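(* Let $\mathbf{C}^-:=\inf_{F\in\mathcal{H}_{\pi\Delta},F\ne0}\|F\|_{L^2(\mathbb{R},W)}/\|F\|_{L^2(\mathbb{R})}$ and $\mathbf{C}^+:=\sup_{F\in\mathcal{H}_{\pi\Delta},F\ne0}\|F\|_{L^2(\mathbb{R},W)}/\|F\|_{L^2(\mathbb{R})}$, where $W(x)=1-\frac{\sin 2\pi x}{2\pi x}$. (i) For $0<\Delta\le1$: $\mathbf{C}^-=\sqrt{1-\frac{\Delta}{2}}$ and $\mathbf{C}^+=1$. (ii) For $1<\Delta\le2$, let $\eta^+$ and $\eta^-$ be the largest and the smallest real solutions $\eta$ of \[ \left(\tfrac{1}{2}+\tfrac{2-\Delta}{4\eta}\right)\cos\left(\tfrac{\Delta-1}{2\eta}\right)+\sin\left(\tfrac{\Delta-1}{2\eta}\right) = 1. \] Then $\mathbf{C}^-=\sqrt{1-\eta^+}$ and $\mathbf{C}^+=\sqrt{1-\eta^-}$.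
   Context: $\mathcal{H}_{\pi\Delta}$ is the space of entire functions of exponential type at most $\pi\Delta$ that are square-integrable on $\mathbb{R}$; $\|F\|^2_{L^2(\mathbb{R},W)}=\int_{\mathbb{R}}|F(x)|^2W(x)\,dx$. *)

(* Defs.v *)
From Stdlib Require Import Reals.
From Coquelicot Require Import Coquelicot.
Open Scope R_scope.

Definition entire (F : C -> C) : Prop :=
  forall z : C, ex_derive (K := C_AbsRing) F z.

Definition exp_type_le (tau : R) (F : C -> C) : Prop :=
  forall eps : R, 0 < eps ->
    exists A : R, forall z : C, Cmod (F z) <= A * exp ((tau + eps) * Cmod z).

Definition int_R (f : R -> R) : R :=
  RInt_gen f (Rbar_locally m_infty) (Rbar_locally p_infty).

Definition sq_int_R (F : C -> C) : Prop :=
  ex_RInt_gen (fun x : R => Cmod (F (RtoC x)) ^ 2)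
    (Rbar_locally m_infty) (Rbar_locally p_infty).

Definition PW (Delta : R) (F : C -> C) : Prop :=
  entire F /\ exp_type_le (PI * Delta) F /\ sq_int_R F.

(* W(x) = 1 - sin(2 pi x)/(2 pi x), with the removable singularity W(0) = 0 *)
Definition W (x : R) : R :=
  1 - (if Req_EM_T x 0 then 1 else sin (2 * PI * x) / (2 * PI * x)).

Definition L2norm (F : C -> C) : R :=
  sqrt (int_R (fun x => Cmod (F (RtoC x)) ^ 2)).
Definition L2Wnorm (F : C -> C) : R :=
  sqrt (int_R (fun x => Cmod (F (RtoC x)) ^ 2 * W x)).

Definition ratios (Delta : R) (r : R) : Prop :=
  exists F : C -> C, PW Delta F /\ (exists z : C, F z <> 0) /\
    r = L2Wnorm F / L2norm F.

Definition C_lower (Delta : R) : Rbar := Glb_Rbar (ratios Delta).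
Definition C_upper (Delta : R) : Rbar := Lub_Rbar (ratios Delta).

Definition eta_eq (Delta eta : R) : Prop :=
  eta <> 0 /\
  (1/2 + (2 - Delta) / (4 * eta)) * cos ((Delta - 1) / (2 * eta))
    + sin ((Delta - 1) / (2 * eta)) = 1.

(* Main.v *)
Require Import Defs.
From Stdlib Require Import Reals Lra Lia Factorial.
From Coquelicot Require Import Coquelicot.
Open Scope R_scope.

(** Let [F] be band-limited with spectral density [f], supported in [[-a, a]], [a = Delta / 2].
    Plancherel's formula gives [int |F|^2 = int |f|^2], and since [sin (2 pi x) / (2 pi x)] is the
    Fourier transform of half the indicator of [[-1, 1]], [int |F|^2 (1 - W)] is the quadratic form
    of the operator [f |-> 1/2 int_{|s - t| < 1} f] on [[-a, a]]. So [1 - C^2] is the top, resp.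
    the bottom, of its spectrum. For [a <= 1/2] the operator is [1/2 (int f)]; for [a > 1/2] its
    eigenvalue equation is a rotation system on the two outer parts of [[-a, a]], coupled by linear
    boundary conditions whose determinant vanishes exactly when [eta_eq] holds.

    That the spectrum of an entire [F] of type [tau], integrable on the line, lies in
    [[-tau, tau]] is seen on the Laplace transform of [F] along the positive axis: by Cauchy's
    theorem it equals, for large argument, the transform along the negative imaginary axis, and both
    are analytic, so they agree up to the boundary; the same computation on the negative axis
    cancels it. General [F] are reduced to integrable ones by a dilation and a multiplier. The
    Riemann integral suffices because only continuous functions occur. *)

(** An arbitrary [F] in the space has only a square-integrable spectral density, and none is ever
    constructed. What passes to [F] is an inequality: if [al * nrm + be * qform] is nonnegative on
    continuous densities, the corresponding weighted integral of [|F|^2] is nonnegative, because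
    this survives the limit of integrable approximants. Sharpness comes from an explicit continuous
    extremal density, cut off near the ends of the interval since it need not vanish there.

    That [eta_eq] has a largest and a smallest root is not read off the transcendental equation.
    Every root has an eigenfunction, hence is a Rayleigh quotient; conversely the supremum of the
    quotients of plus or minus the form must be a root, for otherwise [eta - avg] would be bounded
    below and the supremum could be lowered. No compactness is used. The argument asks only that the
    supremum be positive, which one explicit root of each sign provides.

    Inversion of Fourier integrals is obtained by Abel means: they converge for every continuous
    integrable function, and either nonnegativity or compact support of the transform removes the
    damping factor. *)

Definition cont (f : R -> R) : Prop := forall x, continuous f x.

Lemma cont_const c : cont (fun _ => c).
Proof. intro x; apply continuous_const. Qed.
Lemma cont_id : cont (fun x => x).
Proof. intro x; apply continuous_id. Qed.
Lemma cont_plus f g : cont f -> cont g -> cont (fun x => f x + g x).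
Proof. intros Hf Hg x; exact (continuous_plus f g x (Hf x) (Hg x)). Qed.
Lemma cont_minus f g : cont f -> cont g -> cont (fun x => f x - g x).
Proof. intros Hf Hg x; exact (continuous_minus f g x (Hf x) (Hg x)). Qed.
Lemma cont_opp f : cont f -> cont (fun x => - f x).
Proof. intros Hf x; exact (continuous_opp f x (Hf x)). Qed.
Lemma cont_mult f g : cont f -> cont g -> cont (fun x => f x * g x).
Proof. intros Hf Hg x; exact (continuous_mult f g x (Hf x) (Hg x)). Qed.
Lemma cont_comp f g : cont f -> cont g -> cont (fun x => f (g x)).
Proof. intros Hf Hg x; exact (continuous_comp g f x (Hg x) (Hf (g x))). Qed.
Lemma cont_abs f : cont f -> cont (fun x => Rabs (f x)).
Proof. intros Hf x; exact (continuous_Rabs_comp f x (Hf x)). Qed.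
Lemma cont_cos f : cont f -> cont (fun x => cos (f x)).
Proof. intros Hf x; exact (continuous_cos_comp f x (Hf x)). Qed.
Lemma cont_sin f : cont f -> cont (fun x => sin (f x)).
Proof. intros Hf x; exact (continuous_sin_comp f x (Hf x)). Qed.
Lemma cont_exp f : cont f -> cont (fun x => exp (f x)).
Proof. intros Hf x; exact (continuous_exp_comp f x (Hf x)). Qed.
Lemma cont_pow f n : cont f -> cont (fun x => f x ^ n).
Proof.
intros Hf; induction n as [|n IH]; simpl; [apply cont_const | now apply cont_mult].
Qed.
Lemma cont_ext f g : (forall x, f x = g x) -> cont f -> cont g.
Proof. intros E Hf x; apply (continuous_ext f g x E (Hf x)). Qed.
Lemma cont_Rmax f g : cont f -> cont g -> cont (fun x => Rmax (f x) (g x)).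
Proof.
intros Hf Hg.
apply (cont_ext (fun x => (f x + g x + Rabs (f x - g x)) * / 2)).
  intro x; unfold Rmax, Rabs; destruct (Rcase_abs _), (Rle_dec _ _); lra.
apply cont_mult; [|apply cont_const].
apply cont_plus; [now apply cont_plus | now apply cont_abs, cont_minus].
Qed.
Lemma cont_Rmin f g : cont f -> cont g -> cont (fun x => Rmin (f x) (g x)).
Proof.
intros Hf Hg.
apply (cont_ext (fun x => - Rmax (- f x) (- g x))).
  intro x; unfold Rmax, Rmin; destruct (Rle_dec _ _), (Rle_dec _ _); lra.
now apply cont_opp, cont_Rmax; apply cont_opp.
Qed.
Lemma cont_inv f : cont f -> (forall x, f x <> 0) -> cont (fun x => / f x).
Proof. intros Hf H0 x; exact (continuous_Rinv_comp f x (Hf x) (H0 x)). Qed.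

Ltac solve_cont :=
  unfold Rdiv;
  repeat match goal with
  | H : cont ?f |- cont ?f => exact H
  | |- cont (fun _ => ?c) => exact (cont_const c)
  | |- cont (fun x => x) => exact cont_id
  | |- cont (fun x => @?f x + @?g x) => apply (cont_plus f g)
  | |- cont (fun x => @?f x - @?g x) => apply (cont_minus f g)
  | |- cont (fun x => @?f x * @?g x) => apply (cont_mult f g)
  | |- cont (fun x => - @?f x) => apply (cont_opp f)
  | |- cont (fun x => Rabs (@?f x)) => apply (cont_abs f)
  | |- cont (fun x => cos (@?f x)) => apply (cont_cos f)
  | |- cont (fun x => sin (@?f x)) => apply (cont_sin f)
  | |- cont (fun x => exp (@?f x)) => apply (cont_exp f)
  | |- cont (fun x => @?f x ^ ?n) => apply (cont_pow f n)
  | |- cont (fun x => Rmax (@?f x) (@?g x)) => apply (cont_Rmax f g)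
  | |- cont (fun x => Rmin (@?f x) (@?g x)) => apply (cont_Rmin f g)
  | H : cont ?f |- cont (fun x => ?f (@?g x)) => apply (cont_comp f g H)
  end.

Lemma cont_eps f x : continuous f x <->
  (forall e, 0 < e -> exists d, 0 < d /\ forall y, Rabs (y - x) < d -> Rabs (f y - f x) < e).
Proof.
split.
- intros H e He.
  destruct (proj1 (filterlim_locally f (f x)) H (mkposreal e He)) as [d Hd].
  exists d; split; [apply cond_pos|].
  intros y Hy; exact (Hd y Hy).
- intros H; apply filterlim_locally; intros [e He].
  destruct (H e He) as (d & Hd & H').
  exists (mkposreal d Hd); intros y Hy; exact (H' y Hy).
Qed.

(** * Integrals of continuous functions *)

(** The alias fixes the codomain of [RInt] to [R], so that rewriting does not have to infer a normed
    module. *)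
Definition Int (f : R -> R) (a b : R) : R := RInt f a b.

Lemma ex_RInt_of_cont f a b : cont f -> ex_RInt f a b.
Proof. intros H; apply (ex_RInt_continuous f a b); intros; apply H. Qed.

Lemma Int_add f g a b : cont f -> cont g ->
  Int (fun x => f x + g x) a b = Int f a b + Int g a b.
Proof. intros; apply (RInt_plus f g); now apply ex_RInt_of_cont. Qed.
Lemma Int_sub f g a b : cont f -> cont g ->
  Int (fun x => f x - g x) a b = Int f a b - Int g a b.
Proof. intros; apply (RInt_minus f g); now apply ex_RInt_of_cont. Qed.
Lemma Int_mulc c f a b : cont f -> Int (fun x => c * f x) a b = c * Int f a b.
Proof. intros; apply (RInt_scal f); now apply ex_RInt_of_cont. Qed.
Lemma Int_neg f a b : cont f -> Int (fun x => - f x) a b = - Int f a b.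
Proof. intros; apply (RInt_opp f); now apply ex_RInt_of_cont. Qed.
Lemma Int_cst c a b : Int (fun _ => c) a b = (b - a) * c.
Proof. apply (RInt_const a b c). Qed.
Lemma Int_concat f a b c : cont f -> Int f a b + Int f b c = Int f a c.
Proof. intros; apply (RInt_Chasles f); now apply ex_RInt_of_cont. Qed.
Lemma Int_same (f : R -> R) a : Int f a a = 0.
Proof. apply (RInt_point a f). Qed.
Lemma Int_rev f a b : cont f -> Int f a b = - Int f b a.
Proof. intros H; pose proof (Int_concat f a b a H); rewrite Int_same in H0; lra. Qed.

Lemma Int_eq (f g : R -> R) a b : a <= b -> (forall x, a <= x <= b -> f x = g x) ->
  Int f a b = Int g a b.
Proof.
intros Hab H; apply (RInt_ext f g); intros x; rewrite Rmin_left, Rmax_right by lra.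
intros; apply H; lra.
Qed.
Lemma Int_eq_open (f g : R -> R) a b : a <= b -> (forall x, a < x < b -> f x = g x) ->
  Int f a b = Int g a b.
Proof.
intros Hab H; apply (RInt_ext f g); intros x; rewrite Rmin_left, Rmax_right by lra.
intros; apply H; lra.
Qed.
Lemma Int_eq_all (f g : R -> R) a b : (forall x, f x = g x) -> Int f a b = Int g a b.
Proof. intros H; apply (RInt_ext f g); auto. Qed.

Lemma Int_mono f g a b : a <= b -> cont f -> cont g ->
  (forall x, a <= x <= b -> f x <= g x) -> Int f a b <= Int g a b.
Proof.
intros Hab Hf Hg H; apply RInt_le; auto; try now apply ex_RInt_of_cont.
intros x Hx; apply H; lra.
Qed.
Lemma Int_pos f a b : a <= b -> cont f -> (forall x, a <= x <= b -> 0 <= f x) ->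
  0 <= Int f a b.
Proof.
intros Hab Hf H; apply RInt_ge_0; auto; [now apply ex_RInt_of_cont|].
intros x Hx; apply H; lra.
Qed.
Lemma Int_abs_bound f g a b : a <= b -> cont f -> cont g ->
  (forall x, a <= x <= b -> Rabs (f x) <= g x) -> Rabs (Int f a b) <= Int g a b.
Proof.
intros Hab Hf Hg H.
eapply Rle_trans; [apply abs_RInt_le; auto; now apply ex_RInt_of_cont|].
apply Int_mono; auto; now apply cont_abs.
Qed.
Lemma Int_widen f a b c d : cont f -> (forall x, 0 <= f x) ->
  c <= a -> a <= b -> b <= d -> Int f a b <= Int f c d.
Proof.
intros Hf H0 H1 H2 H3.
rewrite <- (Int_concat f c a d), <- (Int_concat f a b d) by auto.
assert (0 <= Int f c a) by (apply Int_pos; auto).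
assert (0 <= Int f b d) by (apply Int_pos; auto).
lra.
Qed.

Lemma Int_lin f u v a b : cont f ->
  u * Int (fun x => f (u * x + v)) a b = Int f (u * a + v) (u * b + v).
Proof.
intros Hf; unfold Int at 2; rewrite <- (RInt_comp_lin f u v a b) by now apply ex_RInt_of_cont.
rewrite <- Int_mulc by solve_cont; reflexivity.
Qed.
Lemma Int_shift f v a b : cont f ->
  Int (fun x => f (x + v)) a b = Int f (a + v) (b + v).
Proof.
intros Hf; pose proof (Int_lin f 1 v a b Hf) as E.
rewrite !Rmult_1_l in E; rewrite <- E; apply Int_eq_all; intro; f_equal; ring.
Qed.
Lemma Int_reflect f a b : cont f -> Int (fun x => f (- x)) a b = Int f (- b) (- a).
Proof.
intros Hf; pose proof (Int_lin f (-1) 0 a b Hf) as E.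
rewrite (Int_rev f (- b) (- a)) by auto.
replace (-1 * a + 0) with (- a) in E by ring.
replace (-1 * b + 0) with (- b) in E by ring.
rewrite <- E.
rewrite (Int_eq_all (fun x => f (-1 * x + 0)) (fun x => f (- x))); [ring|].
intro; f_equal; ring.
Qed.
Lemma Int_sym f n : cont f -> Int f (- n) n = Int (fun x => f x + f (- x)) 0 n.
Proof.
intros Hf; rewrite Int_add by solve_cont.
rewrite Int_reflect, Ropp_0 by auto.
rewrite <- (Int_concat f (- n) 0 n) by auto; ring.
Qed.

Lemma is_derive_primitive f a x : cont f -> is_derive (fun y => Int f a y) x (f x).
Proof.
intros Hf; apply (is_derive_RInt f (fun y => Int f a y) a x); [|apply Hf].
apply filter_forall; intro y; apply (RInt_correct f); now apply ex_RInt_of_cont.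
Qed.
Lemma cont_derivable (f df : R -> R) : (forall x, is_derive f x (df x)) -> cont f.
Proof.
intros H x; apply (ex_derive_continuous f x); exists (df x); apply H.
Qed.
Lemma cont_primitive f a : cont f -> cont (fun y => Int f a y).
Proof. intros Hf; apply (cont_derivable _ f); intro; now apply is_derive_primitive. Qed.
Lemma Int_primitive (F f : R -> R) a b : (forall x, is_derive F x (f x)) -> cont f ->
  Int f a b = F b - F a.
Proof.
intros H Hf; apply (is_RInt_unique f a b (F b - F a)).
apply (is_RInt_derive F f); auto.
Qed.
Lemma eq_of_derive_eq (f g df : R -> R) x0 : (forall x, is_derive f x (df x)) ->
  (forall x, is_derive g x (df x)) -> f x0 = g x0 -> forall x, f x = g x.
Proof.
intros Hf Hg E x.
assert (H : forall y, is_derive (fun z => f z - g z) y 0).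
  intro y; replace 0 with (df y - df y) by ring. now apply (is_derive_minus f g).
pose proof (Int_primitive (fun z => f z - g z) (fun _ => 0) x0 x H (cont_const 0)) as P.
rewrite Int_cst in P; lra.
Qed.

(** * Joint continuity, parameter integrals and Fubini's theorem *)

Definition cont2 (k : R -> R -> R) : Prop := forall x y, continuity_2d_pt k x y.

Lemma cont_continuity_pt f x : cont f -> continuity_pt f x.
Proof. intros H; apply continuity_pt_filterlim, H. Qed.
Lemma cont2_const c : cont2 (fun _ _ => c).
Proof. intros x y; apply continuity_2d_pt_const. Qed.
Lemma cont2_fst : cont2 (fun x _ => x).
Proof. intros x y; apply continuity_2d_pt_id1. Qed.
Lemma cont2_snd : cont2 (fun _ y => y).
Proof. intros x y; apply continuity_2d_pt_id2. Qed.
Lemma cont2_plus f g : cont2 f -> cont2 g -> cont2 (fun x y => f x y + g x y).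
Proof. intros Hf Hg x y; now apply continuity_2d_pt_plus. Qed.
Lemma cont2_minus f g : cont2 f -> cont2 g -> cont2 (fun x y => f x y - g x y).
Proof. intros Hf Hg x y; now apply continuity_2d_pt_minus. Qed.
Lemma cont2_opp f : cont2 f -> cont2 (fun x y => - f x y).
Proof. intros Hf x y; now apply continuity_2d_pt_opp. Qed.
Lemma cont2_mult f g : cont2 f -> cont2 g -> cont2 (fun x y => f x y * g x y).
Proof. intros Hf Hg x y; now apply continuity_2d_pt_mult. Qed.
Lemma cont2_comp f k : cont f -> cont2 k -> cont2 (fun x y => f (k x y)).
Proof.
intros Hf Hk x y; apply continuity_1d_2d_pt_comp; [now apply cont_continuity_pt | apply Hk].
Qed.
Lemma cont2_cos k : cont2 k -> cont2 (fun x y => cos (k x y)).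
Proof. apply (cont2_comp cos); apply cont_cos, cont_id. Qed.
Lemma cont2_sin k : cont2 k -> cont2 (fun x y => sin (k x y)).
Proof. apply (cont2_comp sin); apply cont_sin, cont_id. Qed.
Lemma cont2_exp k : cont2 k -> cont2 (fun x y => exp (k x y)).
Proof. apply (cont2_comp exp); apply cont_exp, cont_id. Qed.

Ltac solve_cont2 :=
  unfold Rdiv;
  repeat match goal with
  | H : cont2 ?f |- cont2 ?f => exact H
  | |- cont2 (fun _ _ => ?c) => exact (cont2_const c)
  | |- cont2 (fun x _ => x) => exact cont2_fst
  | |- cont2 (fun _ y => y) => exact cont2_snd
  | |- cont2 (fun x y => @?f x y + @?g x y) => apply (cont2_plus f g)
  | |- cont2 (fun x y => @?f x y - @?g x y) => apply (cont2_minus f g)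
  | |- cont2 (fun x y => @?f x y * @?g x y) => apply (cont2_mult f g)
  | |- cont2 (fun x y => - @?f x y) => apply (cont2_opp f)
  | |- cont2 (fun x y => cos (@?f x y)) => apply (cont2_cos f)
  | |- cont2 (fun x y => sin (@?f x y)) => apply (cont2_sin f)
  | |- cont2 (fun x y => exp (@?f x y)) => apply (cont2_exp f)
  | H : cont ?f |- cont2 (fun x y => ?f (@?g x y)) => apply (cont2_comp f g H)
  end.

Lemma cont2_slice_l k y : cont2 k -> cont (fun x => k x y).
Proof.
intros Hk x; apply cont_eps; intros e He.
destruct (Hk x y (mkposreal e He)) as [d Hd].
exists d; split; [apply cond_pos|]; intros z Hz; apply (Hd z y); auto.
rewrite Rminus_eq_0, Rabs_R0; apply cond_pos.
Qed.
Lemma cont2_slice_r k x : cont2 k -> cont (k x).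
Proof.
intros Hk y; apply cont_eps; intros e He.
destruct (Hk x y (mkposreal e He)) as [d Hd].
exists d; split; [apply cond_pos|]; intros z Hz; apply (Hd x z); auto.
rewrite Rminus_eq_0, Rabs_R0; apply cond_pos.
Qed.

Lemma cont_Int_param k a b : cont2 k -> cont (fun x => Int (k x) a b).
Proof.
intros Hk.
assert (Hle : forall a b, a <= b -> cont (fun x => Int (k x) a b)).
  clear a b; intros a b Hab x; apply cont_eps; intros e He.
  assert (He' : 0 < e / (b - a + 1)) by (apply Rdiv_lt_0_compat; lra).
  destruct (uniform_continuity_2d_1d' k a b x (fun t _ => Hk x t) (mkposreal _ He'))
    as [d Hd].
  exists d; split; [apply cond_pos|]; intros y Hy; apply Rabs_def2 in Hy.
  pose proof (cond_pos d).
  rewrite <- Int_sub by (now apply cont2_slice_r).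
  apply Rle_lt_trans with (Int (fun _ => e / (b - a + 1)) a b).
    apply Int_abs_bound; auto.
    - apply cont_minus; now apply cont2_slice_r.
    - apply cont_const.
    - intros t Ht; apply Rlt_le; apply (Hd t x t y); auto; try lra.
      rewrite Rminus_eq_0, Rabs_R0; lra.
  rewrite Int_cst.
  apply Rmult_lt_reg_r with (b - a + 1); [lra|].
  field_simplify; [|lra]; nra.
destruct (Rle_dec a b) as [H|H]; [now apply Hle|].
apply (cont_ext (fun x => - Int (k x) b a)).
  intro x; symmetry; apply Int_rev; now apply cont2_slice_r.
apply cont_opp, Hle; lra.
Qed.

(** As functions of [d] both sides vanish at [c] and have the same derivative, by differentiation
    under the integral sign on one of them; no double integral is introduced. *)
Lemma Fubini k a b c d : cont2 k ->
  Int (fun y => Int (fun x => k x y) a b) c d = Int (fun x => Int (k x) c d) a b.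
Proof.
intros Hk.
assert (Hk' : cont2 (fun y x => k x y)).
  intros y x; intro e; destruct (Hk x y e) as [r Hr]; exists r; intros; now apply Hr.
revert d.
apply (eq_of_derive_eq _ _ (fun y => Int (fun x => k x y) a b) c).
- intro y; apply (is_derive_primitive (fun y => Int (fun x => k x y) a b)).
  now apply (cont_Int_param (fun y x => k x y)).
- intro y.
  assert (E : forall x z, Derive (fun u => Int (k x) c u) z = k x z).
    intros x z; apply is_derive_unique, is_derive_primitive; now apply cont2_slice_r.
  replace (Int (fun x => k x y) a b)
    with (Int (fun x => Derive (fun u => Int (k x) c u) y) a b)
    by (apply Int_eq_all; intro; apply E).
  apply (is_derive_RInt_param (fun u x => Int (k x) c u) a b y).
  + apply filter_forall; intros z x _; exists (k x z).
    apply is_derive_primitive; now apply cont2_slice_r.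
  + intros x _; apply (continuity_2d_pt_ext (fun u v => k v u)).
      intros; symmetry; apply E.
    apply Hk'.
  + apply filter_forall; intro z; apply ex_RInt_of_cont.
    now apply (cont_Int_param k c z).
- rewrite Int_same. symmetry.
  rewrite (Int_eq_all _ (fun _ => 0)); [rewrite Int_cst; ring|].
  intro; apply Int_same.
Qed.

(** The quadratic form of [s f + t g] is nonnegative; at [s = B], [t = - A] it equals
    [A * (A * D - B ^ 2)]. *)
Lemma Int_Cauchy_Schwarz f g a b : a <= b -> cont f -> cont g ->
  Int (fun x => f x * g x) a b ^ 2
  <= Int (fun x => f x ^ 2) a b * Int (fun x => g x ^ 2) a b.
Proof.
intros Hab Hf Hg.
set (A := Int (fun x => f x ^ 2) a b); set (B := Int (fun x => f x * g x) a b).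
set (D := Int (fun x => g x ^ 2) a b).
assert (H : forall s t, 0 <= s ^ 2 * A + 2 * s * t * B + t ^ 2 * D).
  intros s t.
  replace (s ^ 2 * A + 2 * s * t * B + t ^ 2 * D)
    with (Int (fun x => (s * f x + t * g x) ^ 2) a b).
    apply Int_pos; auto; [solve_cont|intros; apply pow2_ge_0].
  rewrite (Int_eq_all _ (fun x => s ^ 2 * f x ^ 2 + 2 * s * t * (f x * g x)
    + t ^ 2 * g x ^ 2)) by (intro; ring).
  rewrite !Int_add, !Int_mulc by solve_cont. reflexivity.
assert (HA : 0 <= A) by (pose proof (H 1 0); lra).
pose proof (H B (- A)) as H1.
destruct (Req_dec A 0) as [E|NE].
- rewrite E in *. pose proof (H 0 1).
  destruct (Req_dec B 0) as [EB|NB]; [rewrite EB; nra|].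
  (* When [A = 0] and [B] is nonzero, the form takes the value -1 at this [s] with [t = 1]. *)
  pose proof (H (- (D + 1) / (2 * B)) 1) as H3.
  replace ((- (D + 1) / (2 * B)) ^ 2 * 0 + 2 * (- (D + 1) / (2 * B)) * 1 * B + 1 ^ 2 * D)
    with (-1) in H3 by (field; auto). lra.
- assert (0 < A) by lra.
  assert (0 <= A * (A * D - B ^ 2)) by (ring_simplify in H1; ring_simplify; lra).
  apply Rmult_le_reg_l with A; auto; lra.
Qed.

(** * Absolutely convergent integrals on the half-line *)

Definition L1_bound (g : R -> R) (M : R) : Prop :=
  forall N, 0 <= N -> Int (fun x => Rabs (g x)) 0 N <= M.
Definition L1 (g : R -> R) : Prop := cont g /\ exists M, L1_bound g M.

(** Total through [real] and [Lim_seq]; for [L1] integrands it is the improper integral by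
    [J_is_lim], and there integer upper limits suffice. *)
Definition J (g : R -> R) : R := real (Lim_seq (fun n => Int g 0 (INR n))).

Lemma L1_cont g : L1 g -> cont g.
Proof. now intros []. Qed.

Lemma L1_bound_nonneg g M : L1_bound g M -> 0 <= M.
Proof. intros H; pose proof (H 0 (Rle_refl 0)) as H0; now rewrite Int_same in H0. Qed.

Lemma L1_dominated f g B : cont f -> L1 g ->
  (forall x, 0 <= x -> Rabs (f x) <= B * Rabs (g x)) -> L1 f.
Proof.
intros Hf [Hg [M HM]] H; split; auto.
exists (Rabs B * M); intros N HN.
apply Rle_trans with (Int (fun x => Rabs B * Rabs (g x)) 0 N).
- apply Int_mono; auto; [solve_cont..|].
  intros x Hx; eapply Rle_trans; [apply H; lra|].
  apply Rmult_le_compat_r; [apply Rabs_pos|apply Rle_abs].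
- rewrite Int_mulc by solve_cont.
  apply Rmult_le_compat_l; [apply Rabs_pos|auto].
Qed.

Lemma L1_plus f g : L1 f -> L1 g -> L1 (fun x => f x + g x).
Proof.
intros [Hf [M HM]] [Hg [M' HM']]; split; [solve_cont|].
exists (M + M'); intros N HN.
apply Rle_trans with (Int (fun x => Rabs (f x) + Rabs (g x)) 0 N).
- apply Int_mono; auto; [solve_cont..|]; intros; apply Rabs_triang.
- rewrite Int_add by solve_cont; apply Rplus_le_compat; auto.
Qed.
Lemma L1_mulc c f : L1 f -> L1 (fun x => c * f x).
Proof.
intros Hf; apply (L1_dominated _ f (Rabs c)); auto.
- apply cont_mult; [apply cont_const|now apply L1_cont].
- intros; rewrite Rabs_mult; lra.
Qed.
Lemma L1_ext f g : (forall x, f x = g x) -> L1 f -> L1 g.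
Proof.
intros E Hf; apply (L1_dominated _ f 1); auto.
- apply (cont_ext f); auto; now apply L1_cont.
- intros; rewrite E; lra.
Qed.
Lemma L1_minus f g : L1 f -> L1 g -> L1 (fun x => f x - g x).
Proof.
intros Hf Hg; apply (L1_ext (fun x => f x + (-1) * g x)); [intro; ring|].
apply L1_plus; auto; now apply L1_mulc.
Qed.
Lemma L1_abs f : L1 f -> L1 (fun x => Rabs (f x)).
Proof.
intros Hf; apply (L1_dominated _ f 1); auto.
- apply cont_abs; now apply L1_cont.
- intros; rewrite Rabs_Rabsolu; lra.
Qed.
Lemma L1_mult_bounded f k : L1 f -> cont k -> (forall x, Rabs (k x) <= 1) ->
  L1 (fun x => f x * k x).
Proof.
intros Hf Hk H; apply (L1_dominated _ f 1); auto.
- apply cont_mult; auto; now apply L1_cont.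
- intros; rewrite Rabs_mult, Rmult_comm; apply Rmult_le_compat_r; auto; apply Rabs_pos.
Qed.

(** Writing [g] as [(|g| + g) - |g|] leaves two nonnegative integrands below [2 * |g|], whose
    integrals increase and stay bounded. *)
Lemma J_is_lim g : L1 g -> is_lim_seq (fun n => Int g 0 (INR n)) (J g).
Proof.
intros [Hg [M HM]].
assert (Hex : forall h, cont h -> (forall x, 0 <= h x) ->
  (forall x, h x <= 2 * Rabs (g x)) -> ex_finite_lim_seq (fun n => Int h 0 (INR n))).
  intros h Hh H0 H2; apply (ex_finite_lim_seq_incr _ (2 * M)).
  - intro n; apply Int_widen; auto; try lra; [apply pos_INR|].
    apply le_INR; lia.
  - intro n; apply Rle_trans with (Int (fun x => 2 * Rabs (g x)) 0 (INR n)).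
    + apply Int_mono; auto; [apply pos_INR|solve_cont].
    + rewrite Int_mulc by solve_cont.
      apply Rmult_le_compat_l; [lra|]; apply HM, pos_INR.
destruct (Hex (fun x => Rabs (g x) + g x)) as [l1 Hl1].
- solve_cont.
- intro x; pose proof (Rle_abs (- g x)); rewrite Rabs_Ropp in H; lra.
- intro x; pose proof (Rle_abs (g x)); lra.
destruct (Hex (fun x => Rabs (g x))) as [l2 Hl2].
- solve_cont.
- intro x; apply Rabs_pos.
- intro x; pose proof (Rabs_pos (g x)); lra.
assert (Hl : is_lim_seq (fun n => Int g 0 (INR n)) (l1 - l2)).
  apply (is_lim_seq_ext (fun n => Int (fun x => Rabs (g x) + g x) 0 (INR n)
    - Int (fun x => Rabs (g x)) 0 (INR n))).
    intro n; rewrite Int_add by solve_cont; ring.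
  now apply (is_lim_seq_minus' _ _ l1 l2).
unfold J; rewrite (is_lim_seq_unique _ _ Hl); exact Hl.
Qed.

Lemma J_eq g l : is_lim_seq (fun n => Int g 0 (INR n)) (Finite l) -> J g = l.
Proof. intros H; unfold J; now rewrite (is_lim_seq_unique _ _ H). Qed.

Lemma J_plus f g : L1 f -> L1 g -> J (fun x => f x + g x) = J f + J g.
Proof.
intros Hf Hg; apply J_eq.
apply (is_lim_seq_ext (fun n => Int f 0 (INR n) + Int g 0 (INR n))).
  intro n; rewrite Int_add; auto; now apply L1_cont.
apply is_lim_seq_plus'; now apply J_is_lim.
Qed.
Lemma J_minus f g : L1 f -> L1 g -> J (fun x => f x - g x) = J f - J g.
Proof.
intros Hf Hg; apply J_eq.
apply (is_lim_seq_ext (fun n => Int f 0 (INR n) - Int g 0 (INR n))).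
  intro n; rewrite Int_sub; auto; now apply L1_cont.
apply is_lim_seq_minus'; now apply J_is_lim.
Qed.
Lemma J_mulc c f : L1 f -> J (fun x => c * f x) = c * J f.
Proof.
intros Hf; apply J_eq.
apply (is_lim_seq_ext (fun n => c * Int f 0 (INR n))).
  intro n; rewrite Int_mulc; auto; now apply L1_cont.
apply (is_lim_seq_scal_l _ c (J f)); now apply J_is_lim.
Qed.
Lemma J_ext f g : (forall x, 0 <= x -> f x = g x) -> J f = J g.
Proof.
intros H; unfold J; f_equal; apply Lim_seq_ext; intro n; apply Int_eq.
- apply pos_INR.
- intros; apply H; lra.
Qed.
Lemma J_0 f : (forall x, 0 <= x -> f x = 0) -> J f = 0.
Proof.
intros H; rewrite (J_ext f (fun _ => 0)) by auto.
apply J_eq, (is_lim_seq_ext (fun _ => 0)); [|apply is_lim_seq_const].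
intro n; rewrite Int_cst; ring.
Qed.

Lemma is_lim_seq_le_const u l M : is_lim_seq u (Finite l) -> (forall n, u n <= M) -> l <= M.
Proof.
intros H Hu; apply (is_lim_seq_le u (fun _ => M) l M); auto; apply is_lim_seq_const.
Qed.

Lemma J_dominated f g : cont f -> L1 g ->
  (forall x, 0 <= x -> Rabs (f x) <= g x) -> Rabs (J f) <= J g.
Proof.
intros Hf Hg H.
assert (Hf1 : L1 f).
  apply (L1_dominated f g 1); auto; intros x Hx.
  eapply Rle_trans; [now apply H|]; rewrite Rmult_1_l; apply Rle_abs.
apply (is_lim_seq_le (fun n => Rabs (Int f 0 (INR n))) (fun n => Int g 0 (INR n))
  (Rabs (J f)) (J g)).
- intro n; apply Int_abs_bound; auto; [apply pos_INR|now apply L1_cont|].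
  intros; apply H; lra.
- apply (is_lim_seq_abs _ (J f)); now apply J_is_lim.
- now apply J_is_lim.
Qed.
Lemma J_abs_bound f M : L1 f -> L1_bound f M -> J (fun x => Rabs (f x)) <= M.
Proof.
intros Hf HM; apply (is_lim_seq_le_const (fun n => Int (fun x => Rabs (f x)) 0 (INR n))).
- apply J_is_lim; now apply L1_abs.
- intro; apply HM, pos_INR.
Qed.
Lemma J_bound f M : cont f -> L1_bound f M -> Rabs (J f) <= M.
Proof.
intros Hf HM; assert (L1 f) by (split; eauto).
eapply Rle_trans; [apply (J_dominated f (fun x => Rabs (f x))); auto|now apply J_abs_bound].
- now apply L1_abs.
- intros; lra.
Qed.

Lemma is_lim_seq_eps u l : is_lim_seq u (Finite l) ->
  forall e, 0 < e -> exists n0, forall n, (n0 <= n)%nat -> Rabs (u n - l) < e.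
Proof. intros H e He; exact (proj2 (is_lim_seq_spec u l) H (mkposreal e He)). Qed.

Lemma L1_tail g : L1 g -> forall e, 0 < e ->
  exists A, 0 < A /\ forall N N', A <= N -> N <= N' -> Int (fun x => Rabs (g x)) N N' <= e.
Proof.
intros Hg e He; pose proof (L1_abs g Hg) as Ha; assert (Hc := L1_cont g Hg).
pose proof (J_is_lim _ Ha) as Hl.
destruct (is_lim_seq_eps _ _ Hl e He) as [n0 Hn0].
exists (INR n0 + 1); split; [pose proof (pos_INR n0); lra|].
intros N N' H1 H2.
destruct (nfloor_ex N') as [m Hm]; [pose proof (pos_INR n0); lra|].
apply Rle_trans with (Int (fun x => Rabs (g x)) (INR n0) (INR (m + 1))).
  apply Int_widen; try lra; [solve_cont|intro; apply Rabs_pos|rewrite plus_INR; simpl; lra].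
assert (Hmn : (n0 <= m + 1)%nat).
  apply INR_le; rewrite plus_INR; simpl; lra.
pose proof (Hn0 n0 (Nat.le_refl _)) as Ha1.
assert (Hb : Int (fun x => Rabs (g x)) 0 (INR (m + 1)) <= J (fun x => Rabs (g x))).
  apply (is_lim_seq_incr_compare (fun n => Int (fun x => Rabs (g x)) 0 (INR n))); auto.
  intro n; apply Int_widen; try lra; [solve_cont|intro; apply Rabs_pos|apply pos_INR|].
  apply le_INR; lia.
rewrite <- (Int_concat _ 0 (INR n0)) in Hb by solve_cont.
apply Rabs_def2 in Ha1; lra.
Qed.

(** The stand-in for dominated convergence: [A] depends on [g] and [e] alone, so one cut serves a
    whole family [f] dominated by [B * |g|]. Only smallness on [[0, A]], measured by [eta], remains
    to be checked for each member. *)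
Lemma J_split g M : L1 g -> L1_bound g M -> forall e, 0 < e -> exists A, 0 < A /\
  forall f B eta, cont f -> 0 <= B ->
    (forall x, 0 <= x -> Rabs (f x) <= B * Rabs (g x)) ->
    (forall x, 0 <= x <= A -> Rabs (f x) <= eta * Rabs (g x)) ->
    Rabs (J f) <= Rabs eta * M + B * e.
Proof.
intros Hg HM e He; destruct (L1_tail g Hg e He) as (A & HA & Ht).
exists A; split; auto; intros f B eta Hf HB H1 H2.
assert (Hc := L1_cont g Hg).
apply J_bound; auto; intros N HN.
assert (HM0 := L1_bound_nonneg g M HM).
assert (Hs : forall N, 0 <= N <= A -> Int (fun x => Rabs (f x)) 0 N <= Rabs eta * M).
  intros N' HN'.
  apply Rle_trans with (Int (fun x => Rabs eta * Rabs (g x)) 0 N').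
    apply Int_mono; [lra|solve_cont..|]. intros x Hx; eapply Rle_trans; [apply H2; lra|].
    apply Rmult_le_compat_r; [apply Rabs_pos|apply Rle_abs].
  rewrite Int_mulc by solve_cont; apply Rmult_le_compat_l; [apply Rabs_pos|apply HM; lra].
destruct (Rle_dec N A) as [HNA|HNA].
- pose proof (Hs N (conj HN HNA)). nra.
- rewrite <- (Int_concat _ 0 A) by solve_cont.
  pose proof (Hs A (conj (Rlt_le _ _ HA) (Rle_refl A))).
  assert (Int (fun x => Rabs (f x)) A N <= B * e); [|lra].
  apply Rle_trans with (Int (fun x => B * Rabs (g x)) A N).
    apply Int_mono; [lra|solve_cont..|]; intros; apply H1; lra.
  rewrite Int_mulc by solve_cont; apply Rmult_le_compat_l; auto; apply Ht; lra.
Qed.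

(** * Abel summation of cosine transforms *)

Definition cos_tr (g : R -> R) (t : R) : R := J (fun x => g x * cos (t * x)).

Lemma Rabs_cos_le x : Rabs (cos x) <= 1.
Proof. apply Rabs_le, COS_bound. Qed.
Lemma Rabs_sin_le x : Rabs (sin x) <= 1.
Proof. apply Rabs_le, SIN_bound. Qed.

Lemma Rabs_mult_le_l a k : Rabs k <= 1 -> Rabs (a * k) <= Rabs a.
Proof. intros; rewrite Rabs_mult; pose proof (Rabs_pos a); nra. Qed.

Lemma Rabs_sub_MVT (f df : R -> R) (K : R) : (forall x, is_derive f x (df x)) ->
  (forall x, Rabs (df x) <= K) -> forall x y, Rabs (f y - f x) <= K * Rabs (y - x).
Proof.
intros H HK x y.
destruct (MVT_gen f x y df) as (c & _ & E).
- intros; apply H.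
- intros z _; apply continuity_pt_filterlim, (ex_derive_continuous f z).
  exists (df z); apply H.
- rewrite E, Rabs_mult; apply Rmult_le_compat_r; auto; apply Rabs_pos.
Qed.
Lemma cos_lipschitz x y : Rabs (cos y - cos x) <= Rabs (y - x).
Proof.
rewrite <- (Rmult_1_l (Rabs (y - x))).
apply (Rabs_sub_MVT cos (fun z => - sin z)).
- intro; auto_derive; auto; ring.
- intro; rewrite Rabs_Ropp; apply Rabs_sin_le.
Qed.
Lemma sin_lipschitz x y : Rabs (sin y - sin x) <= Rabs (y - x).
Proof.
rewrite <- (Rmult_1_l (Rabs (y - x))).
apply (Rabs_sub_MVT sin cos).
- intro; auto_derive; auto; ring.
- intro; apply Rabs_cos_le.
Qed.

Lemma L1_cos_kernel g t : L1 g -> L1 (fun x => g x * cos (t * x)).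
Proof. intros H; apply L1_mult_bounded; auto; [solve_cont|intro; apply Rabs_cos_le]. Qed.
Lemma L1_sin_kernel g t : L1 g -> L1 (fun x => g x * sin (t * x)).
Proof. intros H; apply L1_mult_bounded; auto; [solve_cont|intro; apply Rabs_sin_le]. Qed.

(** The Lipschitz bound on [th] controls the head [[0, A]] of [J_split], the bound by 1 controls the
    tail. *)
Lemma cont_J_kernel g (th : R -> R) : L1 g -> cont th -> (forall x, Rabs (th x) <= 1) ->
  (forall x y, Rabs (th y - th x) <= Rabs (y - x)) ->
  cont (fun t => J (fun x => g x * th (t * x))).
Proof.
intros Hg Hth Hb Hl t; apply cont_eps; intros e He.
assert (Hc := L1_cont g Hg); destruct (proj2 Hg) as [M HM].
assert (HM0 := L1_bound_nonneg g M HM).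
assert (He4 : 0 < e / 5) by lra.
destruct (J_split g M Hg HM (e / 5) He4) as (A & HA & Hs).
assert (HMA : 0 < A * (M + 1)) by nra.
exists (e / 5 / (A * (M + 1))); split; [apply Rdiv_lt_0_compat; nra|].
intros t' Ht'.
rewrite <- J_minus by (apply L1_mult_bounded; auto; solve_cont).
apply Rle_lt_trans with (Rabs (A * Rabs (t' - t)) * M + 2 * (e / 5)).
- apply Hs; try lra; [solve_cont| |].
  + intros x Hx.
    replace (g x * th (t' * x) - g x * th (t * x))
      with ((th (t' * x) - th (t * x)) * g x) by ring.
    rewrite Rabs_mult; apply Rmult_le_compat_r; [apply Rabs_pos|].
    eapply Rle_trans; [apply Rabs_triang|]. rewrite Rabs_Ropp.
    pose proof (Hb (t' * x)); pose proof (Hb (t * x)); lra.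
  + intros x Hx.
    replace (g x * th (t' * x) - g x * th (t * x))
      with ((th (t' * x) - th (t * x)) * g x) by ring.
    rewrite Rabs_mult; apply Rmult_le_compat_r; [apply Rabs_pos|].
    eapply Rle_trans; [apply Hl|].
    replace (t' * x - t * x) with (x * (t' - t)) by ring.
    rewrite Rabs_mult, (Rabs_pos_eq x) by lra.
    apply Rmult_le_compat_r; [apply Rabs_pos|lra].
- pose proof (Rabs_pos (t' - t)).
  rewrite (Rabs_pos_eq (A * _)) by nra.
  assert (Rabs (t' - t) * (A * (M + 1)) < e / 5).
    apply Rmult_lt_reg_r with (/ (A * (M + 1))); [now apply Rinv_0_lt_compat|].
    rewrite Rmult_assoc, Rinv_r, Rmult_1_r by lra; exact Ht'.
  nra.
Qed.
Lemma cont_cos_tr g : L1 g -> cont (cos_tr g).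
Proof.
intros Hg; apply (cont_J_kernel g cos); auto.
- apply cont_cos, cont_id.
- apply Rabs_cos_le.
- apply cos_lipschitz.
Qed.
Lemma cos_tr_bound g M t : L1 g -> L1_bound g M -> Rabs (cos_tr g t) <= M.
Proof.
intros Hg HM; assert (Hc := L1_cont g Hg); apply J_bound; [solve_cont|].
intros N HN; eapply Rle_trans; [|apply (HM N HN)].
apply Int_mono; auto; [solve_cont..|]; intros x Hx.
apply Rabs_mult_le_l, Rabs_cos_le.
Qed.

(** The Poisson kernel of the half-plane without its factor [1 / PI]. It appears as the cosine
    integral of [exp (- ep * t)], see [Int_exp_cos], and has mass [PI / 2] on the half-line. *)
Definition poisson (ep x : R) : R := ep / (ep ^ 2 + x ^ 2).

Lemma poisson_denom ep x : 0 < ep -> 0 < ep ^ 2 + x ^ 2.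
Proof. intros; pose proof (pow2_ge_0 x); assert (0 < ep ^ 2) by (apply pow_lt; auto); lra. Qed.
Lemma cont_poisson ep : 0 < ep -> cont (poisson ep).
Proof.
intros H; unfold poisson; apply cont_mult; [apply cont_const|].
apply cont_inv; [solve_cont|]; intro x; pose proof (poisson_denom ep x H); lra.
Qed.
Lemma poisson_pos ep x : 0 < ep -> 0 < poisson ep x.
Proof. intros; apply Rdiv_lt_0_compat; auto; now apply poisson_denom. Qed.
Lemma Int_poisson ep N : 0 < ep -> Int (poisson ep) 0 N = atan (N / ep).
Proof.
intros H.
rewrite (Int_primitive (fun x => atan (x / ep)) (poisson ep)).
- replace (0 / ep) with 0 by (field; lra); rewrite atan_0; ring.
- intro x; pose proof (poisson_denom ep x H); unfold poisson; auto_derive; auto.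
  field; repeat split; try lra.
- now apply cont_poisson.
Qed.
Lemma L1_poisson ep : 0 < ep -> L1 (poisson ep).
Proof.
intros H; split; [now apply cont_poisson|].
exists (PI / 2); intros N HN.
rewrite (Int_eq_all _ (poisson ep)).
- rewrite Int_poisson by auto; apply Rlt_le, atan_bound.
- intro x; apply Rabs_pos_eq, Rlt_le, poisson_pos, H.
Qed.
Lemma L1_mult_poisson g ep : L1 g -> 0 < ep -> L1 (fun x => g x * poisson ep x).
Proof.
intros Hg Hep; pose proof (L1_cont g Hg); pose proof (cont_poisson ep Hep).
apply (L1_dominated _ g (/ ep)); auto; [solve_cont|].
intros x Hx; rewrite Rabs_mult, Rmult_comm; apply Rmult_le_compat_r; [apply Rabs_pos|].
rewrite Rabs_pos_eq by (apply Rlt_le, poisson_pos, Hep).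
unfold poisson; pose proof (poisson_denom ep x Hep); pose proof (pow2_ge_0 x).
apply Rmult_le_reg_r with (ep * (ep ^ 2 + x ^ 2)); [nra|].
field_simplify; lra.
Qed.
Lemma J_poisson ep : 0 < ep -> J (poisson ep) = PI / 2.
Proof.
intros H; apply J_eq, (is_lim_seq_ext (fun n => atan (INR n / ep))).
  intro; now rewrite Int_poisson.
apply is_lim_seq_spec; intros [e He]; simpl.
destruct (nfloor_ex (ep / e)) as [n0 Hn0]; [apply Rlt_le, Rdiv_lt_0_compat; auto|].
exists (n0 + 1)%nat; intros n Hn; apply le_INR in Hn; rewrite plus_INR in Hn; simpl in Hn.
assert (Hn1 : ep / e < INR n) by lra.
assert (0 < ep / e) by (apply Rdiv_lt_0_compat; auto).
assert (Hep : ep < INR n * e).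
  apply Rmult_lt_reg_r with (/ e); [now apply Rinv_0_lt_compat|].
  rewrite Rmult_assoc, Rinv_r, Rmult_1_r by lra; exact Hn1.
replace (INR n / ep) with (/ (ep / INR n)) by (field; lra).
rewrite atan_inv by (apply Rdiv_lt_0_compat; lra).
replace (PI / 2 - atan (ep / INR n) - PI / 2) with (- (atan (ep / INR n) - atan 0))
  by (rewrite atan_0; ring).
rewrite Rabs_Ropp.
eapply Rle_lt_trans; [apply (Rabs_sub_MVT atan (fun x => / (1 + x ^ 2)) 1)|].
- intro x; apply is_derive_Reals, derivable_pt_lim_atan.
- intro x; pose proof (pow2_ge_0 x).
  rewrite Rabs_pos_eq by (apply Rlt_le, Rinv_0_lt_compat; lra).
  rewrite <- Rinv_1; apply Rinv_le_contravar; lra.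
- rewrite Rminus_0_r, Rmult_1_l, Rabs_pos_eq by (apply Rlt_le, Rdiv_lt_0_compat; lra).
  apply Rmult_lt_reg_r with (INR n); [lra|]; field_simplify; lra.
Qed.

(** The Poisson kernel is an approximate identity: its mass [PI / 2] concentrates at 0 as [ep]
    shrinks. *)
Lemma J_poisson_mult g : L1 g -> forall e, 0 < e -> exists ep0, 0 < ep0 /\
  forall ep, 0 < ep < ep0 -> Rabs (J (fun x => g x * poisson ep x) - PI / 2 * g 0) <= e.
Proof.
intros Hg e He; assert (Hc := L1_cont g Hg); destruct (proj2 Hg) as [M HM].
assert (HM0 := L1_bound_nonneg g M HM).
pose proof PI_RGT_0 as HPI; pose proof PI_4 as HPI4.
destruct (proj1 (cont_eps g 0) (Hc 0) (e / 4)) as (d & Hd & Hgd); [lra|].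
set (K := M / d ^ 2 + Rabs (g 0) * (1 + / d ^ 2) * 2).
assert (Hd2 : 0 < / d ^ 2) by (apply Rinv_0_lt_compat, pow_lt, Hd).
assert (HK : 0 <= K).
  unfold K, Rdiv; pose proof (Rabs_pos (g 0)).
  apply Rplus_le_le_0_compat; [nra|]. nra.
exists (e / 2 / (K + 1)); split; [apply Rdiv_lt_0_compat; lra|].
intros ep [Hep Hep0].
assert (HP := L1_poisson ep Hep); assert (HPc := cont_poisson ep Hep).
assert (Hcp1 := cont_poisson 1 Rlt_0_1).
assert (HgP := L1_mult_poisson g ep Hg Hep).
rewrite <- (J_poisson ep Hep), Rmult_comm, <- J_mulc, <- J_minus by (auto using L1_mulc).
(* The first summand dominates on [[0, d)], where [g x] is within [e / 4] of [g 0]. For [x >= d] the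
   kernel is at most [ep / x ^ 2]: the second summand takes the part with [g x], the third the part
   with [g 0], where [/ x ^ 2] is compared with the integrable [poisson 1 x]. [K] is the total
   coefficient of [ep], with [PI / 2] replaced by 2. *)
set (b := fun x => (e / 4) * poisson ep x + ((ep / d ^ 2) * Rabs (g x)
  + (Rabs (g 0) * ep * (1 + / d ^ 2)) * poisson 1 x)).
assert (Hb : L1 b).
  unfold b; apply L1_plus; [now apply L1_mulc|].
  apply L1_plus; apply L1_mulc; [now apply L1_abs|apply L1_poisson; lra].
eapply Rle_trans; [apply (J_dominated _ b); auto|].
- solve_cont.
- intros x Hx; replace (g x * poisson ep x - g 0 * poisson ep x)
    with ((g x - g 0) * poisson ep x) by ring.
  pose proof (poisson_pos ep x Hep) as HPp; pose proof (poisson_pos 1 x Rlt_0_1) as HP1.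
  rewrite Rabs_mult, (Rabs_pos_eq (poisson ep x)) by lra.
  pose proof (Rabs_pos (g x)); pose proof (Rabs_pos (g 0)).
  unfold b; destruct (Rlt_dec x d) as [Hxd|Hxd].
  + assert (Rabs (g x - g 0) < e / 4).
      apply Hgd; rewrite Rminus_0_r, Rabs_pos_eq; lra.
    assert (0 <= ep / d ^ 2 * Rabs (g x)) by (apply Rmult_le_pos; auto; unfold Rdiv; nra).
    assert (0 <= Rabs (g 0) * ep * (1 + / d ^ 2) * poisson 1 x).
      apply Rmult_le_pos; [|lra]; apply Rmult_le_pos; nra.
    nra.
  + assert (Hx0 : 0 < x) by lra.
    assert (Hx2 : 0 < x ^ 2) by (apply pow_lt; lra).
    assert (H1 : poisson ep x <= ep / x ^ 2).
      unfold poisson, Rdiv; apply Rmult_le_compat_l; [lra|].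
      apply Rinv_le_contravar; auto; pose proof (pow2_ge_0 ep); lra.
    assert (H2 : / x ^ 2 <= / d ^ 2).
      apply Rinv_le_contravar; [apply pow_lt; lra|]. apply pow_incr; lra.
    assert (H3 : / x ^ 2 <= (1 + / d ^ 2) * poisson 1 x).
      unfold poisson.
      apply Rmult_le_reg_r with (1 ^ 2 + x ^ 2); [nra|].
      replace ((1 + / d ^ 2) * (1 / (1 ^ 2 + x ^ 2)) * (1 ^ 2 + x ^ 2)) with (1 + / d ^ 2)
        by (field; split; nra).
      replace (/ x ^ 2 * (1 ^ 2 + x ^ 2)) with (/ x ^ 2 + 1) by (field; lra). lra.
    apply Rle_trans with ((Rabs (g x) + Rabs (g 0)) * (ep / x ^ 2)).
      apply Rmult_le_compat; try apply Rabs_pos; try lra.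
      eapply Rle_trans; [apply Rabs_triang|]; rewrite Rabs_Ropp; lra.
    unfold Rdiv in *.
    assert (Rabs (g x) * (ep * / x ^ 2) <= ep * / d ^ 2 * Rabs (g x)) by
      (rewrite (Rmult_comm (ep * / d ^ 2)); apply Rmult_le_compat_l; auto; nra).
    assert (Rabs (g 0) * (ep * / x ^ 2) <= Rabs (g 0) * ep * (1 + / d ^ 2) * poisson 1 x).
      rewrite !Rmult_assoc; apply Rmult_le_compat_l; auto;
      apply Rmult_le_compat_l; lra.
    assert (0 <= e * / 4 * poisson ep x) by nra.
    lra.
- unfold b; rewrite !J_plus, !J_mulc, !J_poisson; try lra;
    auto using L1_plus, L1_mulc, L1_abs, L1_poisson, Rlt_0_1.
  pose proof (J_abs_bound g M Hg HM) as HJ.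
  assert (ep * K <= e / 2).
    assert (ep * (K + 1) <= e / 2); [|nra].
    apply Rmult_le_reg_r with (/ (K + 1)); [apply Rinv_0_lt_compat; lra|].
    rewrite Rmult_assoc, Rinv_r, Rmult_1_r by lra; apply Rlt_le, Hep0.
  assert (ep / d ^ 2 * J (fun x => Rabs (g x)) <= ep * (M / d ^ 2)).
    unfold Rdiv; rewrite (Rmult_comm M), <- Rmult_assoc; apply Rmult_le_compat_l; nra.
  assert (Rabs (g 0) * ep * (1 + / d ^ 2) * (PI / 2)
    <= ep * (Rabs (g 0) * (1 + / d ^ 2) * 2)).
    pose proof (Rabs_pos (g 0)).
    replace (ep * (Rabs (g 0) * (1 + / d ^ 2) * 2))
      with (Rabs (g 0) * ep * (1 + / d ^ 2) * 2) by ring.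
    apply Rmult_le_compat_l; [|lra]; apply Rmult_le_pos; [|lra]; nra.
  unfold K in *; nra.
Qed.

Lemma Int_exp_cos ep x N : 0 < ep ->
  Int (fun t => exp (- ep * t) * cos (t * x)) 0 N
  = poisson ep x + exp (- ep * N) * (x * sin (N * x) - ep * cos (N * x)) / (ep ^ 2 + x ^ 2).
Proof.
intros H; pose proof (poisson_denom ep x H).
rewrite (Int_primitive
  (fun t => exp (- ep * t) * (x * sin (t * x) - ep * cos (t * x)) / (ep ^ 2 + x ^ 2))).
- rewrite Rmult_0_r, Rmult_0_l, exp_0, sin_0, cos_0; unfold poisson; field; lra.
- intro t; auto_derive; auto; field; lra.
- solve_cont.
Qed.

(** Fubini holds on each rectangle [[0, n] x [0, N]]; the tails of the inner integral are bounded
    uniformly in [t] by those of [|g|], which allows [n] to go to infinity. *)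
Lemma Abel_cos_tr_exchange g ep N : L1 g -> 0 < ep -> 0 <= N ->
  Int (fun t => exp (- ep * t) * cos_tr g t) 0 N
  = J (fun x => g x * Int (fun t => exp (- ep * t) * cos (t * x)) 0 N).
Proof.
intros Hg Hep HN; assert (Hc := L1_cont g Hg); destruct (proj2 Hg) as [M HM].
assert (Hcc := cont_cos_tr g Hg).
symmetry; apply J_eq.
apply (is_lim_seq_ext (fun n => Int (fun t => exp (- ep * t) *
  Int (fun x => g x * cos (t * x)) 0 (INR n)) 0 N)).
  intro n.
  transitivity (Int (fun t => Int (fun x => g x * (exp (- ep * t) * cos (t * x)))
    0 (INR n)) 0 N).
    apply Int_eq_all; intro t; rewrite <- Int_mulc by solve_cont.
    apply Int_eq_all; intro; ring.
  rewrite (Fubini (fun x t => g x * (exp (- ep * t) * cos (t * x)))) by solve_cont2.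
  apply Int_eq_all; intro x; apply Int_mulc; solve_cont.
apply is_lim_seq_spec; intros [e He]; simpl.
assert (He' : 0 < e / (N + 1)) by (apply Rdiv_lt_0_compat; lra).
destruct (L1_tail g Hg (e / (N + 1)) He') as (A & HA & Ht).
destruct (nfloor_ex A (Rlt_le _ _ HA)) as [n0 Hn0].
exists (n0 + 1)%nat; intros n Hn.
assert (HnA : A <= INR n).
  apply le_INR in Hn; rewrite plus_INR in Hn; simpl in Hn; lra.
assert (Hpc : cont (fun t => Int (fun x => g x * cos (t * x)) 0 (INR n))).
  apply (cont_Int_param (fun t x => g x * cos (t * x))); solve_cont2.
assert (Hdiff : forall t,
  Rabs (Int (fun x => g x * cos (t * x)) 0 (INR n) - cos_tr g t) <= e / (N + 1)).
  intro t.
  apply (is_lim_seq_le_const (fun m =>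
    Rabs (Int (fun x => g x * cos (t * x)) 0 (INR n)
      - Int (fun x => g x * cos (t * x)) 0 (INR (m + n))))).
  - apply (is_lim_seq_abs _ (Int (fun x => g x * cos (t * x)) 0 (INR n) - cos_tr g t)).
    apply is_lim_seq_minus'; [apply is_lim_seq_const|].
    apply (is_lim_seq_incr_n (fun m => Int (fun x => g x * cos (t * x)) 0 (INR m))).
    apply J_is_lim; now apply L1_cos_kernel.
  - intro m.
    rewrite <- (Int_concat _ 0 (INR n) (INR (m + n))) by solve_cont.
    replace (_ - (_ + _)) with (- Int (fun x => g x * cos (t * x)) (INR n) (INR (m + n)))
      by ring.
    rewrite Rabs_Ropp.
    assert (INR n <= INR (m + n)) by (apply le_INR; lia).
    eapply Rle_trans; [|apply (Ht (INR n) (INR (m + n))); auto].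
    apply Int_abs_bound; auto; [solve_cont..|].
    intros x Hx; apply Rabs_mult_le_l, Rabs_cos_le.
rewrite <- Int_sub by solve_cont.
apply Rle_lt_trans with (Int (fun _ => e / (N + 1)) 0 N).
- apply Int_abs_bound; auto; [solve_cont..|].
  intros t Htt; rewrite <- Rmult_minus_distr_l, Rabs_mult.
  rewrite <- (Rmult_1_l (e / (N + 1))).
  apply Rmult_le_compat; try apply Rabs_pos; auto.
  rewrite Rabs_pos_eq by (apply Rlt_le, exp_pos).
  rewrite <- exp_0; destruct (Rle_lt_or_eq_dec (- ep * t) 0) as [H|H]; [nra| |].
  + apply Rlt_le, exp_increasing, H.
  + rewrite H; lra.
- rewrite Int_cst; apply Rmult_lt_reg_r with (N + 1); [lra|].
  field_simplify; [|lra]; nra.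
Qed.

Lemma exp_le x y : x <= y -> exp x <= exp y.
Proof. intros [H|H]; [now apply Rlt_le, exp_increasing|subst; apply Rle_refl]. Qed.

Lemma exp_decay k : 0 < k -> forall e, 0 < e -> exists N0, 0 <= N0 /\
  forall N, N0 <= N -> exp (- k * N) <= e.
Proof.
intros Hk e He; exists (/ (k * e)); split.
  apply Rlt_le, Rinv_0_lt_compat; nra.
intros N HN.
assert (H : 1 <= k * N * e).
  apply Rmult_le_compat_l with (r := k * e) in HN; [|nra].
  rewrite Rinv_r in HN by nra; lra.
assert (0 < k * N) by nra.
pose proof (exp_ineq1 (k * N)) as H1.
replace (- k * N) with (- (k * N)) by ring; rewrite exp_Ropp.
apply Rmult_le_reg_r with (exp (k * N)); [apply exp_pos|].
rewrite Rinv_l by (pose proof (exp_pos (k * N)); lra).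
assert (k * N < exp (k * N)) by lra. nra.
Qed.

(** After the exchange of integrals [g] is integrated against the Poisson kernel plus a remainder of
    size [exp (- ep * N)]. The remainder is removed by [N] at fixed [ep], so [N0] depends on
    [ep]. *)
Lemma Abel_cos_tr g : L1 g -> forall e, 0 < e -> exists ep0, 0 < ep0 /\
  forall ep, 0 < ep < ep0 -> exists N0, 0 <= N0 /\ forall N, N0 <= N ->
  Rabs (Int (fun t => exp (- ep * t) * cos_tr g t) 0 N - PI / 2 * g 0) <= e.
Proof.
intros Hg e He; assert (Hc := L1_cont g Hg); destruct (proj2 Hg) as [M HM].
assert (HM0 := L1_bound_nonneg g M HM).
destruct (J_poisson_mult g Hg (e / 2)) as (ep0 & Hep0 & H); [lra|].
exists ep0; split; auto; intros ep Hep; destruct (Hep) as [Hep1 _].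
assert (HPc := cont_poisson ep Hep1).
destruct (exp_decay ep Hep1 (e / 2 * ep / (2 * (M + 1)))) as (N0 & HN0 & HN).
  apply Rdiv_lt_0_compat; nra.
exists N0; split; auto; intros N HNN.
rewrite Abel_cos_tr_exchange by (auto; lra).
assert (HgP := L1_mult_poisson g ep Hg Hep1).
set (r := fun x => exp (- ep * N) * (x * sin (N * x) - ep * cos (N * x)) / (ep ^ 2 + x ^ 2)).
(* The factor [2 / ep] bounds [(|x| + ep) / (ep ^ 2 + x ^ 2)]. *)
assert (Hr : forall x, Rabs (g x * r x) <= (exp (- ep * N) * (2 / ep)) * Rabs (g x)).
  intro x; rewrite Rabs_mult, Rmult_comm; apply Rmult_le_compat_r; [apply Rabs_pos|].
  pose proof (poisson_denom ep x Hep1).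
  unfold r, Rdiv; rewrite Rmult_assoc, Rabs_mult, (Rabs_pos_eq (exp _)) by
    (apply Rlt_le, exp_pos).
  apply Rmult_le_compat_l; [apply Rlt_le, exp_pos|].
  rewrite Rabs_mult, (Rabs_pos_eq (/ _)) by (apply Rlt_le, Rinv_0_lt_compat; auto).
  assert (Hs : Rabs (x * sin (N * x) - ep * cos (N * x)) <= Rabs x + ep).
    eapply Rle_trans; [apply Rabs_triang|]; rewrite Rabs_Ropp, !Rabs_mult.
    rewrite (Rabs_pos_eq ep) by lra.
    pose proof (Rabs_sin_le (N * x)); pose proof (Rabs_cos_le (N * x)).
    pose proof (Rabs_pos x); nra.
  apply Rmult_le_reg_r with (ep * (ep ^ 2 + x ^ 2)); [nra|].
  replace (2 * / ep * (ep * (ep ^ 2 + x ^ 2))) with (2 * (ep ^ 2 + x ^ 2)) by (field; lra).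
  match goal with |- ?l <= _ => replace l with
    (Rabs (x * sin (N * x) - ep * cos (N * x)) * ep) by (field; lra) end.
  apply Rle_trans with ((Rabs x + ep) * ep); [apply Rmult_le_compat_r; lra|].
  rewrite <- (pow2_abs x); pose proof (pow2_ge_0 (Rabs x - ep)); nra.
assert (Hrc : cont (fun x => g x * r x)).
  unfold r; apply cont_mult; auto; unfold Rdiv; apply cont_mult; [solve_cont|].
  apply cont_inv; [solve_cont|]; intro x; pose proof (poisson_denom ep x Hep1); lra.
assert (HrL : L1 (fun x => g x * r x)).
  apply (L1_dominated _ g (exp (- ep * N) * (2 / ep))); auto.
rewrite (J_ext _ (fun x => g x * poisson ep x + g x * r x)).
2: { intros x _; rewrite Int_exp_cos by auto; unfold r; ring. }
rewrite J_plus by auto.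
assert (HJr : Rabs (J (fun x => g x * r x)) <= e / 2).
  eapply Rle_trans; [apply (J_dominated _ (fun x => (exp (- ep * N) * (2 / ep)) * Rabs (g x)))|].
  - auto.
  - now apply L1_mulc, L1_abs.
  - intros; apply Hr.
  - rewrite J_mulc by now apply L1_abs.
    pose proof (J_abs_bound g M Hg HM) as HJ.
    specialize (HN N HNN).
    assert (0 < 2 / ep) by (apply Rdiv_lt_0_compat; lra).
    pose proof (exp_pos (- ep * N)).
    apply Rle_trans with (exp (- ep * N) * (2 / ep) * (M + 1)).
      apply Rmult_le_compat_l; nra.
    apply Rle_trans with (e / 2 * ep / (2 * (M + 1)) * (2 / ep) * (M + 1)).
      apply Rmult_le_compat_r; [lra|]; apply Rmult_le_compat_r; lra.
    right; field; lra.
specialize (H ep Hep).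
match goal with |- Rabs (?a + ?b - ?c) <= _ =>
  replace (a + b - c) with ((a - c) + b) by ring end.
eapply Rle_trans; [apply Rabs_triang|]; lra.
Qed.

Lemma exp_neg_le_1 x : 0 <= x -> exp (- x) <= 1.
Proof. intros; rewrite <- exp_0; apply exp_le; lra. Qed.

(** A Tauberian step. For a nonnegative transform the damped integrals lie below the plain ones,
    which gives the lower bound. If some plain integral [X] over [[0, N]] exceeded the limit [L], a
    damping so weak that it hardly changes [[0, N]] would push the damped integrals above [L] as
    well. *)
Lemma cos_tr_inversion_nonneg g : L1 g -> (forall t, 0 <= t -> 0 <= cos_tr g t) ->
  forall e, 0 < e -> exists N0, 0 <= N0 /\ forall N, N0 <= N ->
  PI / 2 * g 0 - e <= Int (cos_tr g) 0 N <= PI / 2 * g 0.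
Proof.
intros Hg Hpos e He; assert (Hcc := cont_cos_tr g Hg).
assert (Hup : forall N, 0 <= N -> Int (cos_tr g) 0 N <= PI / 2 * g 0).
  intros N HN; apply Rnot_lt_le; intro Habs.
  set (X := Int (cos_tr g) 0 N) in *; set (L := PI / 2 * g 0) in *.
  assert (HX : forall e', 0 < e' -> L + e' >= 0).
    intros e' He'; destruct (Abel_cos_tr g Hg e' He') as (ep0 & Hep0 & HA).
    destruct (HA (ep0 / 2)) as (N0 & HN0 & HB); [lra|].
    specialize (HB N0 (Rle_refl _)); fold L in HB.
    assert (0 <= Int (fun t => exp (- (ep0 / 2) * t) * cos_tr g t) 0 N0).
      apply Int_pos; auto; [solve_cont|].
      intros t Ht; apply Rmult_le_pos; [apply Rlt_le, exp_pos|apply Hpos; lra].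
    apply Rabs_le_between in HB; lra.
  assert (HL : 0 <= L) by (apply Rnot_lt_le; intro; specialize (HX (- L / 2)); lra).
  set (e' := (X - L) / 4).
  destruct (Abel_cos_tr g Hg e') as (ep0 & Hep0 & HA); [unfold e'; lra|].
  (* With [ep <= k] the damping costs at most [(X - L) / 2] on [[0, N]], while the Abel mean is
     within [(X - L) / 4] of [L]. *)
  set (k := (X - L) / (2 * (X * (N + 1)))).
  assert (HXN : 0 < X * (N + 1)) by nra.
  assert (Hk : 0 < k) by (apply Rdiv_lt_0_compat; lra).
  set (ep := Rmin (ep0 / 2) k).
  assert (Hep : 0 < ep < ep0).
    unfold ep; split; [apply Rmin_glb_lt; lra|].
    eapply Rle_lt_trans; [apply Rmin_l|]; lra.
  assert (Hepk : ep <= k) by apply Rmin_r.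
  destruct (HA ep Hep) as (N0 & HN0 & HB).
  specialize (HB (Rmax N0 N) (Rmax_l _ _)); fold L in HB.
  assert (H1 : exp (- ep * N) * X <= Int (fun t => exp (- ep * t) * cos_tr g t) 0 N).
    unfold X; rewrite <- Int_mulc by auto.
    apply Int_mono; auto; [solve_cont..|].
    intros t Ht; apply Rmult_le_compat_r; [apply Hpos; lra|].
    apply exp_le; nra.
  assert (H2 : Int (fun t => exp (- ep * t) * cos_tr g t) 0 N
    <= Int (fun t => exp (- ep * t) * cos_tr g t) 0 (Rmax N0 N)).
    rewrite <- (Int_concat _ 0 N (Rmax N0 N)) by solve_cont.
    assert (0 <= Int (fun t => exp (- ep * t) * cos_tr g t) N (Rmax N0 N)); [|lra].
    apply Int_pos; [apply Rmax_r|solve_cont|].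
    intros t Ht; apply Rmult_le_pos; [apply Rlt_le, exp_pos|apply Hpos; lra].
  pose proof (exp_ineq1_le (- ep * N)) as H3.
  assert (H4 : ep * (X * (N + 1)) <= (X - L) / 2).
    apply Rle_trans with (k * (X * (N + 1))); [apply Rmult_le_compat_r; lra|].
    unfold k; right; field; nra.
  apply Rabs_le_between in HB; unfold e' in HB. nra.
destruct (Abel_cos_tr g Hg e He) as (ep0 & Hep0 & HA).
destruct (HA (ep0 / 2)) as (N0 & HN0 & HB); [lra|].
exists N0; split; auto; intros N HN; split; [|apply Hup; lra].
specialize (HB N HN); apply Rabs_le_between in HB.
apply Rle_trans with (Int (fun t => exp (- (ep0 / 2) * t) * cos_tr g t) 0 N); [lra|].
apply Int_mono; [lra|solve_cont..|].
intros t Ht; rewrite <- (Rmult_1_l (cos_tr g t)) at 2.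
apply Rmult_le_compat_r; [apply Hpos; lra|].
replace (- (ep0 / 2) * t) with (- (ep0 / 2 * t)) by ring; apply exp_neg_le_1; nra.
Qed.

Lemma eq_of_close x y K : (forall e, 0 < e -> Rabs (x - y) <= K * e) -> x = y.
Proof.
intros H; apply Rminus_diag_uniq.
destruct (Req_dec (x - y) 0) as [E|E]; auto.
pose proof (Rabs_pos_lt _ E) as Hp; pose proof (Rabs_pos K).
assert (He : 0 < Rabs (x - y) / (2 * (Rabs K + 1))) by (apply Rdiv_lt_0_compat; lra).
pose proof (H _ He) as H1.
assert (H2 : K * (Rabs (x - y) / (2 * (Rabs K + 1)))
  <= Rabs K * (Rabs (x - y) / (2 * (Rabs K + 1)))).
  apply Rmult_le_compat_r; [lra|apply Rle_abs].
assert (H3 : Rabs K * (Rabs (x - y) / (2 * (Rabs K + 1))) < Rabs (x - y)).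
  apply Rmult_lt_reg_r with (2 * (Rabs K + 1)); [lra|].
  field_simplify; [|lra]; nra.
lra.
Qed.

(** On [[0, b]] the damping factor differs from 1 by at most [ep * b], and nothing is left beyond
    [b]; so it can be removed without a sign condition on the transform. *)
Lemma cos_tr_inversion_support g b : L1 g -> 0 <= b -> (forall t, b < t -> cos_tr g t = 0) ->
  Int (cos_tr g) 0 b = PI / 2 * g 0.
Proof.
intros Hg Hb Hz; assert (Hcc := cont_cos_tr g Hg); destruct (proj2 Hg) as [M HM].
assert (HM0 := L1_bound_nonneg g M HM).
apply (eq_of_close _ _ (b * b * M + 1)); intros e He.
destruct (Abel_cos_tr g Hg e He) as (ep0 & Hep0 & HA).
set (ep := Rmin (ep0 / 2) e).
assert (Hep : 0 < ep < ep0).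
  unfold ep; split; [apply Rmin_glb_lt; lra|].
  eapply Rle_lt_trans; [apply Rmin_l|]; lra.
assert (Hepe : ep <= e) by apply Rmin_r.
destruct (HA ep Hep) as (N0 & HN0 & HB).
specialize (HB (Rmax N0 b) (Rmax_l _ _)).
rewrite <- (Int_concat _ 0 b) in HB by solve_cont.
assert (E0 : Int (fun t => exp (- ep * t) * cos_tr g t) b (Rmax N0 b) = 0).
  transitivity (Int (fun _ => 0) b (Rmax N0 b)); [|rewrite Int_cst; ring].
  apply Int_eq_open; [apply Rmax_r|]; intros t Ht; rewrite Hz by lra; ring.
rewrite E0, Rplus_0_r in HB.
replace (Int (cos_tr g) 0 b - PI / 2 * g 0) with
  (Int (fun t => cos_tr g t - exp (- ep * t) * cos_tr g t) 0 b
   + (Int (fun t => exp (- ep * t) * cos_tr g t) 0 b - PI / 2 * g 0)).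
2: { rewrite Int_sub by solve_cont; ring. }
eapply Rle_trans; [apply Rabs_triang|].
assert (Rabs (Int (fun t => cos_tr g t - exp (- ep * t) * cos_tr g t) 0 b)
  <= Int (fun _ => ep * b * M) 0 b).
  apply Int_abs_bound; auto; [solve_cont..|].
  intros t Ht; replace (cos_tr g t - exp (- ep * t) * cos_tr g t)
    with ((1 - exp (- ep * t)) * cos_tr g t) by ring.
  rewrite Rabs_mult.
  pose proof (exp_ineq1_le (- ep * t)).
  replace (- ep * t) with (- (ep * t)) in * by ring.
  pose proof (exp_neg_le_1 (ep * t) ltac:(nra)).
  apply Rmult_le_compat; try apply Rabs_pos; [|now apply cos_tr_bound].
  rewrite Rabs_pos_eq by lra; nra.
rewrite Int_cst in H.
assert ((b - 0) * (ep * b * M) <= b * b * M * e).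
  replace ((b - 0) * (ep * b * M)) with (b * b * M * ep) by ring.
  apply Rmult_le_compat_l; auto; apply Rmult_le_pos; nra.
lra.
Qed.

(** * Plancherel's formula for continuous functions of compact support *)

Definition supported (f : R -> R) (b : R) : Prop := forall x, b < Rabs x -> f x = 0.

Lemma Int_supported f b p q : cont f -> supported f b -> 0 <= b -> p <= - b -> b <= q ->
  Int f p q = Int f (- b) b.
Proof.
intros Hf Hs Hb Hp Hq.
rewrite <- (Int_concat f p (- b) q), <- (Int_concat f (- b) b q) by auto.
rewrite (Int_eq_open f (fun _ => 0) p (- b)), (Int_eq_open f (fun _ => 0) b q); auto.
- rewrite !Int_cst; ring.
- intros x Hx; apply Hs; rewrite Rabs_pos_eq; lra.
- intros x Hx; apply Hs; rewrite Rabs_left1; lra.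
Qed.
Lemma supported_mult_l f g b : supported f b -> supported (fun x => f x * g x) b.
Proof. intros H x Hx; rewrite H; auto; ring. Qed.
Lemma supported_le f b c : supported f b -> b <= c -> supported f c.
Proof. intros H Hc x Hx; apply H; lra. Qed.

(** [ct] and [st] are the real and imaginary parts of the Fourier transform with kernel
    [exp (i w t)], and [power] is its squared modulus. The frequency [w] is angular, whence the
    argument [2 * PI * x] later on. *)
Definition ct (f : R -> R) (b w : R) : R := Int (fun t => f t * cos (w * t)) (- b) b.
Definition st (f : R -> R) (b w : R) : R := Int (fun t => f t * sin (w * t)) (- b) b.
Definition power (f : R -> R) (b w : R) : R := ct f b w ^ 2 + st f b w ^ 2.

Lemma cont_ct f b : cont f -> cont (ct f b).
Proof. intros; apply (cont_Int_param (fun w t => f t * cos (w * t))); solve_cont2. Qed.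
Lemma cont_st f b : cont f -> cont (st f b).
Proof. intros; apply (cont_Int_param (fun w t => f t * sin (w * t))); solve_cont2. Qed.
Lemma cont_power f b : cont f -> cont (power f b).
Proof.
intros Hf; pose proof (cont_ct f b Hf); pose proof (cont_st f b Hf).
unfold power; solve_cont.
Qed.
Lemma power_nonneg f b w : 0 <= power f b w.
Proof. unfold power; pose proof (pow2_ge_0 (ct f b w)); pose proof (pow2_ge_0 (st f b w)); lra. Qed.

Lemma ct_widen f b c w : cont f -> supported f b -> 0 <= b -> b <= c -> ct f c w = ct f b w.
Proof.
intros; apply Int_supported; auto; [solve_cont|now apply supported_mult_l|lra].
Qed.
Lemma st_widen f b c w : cont f -> supported f b -> 0 <= b -> b <= c -> st f c w = st f b w.
Proof.
intros; apply Int_supported; auto; [solve_cont|now apply supported_mult_l|lra].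
Qed.

Lemma ct_translate f b w u p q : cont f -> supported f b -> 0 <= b ->
  p + u <= - b -> b <= q + u ->
  Int (fun s => f (s + u) * cos (w * s)) p q = cos (w * u) * ct f b w + sin (w * u) * st f b w.
Proof.
intros Hf Hs Hb Hp Hq.
rewrite (Int_eq_all _ (fun s => (fun v => f v * cos (w * (v - u))) (s + u))).
2: { intro s; simpl; do 2 f_equal; ring. }
rewrite (Int_shift (fun v => f v * cos (w * (v - u)))) by solve_cont.
rewrite (Int_supported _ b) by first [assumption | now apply supported_mult_l | solve_cont].
unfold ct, st; rewrite <- !Int_mulc, <- Int_add by solve_cont.
apply Int_eq_all; intro v.
replace (w * (v - u)) with (w * v - w * u) by ring; rewrite cos_minus; ring.
Qed.
Lemma st_translate f b w u p q : cont f -> supported f b -> 0 <= b ->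
  p + u <= - b -> b <= q + u ->
  Int (fun s => f (s + u) * sin (w * s)) p q = cos (w * u) * st f b w - sin (w * u) * ct f b w.
Proof.
intros Hf Hs Hb Hp Hq.
rewrite (Int_eq_all _ (fun s => (fun v => f v * sin (w * (v - u))) (s + u))).
2: { intro s; simpl; do 2 f_equal; ring. }
rewrite (Int_shift (fun v => f v * sin (w * (v - u)))) by solve_cont.
rewrite (Int_supported _ b) by first [assumption | now apply supported_mult_l | solve_cont].
unfold ct, st; rewrite <- !Int_mulc, <- Int_sub by solve_cont.
apply Int_eq_all; intro v.
replace (w * (v - u)) with (w * v - w * u) by ring; rewrite sin_minus; ring.
Qed.

Definition autocorr (f : R -> R) (b u : R) : R := Int (fun t => f t * f (t + u)) (- b) b.

Lemma cont_autocorr f b : cont f -> cont (autocorr f b).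
Proof. intros; apply (cont_Int_param (fun u t => f t * f (t + u))); solve_cont2. Qed.
Lemma autocorr_supported f b : cont f -> supported f b -> 0 <= b ->
  supported (autocorr f b) (2 * b).
Proof.
intros Hf Hs Hb u Hu; unfold autocorr.
rewrite (Int_eq _ (fun _ => 0)); [rewrite Int_cst; ring|lra|].
intros t Ht; rewrite (Hs (t + u)); [ring|].
pose proof (Rabs_triang_inv u (- t)); rewrite Rabs_Ropp in H.
replace (u - - t) with (t + u) in H by ring.
assert (Rabs t <= b) by (apply Rabs_le; lra); lra.
Qed.

(** The Wiener-Khinchin identity. After Fubini the inner integral over [[- 2 b, 2 b]] contains the
    support of every translate of [f] by [t] in [[- b, b]], so it is the full transform rotated by
    [w * t]. *)
Lemma power_autocorr f b w : cont f -> supported f b -> 0 <= b ->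
  power f b w = Int (fun u => autocorr f b u * cos (w * u)) (- (2 * b)) (2 * b).
Proof.
intros Hf Hs Hb.
transitivity (Int (fun u => Int (fun t => f t * (f (t + u) * cos (w * u))) (- b) b)
  (- (2 * b)) (2 * b)).
2: { apply Int_eq_all; intro u; unfold autocorr; rewrite (Rmult_comm (Int _ _ _)), <- Int_mulc by solve_cont.
  apply Int_eq_all; intro; ring. }
rewrite (Fubini (fun t u => f t * (f (t + u) * cos (w * u)))) by solve_cont2.
rewrite (Int_eq _ (fun t => ct f b w * (f t * cos (w * t)) + st f b w * (f t * sin (w * t)))).
- rewrite Int_add, !Int_mulc by solve_cont. unfold power, ct, st; ring.
- lra.
- intros t Ht; rewrite Int_mulc by solve_cont.
  rewrite (Int_eq_all _ (fun u => f (u + t) * cos (w * u))) by (intro; do 2 f_equal; ring).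
  rewrite (ct_translate f b); auto; try lra; ring.
Qed.

Lemma Int_supported_pos f b N : cont f -> supported f b -> 0 <= b -> b <= N ->
  Int f 0 N = Int f 0 b.
Proof.
intros Hf Hs Hb HN; rewrite <- (Int_concat f 0 b N) by auto.
rewrite (Int_eq_open f (fun _ => 0) b N), Int_cst; auto; [ring|].
intros x Hx; apply Hs; rewrite Rabs_pos_eq; lra.
Qed.
Lemma supported_abs f b : supported f b -> supported (fun x => Rabs (f x)) b.
Proof. intros H x Hx; rewrite H, Rabs_R0; auto. Qed.
Lemma L1_supported f b : cont f -> supported f b -> 0 <= b -> L1 f.
Proof.
intros Hf Hs Hb; split; auto; exists (Int (fun x => Rabs (f x)) 0 b); intros N HN.
destruct (Rle_dec b N) as [H|H].
- rewrite (Int_supported_pos _ b); auto; [lra|solve_cont|now apply supported_abs].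
- apply Int_widen; try lra; [solve_cont|intro; apply Rabs_pos].
Qed.
Lemma J_supported f b : cont f -> supported f b -> 0 <= b -> J f = Int f 0 b.
Proof.
intros Hf Hs Hb; apply J_eq; destruct (nfloor_ex b Hb) as [n0 Hn0].
apply (is_lim_seq_ext_loc (fun _ => Int f 0 b)); [|apply is_lim_seq_const].
exists (n0 + 1)%nat; intros n Hn; apply le_INR in Hn; rewrite plus_INR in Hn; simpl in Hn.
symmetry; apply Int_supported_pos; auto; lra.
Qed.

(** The folded autocorrelation [g] has cosine transform [power f b], which is nonnegative, so the
    Tauberian inversion applies at 0, where [g 0] is twice the integral of [f ^ 2]. *)
Lemma Plancherel_freq f b : cont f -> supported f b -> 0 <= b ->
  forall e, 0 < e -> exists N0, 0 <= N0 /\ forall N, N0 <= N ->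
  PI * Int (fun t => f t ^ 2) (- b) b - e <= Int (power f b) 0 N
    <= PI * Int (fun t => f t ^ 2) (- b) b.
Proof.
intros Hf Hs Hb e He.
set (g := fun u => autocorr f b u + autocorr f b (- u)).
pose proof (cont_autocorr f b Hf) as Ha; pose proof (autocorr_supported f b Hf Hs Hb) as Has.
assert (Hgc : cont g) by (unfold g; solve_cont).
assert (Hgs : supported g (2 * b)).
  intros u Hu; unfold g; rewrite !Has; [ring|rewrite Rabs_Ropp|]; auto.
assert (Hg : L1 g) by (apply (L1_supported g (2 * b)); auto; lra).
assert (Hp : forall w, cos_tr g w = power f b w).
  intro w; unfold cos_tr; rewrite (J_supported _ (2 * b)); try lra.
  - rewrite power_autocorr, Int_sym by (auto; solve_cont).
    apply Int_eq_all; intro u; unfold g.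
    replace (w * - u) with (- (w * u)) by ring; rewrite cos_neg; ring.
  - solve_cont.
  - now apply supported_mult_l.
destruct (cos_tr_inversion_nonneg g Hg) with (e := e) as (N0 & HN0 & H); auto.
  intros t _; rewrite Hp; apply power_nonneg.
exists N0; split; auto; intros N HN; specialize (H N HN).
rewrite (Int_eq_all (cos_tr g) (power f b)) in H by auto.
replace (PI * Int (fun t => f t ^ 2) (- b) b) with (PI / 2 * g 0); auto.
unfold g, autocorr; rewrite Ropp_0.
rewrite (Int_eq_all _ (fun t => f t ^ 2)); [field|].
intro; rewrite Rplus_0_r; ring.
Qed.

(** Symmetric limits are linear and annihilate odd functions, which disposes of the cross terms
    below. For nonnegative integrands they agree with the improper integral of the statement. *)
Definition lim_sym (h : R -> R) (l : R) : Prop :=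
  forall e, 0 < e -> exists N0, 0 <= N0 /\ forall N, N0 <= N -> Rabs (Int h (- N) N - l) <= e.

Lemma lim_sym_plus h k l m : cont h -> cont k -> lim_sym h l -> lim_sym k m ->
  lim_sym (fun x => h x + k x) (l + m).
Proof.
intros Hh Hk H1 H2 e He.
destruct (H1 (e / 2)) as (N1 & HN1 & B1); [lra|].
destruct (H2 (e / 2)) as (N2 & HN2 & B2); [lra|].
exists (Rmax N1 N2); split; [apply Rle_trans with N1; auto; apply Rmax_l|]; intros N HN.
rewrite Int_add by auto.
replace (Int h (- N) N + Int k (- N) N - (l + m))
  with ((Int h (- N) N - l) + (Int k (- N) N - m)) by ring.
eapply Rle_trans; [apply Rabs_triang|].
specialize (B1 N (Rle_trans _ _ _ (Rmax_l N1 N2) HN)).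
specialize (B2 N (Rle_trans _ _ _ (Rmax_r N1 N2) HN)); lra.
Qed.
Lemma lim_sym_mulc c h l : cont h -> lim_sym h l -> lim_sym (fun x => c * h x) (c * l).
Proof.
intros Hh H e He; pose proof (Rabs_pos c).
destruct (H (e / (Rabs c + 1))) as (N0 & HN0 & B); [apply Rdiv_lt_0_compat; lra|].
exists N0; split; auto; intros N HN; specialize (B N HN).
rewrite Int_mulc, <- Rmult_minus_distr_l, Rabs_mult by auto.
apply Rle_trans with (Rabs c * (e / (Rabs c + 1))); [now apply Rmult_le_compat_l|].
apply Rmult_le_reg_r with (Rabs c + 1); [lra|]; field_simplify; [|lra]; nra.
Qed.
Lemma lim_sym_ext h k l : (forall x, h x = k x) -> lim_sym h l -> lim_sym k l.
Proof.
intros E H e He; destruct (H e He) as (N0 & HN0 & B); exists N0; split; auto.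
intros N HN; rewrite <- (Int_eq_all h k) by auto; auto.
Qed.
Lemma lim_sym_minus h k l m : cont h -> cont k -> lim_sym h l -> lim_sym k m ->
  lim_sym (fun x => h x - k x) (l - m).
Proof.
intros Hh Hk H1 H2; apply (lim_sym_ext (fun x => h x + (-1) * k x)); [intro; ring|].
replace (l - m) with (l + (-1) * m) by ring.
apply lim_sym_plus; auto; [solve_cont|now apply lim_sym_mulc].
Qed.
Lemma lim_sym_unique h l m : lim_sym h l -> lim_sym h m -> l = m.
Proof.
intros H1 H2; apply (eq_of_close l m 2); intros e He.
destruct (H1 e He) as (N1 & HN1 & B1); destruct (H2 e He) as (N2 & HN2 & B2).
specialize (B1 _ (Rmax_l N1 N2)); specialize (B2 _ (Rmax_r N1 N2)).
rewrite Rabs_minus_sym in B1.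
match type of B1 with Rabs (l - ?x) <= _ =>
  replace (l - m) with ((l - x) + (x - m)) by ring end.
eapply Rle_trans; [apply Rabs_triang|]; lra.
Qed.

Lemma Plancherel f b : cont f -> supported f b -> 0 <= b ->
  lim_sym (fun x => power f b (2 * PI * x)) (Int (fun t => f t ^ 2) (- b) b).
Proof.
intros Hf Hs Hb e He; pose proof PI_RGT_0 as HPI.
pose proof (cont_power f b Hf) as Hp.
destruct (Plancherel_freq f b Hf Hs Hb (PI * e)) as (N0 & HN0 & H); [nra|].
exists N0; split; auto; intros N HN.
assert (HN1 : N0 <= 2 * PI * N) by (pose proof PI2_3_2; nra).
specialize (H _ HN1).
assert (Heven : forall w, power f b (- w) = power f b w).
  intro w; unfold power, ct, st; f_equal.
  - f_equal; apply Int_eq_all; intro t; replace (- w * t) with (- (w * t)) by ring.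
    now rewrite cos_neg.
  - rewrite (Int_eq_all _ (fun t => - (f t * sin (w * t)))).
    + rewrite Int_neg by solve_cont; ring.
    + intro t; replace (- w * t) with (- (w * t)) by ring; rewrite sin_neg; ring.
rewrite Int_sym by solve_cont.
rewrite (Int_eq_all _ (fun x => 2 * power f b (2 * PI * x + 0))).
2: { intro x; replace (2 * PI * - x) with (- (2 * PI * x)) by ring.
  rewrite Heven, Rplus_0_r; ring. }
rewrite Int_mulc by solve_cont.
pose proof (Int_lin (power f b) (2 * PI) 0 0 N Hp) as E.
rewrite Rmult_0_r, !Rplus_0_r in E.
apply Rabs_le; split; apply Rmult_le_reg_l with PI; auto; nra.
Qed.

(** * The sinc multiplier *)

(** The integral form is regular at 0 and is the transform of half the indicator of [[-1, 1]], which
    is how [mean] acquires [sinc] as its multiplier. *)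
Definition sinc (w : R) : R := / 2 * Int (fun u => cos (w * u)) (-1) 1.

Lemma cont_sinc : cont sinc.
Proof.
pose proof (cont_Int_param (fun w u => cos (w * u)) (-1) 1) as H.
unfold sinc; apply cont_mult; [apply cont_const|apply H; solve_cont2].
Qed.
Lemma sinc_eq w : w <> 0 -> sinc w = sin w / w.
Proof.
intros Hw; unfold sinc.
rewrite (Int_primitive (fun u => sin (w * u) / w)).
- rewrite Rmult_1_r; replace (w * -1) with (- w) by ring; rewrite sin_neg; field; auto.
- intro u; auto_derive; auto; field; auto.
- solve_cont.
Qed.
Lemma sinc_0 : sinc 0 = 1.
Proof.
unfold sinc; rewrite (Int_eq_all _ (fun _ => 1)).
- rewrite Int_cst; field.
- intro; rewrite Rmult_0_l; apply cos_0.
Qed.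
Lemma Rabs_sinc_le w : Rabs (sinc w) <= 1.
Proof.
unfold sinc; rewrite Rabs_mult, (Rabs_pos_eq (/ 2)) by lra.
assert (Rabs (Int (fun u => cos (w * u)) (-1) 1) <= Int (fun _ => 1) (-1) 1).
  apply Int_abs_bound; [lra|solve_cont..|]; intros; apply Rabs_cos_le.
rewrite Int_cst in H; lra.
Qed.

(** Convolution with half the indicator of [[-1, 1]] on the whole line. It enlarges the support by
    1, hence the radius [b + 1] in what follows. *)
Definition mean (f : R -> R) (s : R) : R := / 2 * Int f (s - 1) (s + 1).

Lemma mean_window f s : cont f -> mean f s = / 2 * Int (fun u => f (s + u)) (-1) 1.
Proof.
intros Hf; unfold mean; f_equal.
rewrite (Int_eq_all (fun u => f (s + u)) (fun u => f (u + s))) by (intro; f_equal; ring).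
rewrite Int_shift by auto; f_equal; ring.
Qed.
Lemma cont_mean f : cont f -> cont (mean f).
Proof.
intros Hf; apply (cont_ext (fun s => / 2 * Int (fun u => f (s + u)) (-1) 1)).
  intro; symmetry; now apply mean_window.
apply cont_mult; [apply cont_const|].
apply (cont_Int_param (fun s u => f (s + u))); solve_cont2.
Qed.
Lemma mean_supported f b : cont f -> supported f b -> 0 <= b -> supported (mean f) (b + 1).
Proof.
intros Hf Hs Hb s Hsb; unfold mean.
rewrite (Int_eq f (fun _ => 0)); [rewrite Int_cst; ring|lra|].
intros x Hx; apply Hs.
pose proof (Rabs_triang_inv s (s - x)); replace (s - (s - x)) with x in H by ring.
assert (Rabs (s - x) <= 1) by (apply Rabs_le; lra); lra.
Qed.

(** The convolution theorem by Fubini: each translate by [u] contributes [cos (w * u)] times [ct]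
    plus [sin (w * u)] times [st], and the sine integrates to 0 over [[-1, 1]]. *)
Lemma ct_mean f b w : cont f -> supported f b -> 0 <= b ->
  ct (mean f) (b + 1) w = sinc w * ct f b w.
Proof.
intros Hf Hs Hb; unfold ct at 1.
transitivity (Int (fun s => Int (fun u => / 2 * (f (s + u) * cos (w * s))) (-1) 1)
  (- (b + 1)) (b + 1)).
  apply Int_eq_all; intro s; rewrite mean_window, Int_mulc by (auto; solve_cont).
  rewrite Rmult_assoc; f_equal; rewrite (Rmult_comm (Int _ _ _)), <- Int_mulc by solve_cont.
  apply Int_eq_all; intro; ring.
rewrite <- (Fubini (fun s u => / 2 * (f (s + u) * cos (w * s)))) by solve_cont2.
rewrite (Int_eq _ (fun u => (/ 2 * ct f b w) * cos (w * u) + (/ 2 * st f b w) * sin (w * u))).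
- rewrite Int_add, !Int_mulc by solve_cont.
  replace (Int (fun u => sin (w * u)) (-1) 1) with 0; [unfold sinc; ring|].
  replace (-1) with (- (1)) by ring; rewrite Int_sym by solve_cont.
  rewrite (Int_eq_all _ (fun _ => 0)); [rewrite Int_cst; ring|].
  intro u; replace (w * - u) with (- (w * u)) by ring; rewrite sin_neg; ring.
- lra.
- intros u Hu; rewrite Int_mulc, (ct_translate f b) by (auto; try solve_cont; lra); ring.
Qed.
Lemma st_mean f b w : cont f -> supported f b -> 0 <= b ->
  st (mean f) (b + 1) w = sinc w * st f b w.
Proof.
intros Hf Hs Hb; unfold st at 1.
transitivity (Int (fun s => Int (fun u => / 2 * (f (s + u) * sin (w * s))) (-1) 1)
  (- (b + 1)) (b + 1)).
  apply Int_eq_all; intro s; rewrite mean_window, Int_mulc by (auto; solve_cont).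
  rewrite Rmult_assoc; f_equal; rewrite (Rmult_comm (Int _ _ _)), <- Int_mulc by solve_cont.
  apply Int_eq_all; intro; ring.
rewrite <- (Fubini (fun s u => / 2 * (f (s + u) * sin (w * s)))) by solve_cont2.
rewrite (Int_eq _ (fun u => (/ 2 * st f b w) * cos (w * u) - (/ 2 * ct f b w) * sin (w * u))).
- rewrite Int_sub, !Int_mulc by solve_cont.
  replace (Int (fun u => sin (w * u)) (-1) 1) with 0; [unfold sinc; ring|].
  replace (-1) with (- (1)) by ring; rewrite Int_sym by solve_cont.
  rewrite (Int_eq_all _ (fun _ => 0)); [rewrite Int_cst; ring|].
  intro u; replace (w * - u) with (- (w * u)) by ring; rewrite sin_neg; ring.
- lra.
- intros u Hu; rewrite Int_mulc, (st_translate f b) by (auto; try solve_cont; lra); ring.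
Qed.

(* Polarization: [4 sinc] times the power of [f] is the difference of the powers of
   [mean f + f] and [mean f - f]. *)
Lemma Plancherel_sinc f b : cont f -> supported f b -> 0 <= b ->
  lim_sym (fun x => power f b (2 * PI * x) * sinc (2 * PI * x))
    (Int (fun t => f t * mean f t) (- b) b).
Proof.
intros Hf Hs Hb.
pose proof (cont_mean f Hf) as Hm; pose proof (mean_supported f b Hf Hs Hb) as Hms.
pose proof (supported_le f b (b + 1) Hs ltac:(lra)) as Hs1.
assert (Hb1 : 0 <= b + 1) by lra.
assert (Hpc : forall h, cont h -> cont (fun x => power h (b + 1) (2 * PI * x))).
  intros h Hh; pose proof (cont_power h (b + 1) Hh); solve_cont.
set (p := fun t => mean f t + f t); set (q := fun t => mean f t - f t).
assert (Hp : cont p) by (unfold p; solve_cont).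
assert (Hq : cont q) by (unfold q; solve_cont).
assert (Hps : supported p (b + 1)) by (intros x Hx; unfold p; rewrite Hms, Hs1; auto; ring).
assert (Hqs : supported q (b + 1)) by (intros x Hx; unfold q; rewrite Hms, Hs1; auto; ring).
assert (Hcp : forall w, ct p (b + 1) w = (sinc w + 1) * ct f b w).
  intro w; transitivity (ct (mean f) (b + 1) w + ct f (b + 1) w).
  - unfold ct, p; rewrite <- Int_add by solve_cont; apply Int_eq_all; intro; ring.
  - rewrite ct_mean, (ct_widen f b (b + 1)) by (auto; lra); ring.
assert (Hsp : forall w, st p (b + 1) w = (sinc w + 1) * st f b w).
  intro w; transitivity (st (mean f) (b + 1) w + st f (b + 1) w).
  - unfold st, p; rewrite <- Int_add by solve_cont; apply Int_eq_all; intro; ring.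
  - rewrite st_mean, (st_widen f b (b + 1)) by (auto; lra); ring.
assert (Hcq : forall w, ct q (b + 1) w = (sinc w - 1) * ct f b w).
  intro w; transitivity (ct (mean f) (b + 1) w - ct f (b + 1) w).
  - unfold ct, q; rewrite <- Int_sub by solve_cont; apply Int_eq_all; intro; ring.
  - rewrite ct_mean, (ct_widen f b (b + 1)) by (auto; lra); ring.
assert (Hsq : forall w, st q (b + 1) w = (sinc w - 1) * st f b w).
  intro w; transitivity (st (mean f) (b + 1) w - st f (b + 1) w).
  - unfold st, q; rewrite <- Int_sub by solve_cont; apply Int_eq_all; intro; ring.
  - rewrite st_mean, (st_widen f b (b + 1)) by (auto; lra); ring.
apply (lim_sym_ext (fun x => / 4 * (power p (b + 1) (2 * PI * x) - power q (b + 1) (2 * PI * x)))).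
  intro x; unfold power; rewrite Hcp, Hsp, Hcq, Hsq; field.
replace (Int (fun t => f t * mean f t) (- b) b) with
  (/ 4 * (Int (fun t => p t ^ 2) (- (b + 1)) (b + 1)
    - Int (fun t => q t ^ 2) (- (b + 1)) (b + 1))).
- apply lim_sym_mulc; [apply cont_minus; auto|].
  apply lim_sym_minus; auto; now apply Plancherel.
- rewrite <- Int_sub, <- Int_mulc by solve_cont.
  rewrite <- (Int_supported (fun t => f t * mean f t) b (- (b + 1)) (b + 1)); try lra.
  + apply Int_eq_all; intro t; unfold p, q; field.
  + solve_cont.
  + now apply supported_mult_l.
Qed.

(** * Fourier inversion on the line *)

Definition L1R (h : R -> R) : Prop :=
  cont h /\ exists M, forall p q, p <= q -> Int (fun x => Rabs (h x)) p q <= M.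

Lemma L1R_sym_bound h M : cont h ->
  (forall N, 0 <= N -> Int (fun x => Rabs (h x)) (- N) N <= M) -> L1R h.
Proof.
intros Hh HM; split; auto; exists M; intros p q Hpq.
pose proof (Rmax_l (Rabs p) (Rabs q)); pose proof (Rmax_r (Rabs p) (Rabs q)).
pose proof (Rle_abs (- p)); pose proof (Rle_abs q); rewrite Rabs_Ropp in H1.
eapply Rle_trans; [|apply (HM (Rmax (Rabs p) (Rabs q)))].
- apply Int_widen; try lra; [solve_cont|intro; apply Rabs_pos].
- pose proof (Rabs_pos p); lra.
Qed.

Lemma L1R_translate h c : L1R h -> L1 (fun x => h (c + x)).
Proof.
intros [Hh [M HM]]; split; [solve_cont|]; exists M; intros N HN.
rewrite (Int_eq_all _ (fun x => (fun y => Rabs (h y)) (x + c)))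
  by (intro; do 2 f_equal; ring).
rewrite (Int_shift (fun y => Rabs (h y))) by solve_cont; apply HM; lra.
Qed.
Lemma L1R_opp h : L1R h -> L1R (fun x => h (- x)).
Proof.
intros [Hh [M HM]]; split; [solve_cont|]; exists M; intros p q Hpq.
rewrite (Int_reflect (fun y => Rabs (h y))) by solve_cont; apply HM; lra.
Qed.
Lemma L1R_L1 h : L1R h -> L1 h.
Proof.
intros H; apply (L1_ext (fun x => h (0 + x))); [intro; f_equal; ring|].
now apply L1R_translate.
Qed.
Lemma L1R_translate_opp h c : L1R h -> L1 (fun x => h (c - x)).
Proof.
intros H; apply (L1_ext (fun x => (fun y => h (- y)) (- c + x))).
  intro; simpl; f_equal; ring.
apply (L1R_translate (fun y => h (- y))); now apply L1R_opp.
Qed.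

Lemma L1R_tail h : L1R h -> forall e, 0 < e -> exists A, 0 < A /\
  forall p q, p <= q -> A <= p \/ q <= - A -> Int (fun x => Rabs (h x)) p q <= e.
Proof.
intros Hh e He; assert (Hc := proj1 Hh).
destruct (L1_tail h (L1R_L1 h Hh) e He) as (A1 & HA1 & H1).
destruct (L1_tail _ (L1R_L1 _ (L1R_opp h Hh)) e He) as (A2 & HA2 & H2).
exists (Rmax A1 A2); split; [apply Rlt_le_trans with A1; auto; apply Rmax_l|].
intros p q Hpq [H|H].
- apply H1; auto; apply Rle_trans with (Rmax A1 A2); auto; apply Rmax_l.
- pose proof (Rmax_r A1 A2); specialize (H2 (- q) (- p)).
  rewrite (Int_reflect (fun y => Rabs (h y))) in H2 by solve_cont.
  rewrite !Ropp_involutive in H2; apply H2; lra.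
Qed.

(* Cosine and sine coefficients over the whole line, folded onto the half-line. *)
Definition ch (h : R -> R) (w : R) : R := J (fun x => (h x + h (- x)) * cos (w * x)).
Definition sh (h : R -> R) (w : R) : R := J (fun x => (h x - h (- x)) * sin (w * x)).

Lemma L1R_even h : L1R h -> L1 (fun x => h x + h (- x)).
Proof. intros H; apply L1_plus; [now apply L1R_L1|now apply (L1R_L1 _ (L1R_opp h H))]. Qed.
Lemma L1R_odd h : L1R h -> L1 (fun x => h x - h (- x)).
Proof. intros H; apply L1_minus; [now apply L1R_L1|now apply (L1R_L1 _ (L1R_opp h H))]. Qed.

Lemma cont_ch h : L1R h -> cont (ch h).
Proof. intros H; apply (cont_cos_tr (fun x => h x + h (- x))); now apply L1R_even. Qed.
Lemma cont_sh h : L1R h -> cont (sh h).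
Proof.
intros H; apply (cont_J_kernel (fun x => h x - h (- x)) sin).
- now apply L1R_odd.
- apply cont_sin, cont_id.
- apply Rabs_sin_le.
- apply sin_lipschitz.
Qed.
Lemma ch_even h w : ch h (- w) = ch h w.
Proof.
apply J_ext; intros x _; replace (- w * x) with (- (w * x)) by ring; now rewrite cos_neg.
Qed.
Lemma sh_odd h w : L1R h -> sh h (- w) = - sh h w.
Proof.
intros H; unfold sh; rewrite (J_ext _ (fun x => (-1) * ((h x - h (- x)) * sin (w * x)))).
- rewrite J_mulc by (apply (L1_sin_kernel (fun x => h x - h (- x))); now apply L1R_odd); ring.
- intros x _; replace (- w * x) with (- (w * x)) by ring; rewrite sin_neg; ring.
Qed.

Lemma Int_abs_le_rev h k p q e : cont h -> cont k -> (forall x, Rabs (k x) <= Rabs (h x)) ->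
  (forall p' q', p' <= q' -> Rmin p q <= p' -> q' <= Rmax p q ->
    Int (fun x => Rabs (h x)) p' q' <= e) ->
  Rabs (Int k p q) <= e.
Proof.
intros Hh Hk Hkh H.
destruct (Rle_dec p q) as [Hpq|Hpq].
- eapply Rle_trans; [apply (Int_abs_bound k (fun x => Rabs (h x))); auto; solve_cont|].
  apply H; auto; [rewrite Rmin_left|rewrite Rmax_right]; lra.
- rewrite Int_rev, Rabs_Ropp by auto.
  eapply Rle_trans; [apply (Int_abs_bound k (fun x => Rabs (h x))); auto; solve [solve_cont|lra]|].
  apply H; [lra|rewrite Rmin_right|rewrite Rmax_left]; lra.
Qed.

(** This carries inversion from the origin to [x0]. The windows [[- n, n]] and [[x0 - n, x0 + n]]
    differ by two intervals far out, where the integral of [|h|] is small. *)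
Lemma cos_tr_translate h x0 w : L1R h ->
  cos_tr (fun x => h (x0 + x) + h (x0 - x)) w = cos (w * x0) * ch h w + sin (w * x0) * sh h w.
Proof.
intros Hh; assert (Hc := proj1 Hh).
set (k := fun y => h y * cos (w * (y - x0))).
assert (Hk : cont k) by (unfold k; solve_cont).
assert (Hkh : forall x, Rabs (k x) <= Rabs (h x)).
  intro; apply Rabs_mult_le_l, Rabs_cos_le.
unfold cos_tr; apply J_eq.
assert (Hlim : is_lim_seq (fun n => Int k (- INR n) (INR n))
  (cos (w * x0) * ch h w + sin (w * x0) * sh h w)).
  apply (is_lim_seq_ext (fun n =>
    cos (w * x0) * Int (fun x => (h x + h (- x)) * cos (w * x)) 0 (INR n)
    + sin (w * x0) * Int (fun x => (h x - h (- x)) * sin (w * x)) 0 (INR n))).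
    intro n; rewrite Int_sym by auto.
    rewrite <- !Int_mulc, <- Int_add by solve_cont; apply Int_eq_all; intro x; unfold k.
    replace (w * (x - x0)) with (w * x - w * x0) by ring.
    replace (w * (- x - x0)) with (- (w * x + w * x0)) by ring.
    rewrite cos_neg, cos_minus, cos_plus; ring.
  apply is_lim_seq_plus'.
  - apply (is_lim_seq_scal_l _ (cos (w * x0)) (ch h w)), J_is_lim.
    apply (L1_cos_kernel (fun x => h x + h (- x))); now apply L1R_even.
  - apply (is_lim_seq_scal_l _ (sin (w * x0)) (sh h w)), J_is_lim.
    apply (L1_sin_kernel (fun x => h x - h (- x))); now apply L1R_odd.
assert (Hd : is_lim_seq (fun n => Int k (x0 + INR n) (INR n) + Int k (- INR n) (x0 - INR n)) 0).
  apply is_lim_seq_spec; intros [e He]; simpl.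
  destruct (L1R_tail h Hh (e / 3)) as (A & HA & Ht); [lra|].
  destruct (nfloor_ex (A + Rabs x0)) as [n0 Hn0]; [pose proof (Rabs_pos x0); lra|].
  exists (n0 + 1)%nat; intros n Hn; apply le_INR in Hn; rewrite plus_INR in Hn; simpl in Hn.
  pose proof (Rle_abs x0) as Hx1; pose proof (Rle_abs (- x0)) as Hx2.
  rewrite Rabs_Ropp in Hx2.
  rewrite Rminus_0_r; eapply Rle_lt_trans; [apply Rabs_triang|].
  assert (Rabs (Int k (x0 + INR n) (INR n)) <= e / 3).
    apply (Int_abs_le_rev h); auto; intros p' q' H1 H2 H3; apply Ht; auto; left.
    unfold Rmin in H2; destruct (Rle_dec _ _) in H2; lra.
  assert (Rabs (Int k (- INR n) (x0 - INR n)) <= e / 3).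
    apply (Int_abs_le_rev h); auto; intros p' q' H1 H2 H3; apply Ht; auto; right.
    unfold Rmax in H3; destruct (Rle_dec _ _) in H3; lra.
  lra.
apply (is_lim_seq_ext (fun n => Int k (- INR n) (INR n)
  - (Int k (x0 + INR n) (INR n) + Int k (- INR n) (x0 - INR n)))).
2: { rewrite <- (Rminus_0_r (_ + _)); now apply is_lim_seq_minus'. }
intro n.
transitivity (Int k (x0 - INR n) (x0 + INR n)).
  rewrite <- (Int_concat k (- INR n) (x0 - INR n) (INR n)) by auto.
  rewrite <- (Int_concat k (x0 - INR n) (x0 + INR n) (INR n)) by auto; ring.
transitivity (Int (fun x => k (x + x0)) (- INR n) (INR n)).
  rewrite Int_shift by auto; f_equal; ring.
rewrite Int_sym by solve_cont; apply Int_eq_all; intro x; unfold k.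
replace (w * (- x + x0 - x0)) with (- (w * x)) by ring; rewrite cos_neg.
replace (w * (x + x0 - x0)) with (w * x) by ring.
replace (x + x0) with (x0 + x) by ring; replace (- x + x0) with (x0 - x) by ring; ring.
Qed.

(** Inversion at 0 is applied to the symmetrization [G] of [h] about [x0], whose value at 0 is
    [2 * h x0]. *)
Lemma Fourier_inversion h b x0 : L1R h -> 0 <= b ->
  (forall w, b < w -> ch h w = 0 /\ sh h w = 0) ->
  Int (fun w => cos (w * x0) * ch h w + sin (w * x0) * sh h w) 0 b = PI * h x0.
Proof.
intros Hh Hb Hz.
set (G := fun x => h (x0 + x) + h (x0 - x)).
assert (HG : L1 G) by (apply L1_plus; [now apply L1R_translate|now apply L1R_translate_opp]).
assert (HGc : forall w, cos_tr G w = cos (w * x0) * ch h w + sin (w * x0) * sh h w).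
  intro; now apply cos_tr_translate.
rewrite <- (Int_eq_all (cos_tr G)) by auto.
rewrite cos_tr_inversion_support; auto.
- unfold G; rewrite Rplus_0_r, Rminus_0_r; field.
- intros w Hw; rewrite HGc; destruct (Hz w Hw) as [-> ->]; ring.
Qed.

Lemma Fourier_injective h x0 : L1R h ->
  (forall w, 0 < w -> ch h w = 0 /\ sh h w = 0) -> h x0 = 0.
Proof.
intros Hh Hz; pose proof (Fourier_inversion h 0 x0 Hh (Rle_refl 0) Hz) as E.
rewrite Int_same in E; pose proof PI_RGT_0; symmetry in E.
apply Rmult_integral in E; lra.
Qed.

Lemma lim_sym_odd h : cont h -> (forall x, h (- x) = - h x) -> lim_sym h 0.
Proof.
intros Hc Ho e He; exists 0; split; [lra|]; intros N HN.
rewrite Int_sym, (Int_eq_all _ (fun _ => 0)), Int_cst by (auto; intro; rewrite Ho; ring).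
rewrite Rmult_0_r, Rminus_0_r, Rabs_R0; lra.
Qed.
Lemma ct_even f b w : ct f b (- w) = ct f b w.
Proof.
apply Int_eq_all; intro t; replace (- w * t) with (- (w * t)) by ring; now rewrite cos_neg.
Qed.
Lemma st_odd f b w : cont f -> st f b (- w) = - st f b w.
Proof.
intros Hf; unfold st; rewrite <- Int_neg by solve_cont.
apply Int_eq_all; intro t; replace (- w * t) with (- (w * t)) by ring; rewrite sin_neg; ring.
Qed.
Lemma sinc_even w : sinc (- w) = sinc w.
Proof.
unfold sinc; f_equal; apply Int_eq_all; intro t.
replace (- w * t) with (- (w * t)) by ring; now rewrite cos_neg.
Qed.

(** Inversion writes [h] as [ct f1 + st f2] with [f1] even and [f2] odd. Then [st f1] and [ct f2]
    vanish, and [h ^ 2] is the sum of the two powers and an odd cross term, which has symmetric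
    limit 0. Two real densities thus replace one complex density. *)
Lemma Plancherel_band_limited h a : L1R h -> 0 <= a ->
  (forall w, 2 * PI * a < w -> ch h w = 0 /\ sh h w = 0) ->
  exists f1 f2, cont f1 /\ cont f2 /\ supported f1 a /\ supported f2 a /\
    lim_sym (fun x => h x ^ 2)
      (Int (fun t => f1 t ^ 2) (- a) a + Int (fun t => f2 t ^ 2) (- a) a) /\
    lim_sym (fun x => h x ^ 2 * sinc (2 * PI * x))
      (Int (fun t => f1 t * mean f1 t) (- a) a + Int (fun t => f2 t * mean f2 t) (- a) a).
Proof.
intros Hh Ha Hz; pose proof PI_RGT_0 as HPI.
assert (Hcc := cont_ch h Hh); assert (Hsc := cont_sh h Hh).
set (f1 := fun t => ch h (2 * PI * t)); set (f2 := fun t => sh h (2 * PI * t)).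
assert (H1 : cont f1) by (unfold f1; solve_cont).
assert (H2 : cont f2) by (unfold f2; solve_cont).
assert (E1 : forall t, f1 (- t) = f1 t).
  intro t; unfold f1; replace (2 * PI * - t) with (- (2 * PI * t)) by ring; apply ch_even.
assert (E2 : forall t, f2 (- t) = - f2 t).
  intro t; unfold f2; replace (2 * PI * - t) with (- (2 * PI * t)) by ring.
  now apply sh_odd.
assert (Hlt : forall t, a < t -> 2 * PI * a < 2 * PI * t).
  intros t Ht; apply Rmult_lt_compat_l; lra.
assert (S1 : supported f1 a).
  assert (Hp : forall t, a < t -> f1 t = 0) by (intros t Ht; exact (proj1 (Hz _ (Hlt t Ht)))).
  intros t Ht; unfold Rabs in Ht; destruct (Rcase_abs t) in Ht; [|auto].
  rewrite <- E1; auto.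
assert (S2 : supported f2 a).
  assert (Hp : forall t, a < t -> f2 t = 0) by (intros t Ht; exact (proj2 (Hz _ (Hlt t Ht)))).
  intros t Ht; unfold Rabs in Ht; destruct (Rcase_abs t) in Ht; [|auto].
  pose proof (E2 t); rewrite (Hp (- t)) in H by auto; lra.
assert (Z1 : forall w, st f1 a w = 0).
  intro w; unfold st; rewrite Int_sym, (Int_eq_all _ (fun _ => 0)), Int_cst; [ring| |solve_cont].
  intro t; rewrite E1; replace (w * - t) with (- (w * t)) by ring; rewrite sin_neg; ring.
assert (Z2 : forall w, ct f2 a w = 0).
  intro w; unfold ct; rewrite Int_sym, (Int_eq_all _ (fun _ => 0)), Int_cst; [ring| |solve_cont].
  intro t; rewrite E2; replace (w * - t) with (- (w * t)) by ring; rewrite cos_neg; ring.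
assert (Hx : forall x, h x = ct f1 a (2 * PI * x) + st f2 a (2 * PI * x)).
  intro x; apply Rmult_eq_reg_l with PI; [|lra].
  rewrite <- (Fourier_inversion h (2 * PI * a) x Hh) by (auto; nra).
  pose proof (Int_lin (fun w => cos (w * x) * ch h w + sin (w * x) * sh h w) (2 * PI) 0 0 a) as E.
  rewrite Rmult_0_r, !Rplus_0_r in E; rewrite <- E by solve_cont.
  rewrite Rmult_plus_distr_l; unfold ct, st; rewrite !Int_sym by solve_cont.
  rewrite <- Rmult_plus_distr_l, <- Int_add by solve_cont.
  match goal with |- 2 * PI * ?A = PI * ?B => replace (2 * PI * A) with (PI * (2 * A)) by ring end.
  f_equal; rewrite <- Int_mulc by solve_cont.
  apply Int_eq_all; intro t; rewrite E1, E2, Rplus_0_r; unfold f1, f2.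
  replace (2 * PI * x * - t) with (- (2 * PI * t * x)) by ring.
  replace (2 * PI * x * t) with (2 * PI * t * x) by ring.
  rewrite cos_neg, sin_neg; ring.
assert (Hp1 := cont_power f1 a H1); assert (Hp2 := cont_power f2 a H2).
assert (Hct := cont_ct f1 a H1); assert (Hst := cont_st f2 a H2).
pose proof cont_sinc as Hsi.
exists f1, f2; repeat split; auto.
- apply (lim_sym_ext (fun x => (power f1 a (2 * PI * x) + power f2 a (2 * PI * x))
    + 2 * (ct f1 a (2 * PI * x) * st f2 a (2 * PI * x)))).
    intro x; unfold power; rewrite Z1, Z2, Hx; ring.
  rewrite <- (Rplus_0_r (_ + _)); apply lim_sym_plus; [solve_cont|solve_cont| |].
  + apply lim_sym_plus; [solve_cont|solve_cont| |]; now apply Plancherel.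
  + apply lim_sym_odd; [solve_cont|]; intro x.
    replace (2 * PI * - x) with (- (2 * PI * x)) by ring.
    rewrite ct_even, st_odd by auto; ring.
- apply (lim_sym_ext (fun x => (power f1 a (2 * PI * x) * sinc (2 * PI * x)
    + power f2 a (2 * PI * x) * sinc (2 * PI * x))
    + 2 * (ct f1 a (2 * PI * x) * st f2 a (2 * PI * x)) * sinc (2 * PI * x))).
    intro x; unfold power; rewrite Z1, Z2, Hx; ring.
  rewrite <- (Rplus_0_r (_ + _)); apply lim_sym_plus; [solve_cont|solve_cont| |].
  + apply lim_sym_plus; [solve_cont|solve_cont| |]; now apply Plancherel_sinc.
  + apply lim_sym_odd; [solve_cont|]; intro x.
    replace (2 * PI * - x) with (- (2 * PI * x)) by ring.
    rewrite ct_even, st_odd, sinc_even by auto; ring.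
Qed.

(** * Goursat's lemma for rectangles *)

(** The counterclockwise circulation of [P dx + Q dy] around the rectangle with lower left corner
    [(a, c)] and sides [s] and [r]. *)
Definition circ (P Q : R -> R -> R) (a c s r : R) : R :=
  Int (fun x => P x c) a (a + s) + Int (fun y => Q (a + s) y) c (c + r)
  - Int (fun x => P x (c + r)) a (a + s) - Int (fun y => Q a y) c (c + r).

(** The coefficient [p2] shared by both expansions is the closedness condition. Differentiability is
    only pointwise, with no continuity of the partial derivatives, so Green's theorem does not apply
    and the rectangle has to be bisected. *)
Definition closed_form (P Q : R -> R -> R) : Prop :=
  forall x0 y0, exists p1 p2 q2, forall e, 0 < e -> exists d, 0 < d /\
  forall x y, Rabs (x - x0) < d -> Rabs (y - y0) < d ->
    Rabs (P x y - (P x0 y0 + p1 * (x - x0) + p2 * (y - y0)))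
      <= e * (Rabs (x - x0) + Rabs (y - y0)) /\
    Rabs (Q x y - (Q x0 y0 + p2 * (x - x0) + q2 * (y - y0)))
      <= e * (Rabs (x - x0) + Rabs (y - y0)).

Lemma circ_quarter P Q a c s r : cont2 P -> cont2 Q ->
  circ P Q a c s r = circ P Q a c (s / 2) (r / 2) + circ P Q (a + s / 2) c (s / 2) (r / 2)
    + circ P Q a (c + r / 2) (s / 2) (r / 2)
    + circ P Q (a + s / 2) (c + r / 2) (s / 2) (r / 2).
Proof.
intros HP HQ; unfold circ.
replace (a + s / 2 + s / 2) with (a + s) by field.
replace (c + r / 2 + r / 2) with (c + r) by field.
assert (Hl : forall y, Int (fun x => P x y) a (a + s)
  = Int (fun x => P x y) a (a + s / 2) + Int (fun x => P x y) (a + s / 2) (a + s)).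
  intro y; symmetry; apply Int_concat; now apply cont2_slice_l.
assert (Hr : forall x, Int (fun y => Q x y) c (c + r)
  = Int (fun y => Q x y) c (c + r / 2) + Int (fun y => Q x y) (c + r / 2) (c + r)).
  intro x; symmetry; apply Int_concat; now apply cont2_slice_r.
rewrite !Hl, !Hr; ring.
Qed.

Lemma circ_affine a c s r P0 p1 p2 Q0 q2 x0 y0 :
  circ (fun x y => P0 + p1 * (x - x0) + p2 * (y - y0))
    (fun x y => Q0 + p2 * (x - x0) + q2 * (y - y0)) a c s r = 0.
Proof.
unfold circ.
assert (H : forall A B u0 u v, Int (fun x => A + B * (x - u0)) u v
  = A * (v - u) + B * ((v - u0) ^ 2 - (u - u0) ^ 2) / 2).
  intros A B u0 u v.
  rewrite (Int_primitive (fun x => A * x + B * (x - u0) ^ 2 / 2)).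
  - field.
  - intro x; auto_derive; auto; field.
  - solve_cont.
rewrite !(Int_eq_all (fun x => P0 + p1 * (x - x0) + _)
  (fun x => (P0 + p2 * (c - y0)) + p1 * (x - x0))) by (intro; ring).
rewrite (Int_eq_all (fun x => P0 + p1 * (x - x0) + p2 * (c + r - y0))
  (fun x => (P0 + p2 * (c + r - y0)) + p1 * (x - x0))) by (intro; ring).
rewrite !H; field.
Qed.

Lemma circ_bound P Q a c s r K : cont2 P -> cont2 Q -> 0 <= s -> 0 <= r ->
  (forall x y, a <= x <= a + s -> c <= y <= c + r -> Rabs (P x y) <= K /\ Rabs (Q x y) <= K) ->
  Rabs (circ P Q a c s r) <= 2 * (s + r) * K.
Proof.
intros HP HQ Hs Hr H; unfold circ.
assert (Hx : forall y, c <= y <= c + r -> Rabs (Int (fun x => P x y) a (a + s)) <= s * K).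
  intros y Hy; replace (s * K) with (Int (fun _ => K) a (a + s)) by (rewrite Int_cst; ring).
  apply Int_abs_bound; [lra|now apply cont2_slice_l|apply cont_const|].
  intros; now apply H.
assert (Hy : forall x, a <= x <= a + s -> Rabs (Int (fun y => Q x y) c (c + r)) <= r * K).
  intros x Hx'; replace (r * K) with (Int (fun _ => K) c (c + r)) by (rewrite Int_cst; ring).
  apply Int_abs_bound; [lra|now apply cont2_slice_r|apply cont_const|].
  intros; now apply H.
pose proof (Hx c ltac:(lra)); pose proof (Hx (c + r) ltac:(lra)).
pose proof (Hy a ltac:(lra)); pose proof (Hy (a + s) ltac:(lra)).
apply Rabs_le_between in H0, H1, H2, H3; apply Rabs_le; lra.
Qed.

Lemma circ_minus P Q P' Q' a c s r : cont2 P -> cont2 Q -> cont2 P' -> cont2 Q' ->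
  circ (fun x y => P x y - P' x y) (fun x y => Q x y - Q' x y) a c s r
  = circ P Q a c s r - circ P' Q' a c s r.
Proof.
intros; unfold circ.
rewrite (Int_sub (fun x => P x c) (fun x => P' x c)),
  (Int_sub (fun x => P x (c + r)) (fun x => P' x (c + r))) by now apply cont2_slice_l.
rewrite (Int_sub (fun y => Q a y) (fun y => Q' a y)),
  (Int_sub (fun y => Q (a + s) y) (fun y => Q' (a + s) y)) by now apply cont2_slice_r.
ring.
Qed.

Section Bisection.
Variables (P Q : R -> R -> R) (a c s r : R).
Hypothesis HP : cont2 P.
Hypothesis HQ : cont2 Q.
Hypothesis Hs : 0 <= s.
Hypothesis Hr : 0 <= r.

Let big (n : nat) (p q : R * R) :=
  Rle_dec (Rabs (circ P Q (fst p) (snd p) (s / 2 ^ n) (r / 2 ^ n)) / 4)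
    (Rabs (circ P Q (fst q) (snd q) (s / 2 ^ S n) (r / 2 ^ S n))).

(** Lower left corners of nested rectangles, each a quarter of the preceding one chosen to retain at
    least a quarter of the circulation in absolute value. *)
Fixpoint corner (n : nat) : R * R :=
  match n with
  | O => (a, c)
  | S n =>
    let p := corner n in
    let p1 := (fst p + s / 2 ^ S n, snd p) in
    let p2 := (fst p, snd p + r / 2 ^ S n) in
    let p3 := (fst p + s / 2 ^ S n, snd p + r / 2 ^ S n) in
    if big n p p then p else if big n p p1 then p1 else if big n p p2 then p2 else p3
  end.

Lemma pow2_pos n : 0 < 2 ^ n.
Proof. apply pow_lt; lra. Qed.

(** If the first three quarters fail the test, the triangle inequality in [circ_quarter] forces the
    fourth, which is taken by default, to pass it. *)
Lemma corner_step n :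
  (fst (corner n) <= fst (corner (S n)) <= fst (corner n) + s / 2 ^ S n) /\
  (snd (corner n) <= snd (corner (S n)) <= snd (corner n) + r / 2 ^ S n) /\
  Rabs (circ P Q (fst (corner n)) (snd (corner n)) (s / 2 ^ n) (r / 2 ^ n)) / 4
  <= Rabs (circ P Q (fst (corner (S n))) (snd (corner (S n))) (s / 2 ^ S n) (r / 2 ^ S n)).
Proof.
assert (H2s : 0 <= s / 2 ^ S n) by (apply Rdiv_le_0_compat; auto; apply pow2_pos).
assert (H2r : 0 <= r / 2 ^ S n) by (apply Rdiv_le_0_compat; auto; apply pow2_pos).
assert (Es : s / 2 ^ n / 2 = s / 2 ^ S n) by (simpl; field; pose proof (pow2_pos n); lra).
assert (Er : r / 2 ^ n / 2 = r / 2 ^ S n) by (simpl; field; pose proof (pow2_pos n); lra).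
pose proof (circ_quarter P Q (fst (corner n)) (snd (corner n)) (s / 2 ^ n) (r / 2 ^ n) HP HQ) as E.
rewrite Es, Er in E.
cbn [corner]; set (p := corner n) in *; unfold big.
destruct (Rle_dec _ _) as [B|B]; [cbn [fst snd] in *; lra|].
destruct (Rle_dec _ _) as [B1|B1]; [cbn [fst snd] in *; lra|].
destruct (Rle_dec _ _) as [B2|B2]; [cbn [fst snd] in *; lra|].
cbn [fst snd] in *; repeat split; try lra.
rewrite E in *; clear E.
match type of B with ~ Rabs (?A + ?B + ?C + ?D) / 4 <= _ =>
  pose proof (Rabs_triang (A + B + C) D); pose proof (Rabs_triang (A + B) C);
  pose proof (Rabs_triang A B) end.
lra.
Qed.

Lemma nested_limit (u : nat -> R) (w : R) : 0 <= w ->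
  (forall n, u n <= u (S n) <= u n + w / 2 ^ S n) ->
  exists l, forall n, u n <= l <= u n + w / 2 ^ n.
Proof.
intros Hw Hu.
assert (Hdec : forall n, u (S n) + w / 2 ^ S n <= u n + w / 2 ^ n).
  intro n; pose proof (Hu n); replace (w / 2 ^ n) with (w / 2 ^ S n + w / 2 ^ S n); [lra|].
  simpl; field; pose proof (pow2_pos n); lra.
assert (Hpos : forall n, 0 <= w / 2 ^ n) by (intro; apply Rdiv_le_0_compat; auto; apply pow2_pos).
assert (Hub : forall m n, (m <= n)%nat -> u n + w / 2 ^ n <= u m + w / 2 ^ m).
  intros m n H; induction H; [lra|]; pose proof (Hdec m0); lra.
assert (Hmon : forall m n, (m <= n)%nat -> u m <= u n).
  intros m n H; induction H; [lra|]; pose proof (Hu m0); lra.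
destruct (ex_finite_lim_seq_incr u (u 0%nat + w / 2 ^ 0)) as [l Hl].
- intro; apply Hu.
- intro n; pose proof (Hub 0%nat n ltac:(lia)); pose proof (Hpos n); lra.
exists l; intro n; split.
- apply (is_lim_seq_incr_compare u); auto; intro; apply Hu.
- apply (is_lim_seq_le_const (fun m => u (m + n)%nat)).
  + now apply is_lim_seq_incr_n.
  + intro m; pose proof (Hub n (m + n)%nat ltac:(lia)); pose proof (Hpos (m + n)%nat); lra.
Qed.

Lemma corner_circ n :
  Rabs (circ P Q a c s r) / 4 ^ n
  <= Rabs (circ P Q (fst (corner n)) (snd (corner n)) (s / 2 ^ n) (r / 2 ^ n)).
Proof.
induction n as [|n IH].
- simpl; rewrite !Rdiv_1_r; lra.
- destruct (corner_step n) as (_ & _ & H).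
  eapply Rle_trans; [|exact H].
  replace (Rabs (circ P Q a c s r) / 4 ^ S n) with (Rabs (circ P Q a c s r) / 4 ^ n / 4).
    lra.
  simpl; field; apply pow_nonzero; lra.
Qed.

(** At the common point of the rectangles the affine part of the form has circulation 0. At level
    [m] the error is at most [e * (s + r) / 2 ^ m] on a perimeter [2 * (s + r) / 2 ^ m]; both
    factors scale like [2 ^ m], which matches the lower bound by the total circulation over
    [4 ^ m]. *)
Lemma circ_closed_aux : closed_form P Q -> circ P Q a c s r = 0.
Proof.
intros Hcl.
destruct (nested_limit (fun n => fst (corner n)) s Hs) as [x0 Hx0].
  intro; apply corner_step.
destruct (nested_limit (fun n => snd (corner n)) r Hr) as [y0 Hy0].
  intro; apply corner_step.
destruct (Hcl x0 y0) as (p1 & p2 & q2 & Hd).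
apply (eq_of_close _ _ (2 * (s + r) * (s + r))); intros e He.
rewrite Rminus_0_r.
destruct (Hd e He) as (d & Hdp & Hdd).
(* The integer part of [(s + r) / d] is enough because [2 ^ S n] is at least [n + 1]; the rectangle
   of level [S n] then lies within [d] of the limit point. *)
destruct (nfloor_ex ((s + r) / d)) as [n Hn]; [apply Rdiv_le_0_compat; lra|].
assert (Hn2 : (s + r) / 2 ^ S n < d).
  assert (INR n + 1 <= 2 ^ S n).
    clear; induction n as [|n IH]; [simpl; lra|].
    rewrite S_INR; rewrite <- tech_pow_Rmult; pose proof (pos_INR n); lra.
  apply Rmult_lt_reg_r with (2 ^ S n / d).
    apply Rdiv_lt_0_compat; auto; apply pow2_pos.
  replace ((s + r) / 2 ^ S n * (2 ^ S n / d)) with ((s + r) / d).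
  2: { field; split; [lra|apply pow_nonzero; lra]. }
  replace (d * (2 ^ S n / d)) with (2 ^ S n) by (field; lra). lra.
set (m := S n) in *.
assert (H2s : 0 <= s / 2 ^ m) by (apply Rdiv_le_0_compat; auto; apply pow2_pos).
assert (H2r : 0 <= r / 2 ^ m) by (apply Rdiv_le_0_compat; auto; apply pow2_pos).
assert (Esr : (s + r) / 2 ^ m = s / 2 ^ m + r / 2 ^ m) by (unfold Rdiv; ring).
set (P' := fun x y => P x0 y0 + p1 * (x - x0) + p2 * (y - y0)).
set (Q' := fun x y => Q x0 y0 + p2 * (x - x0) + q2 * (y - y0)).
assert (HP' : cont2 P') by (unfold P'; solve_cont2).
assert (HQ' : cont2 Q') by (unfold Q'; solve_cont2).
pose proof (circ_minus P Q P' Q' (fst (corner m)) (snd (corner m)) (s / 2 ^ m) (r / 2 ^ m)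
  HP HQ HP' HQ') as E.
unfold P' at 2, Q' at 2 in E; rewrite circ_affine, Rminus_0_r in E.
pose proof (corner_circ m) as HL; rewrite <- E in HL.
assert (HU : Rabs (circ (fun x y => P x y - P' x y) (fun x y => Q x y - Q' x y)
  (fst (corner m)) (snd (corner m)) (s / 2 ^ m) (r / 2 ^ m))
  <= 2 * (s / 2 ^ m + r / 2 ^ m) * (e * (s / 2 ^ m + r / 2 ^ m))).
  apply circ_bound; auto; [solve_cont2|solve_cont2|].
  intros x y Hx Hy; specialize (Hx0 m); specialize (Hy0 m).
  assert (Hax : Rabs (x - x0) <= s / 2 ^ m) by (apply Rabs_le; lra).
  assert (Hay : Rabs (y - y0) <= r / 2 ^ m) by (apply Rabs_le; lra).
  destruct (Hdd x y) as [B1 B2]; [lra|lra|].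
  assert (e * (Rabs (x - x0) + Rabs (y - y0)) <= e * (s / 2 ^ m + r / 2 ^ m))
    by (apply Rmult_le_compat_l; lra).
  unfold P', Q'; lra.
pose proof (Rle_trans _ _ _ HL HU) as HF; rewrite <- Esr in HF.
assert (H4 : 0 < 4 ^ m) by (apply pow_lt; lra).
apply Rmult_le_reg_r with (/ 4 ^ m); [now apply Rinv_0_lt_compat|].
eapply Rle_trans; [exact HF|]; right.
replace 4 with (2 * 2) by ring; rewrite Rpow_mult_distr.
field; apply pow_nonzero; lra.
Qed.
End Bisection.

Lemma continuity_2d_of_linear_approx P x0 y0 p1 p2 d : 0 < d ->
  (forall x y, Rabs (x - x0) < d -> Rabs (y - y0) < d ->
    Rabs (P x y - (P x0 y0 + p1 * (x - x0) + p2 * (y - y0)))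
      <= 1 * (Rabs (x - x0) + Rabs (y - y0))) ->
  continuity_2d_pt P x0 y0.
Proof.
intros Hdp Hdd [e He].
set (K := 1 + Rabs p1 + Rabs p2).
assert (HK : 0 < K) by (unfold K; pose proof (Rabs_pos p1); pose proof (Rabs_pos p2); lra).
assert (Hm : 0 < Rmin d (e / (3 * K))).
  apply Rmin_glb_lt; auto; apply Rdiv_lt_0_compat; lra.
exists (mkposreal _ Hm); simpl; intros x y Hx Hy.
assert (Hxd : Rabs (x - x0) < d) by (eapply Rlt_le_trans; [exact Hx|apply Rmin_l]).
assert (Hyd : Rabs (y - y0) < d) by (eapply Rlt_le_trans; [exact Hy|apply Rmin_l]).
assert (Hxe : Rabs (x - x0) < e / (3 * K)) by (eapply Rlt_le_trans; [exact Hx|apply Rmin_r]).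
assert (Hye : Rabs (y - y0) < e / (3 * K)) by (eapply Rlt_le_trans; [exact Hy|apply Rmin_r]).
pose proof (Hdd x y Hxd Hyd) as B.
replace (P x y - P x0 y0) with ((P x y - (P x0 y0 + p1 * (x - x0) + p2 * (y - y0)))
  + p1 * (x - x0) + p2 * (y - y0)) by ring.
apply Rle_lt_trans with (K * (Rabs (x - x0) + Rabs (y - y0))).
  eapply Rle_trans; [apply Rabs_triang|].
  eapply Rle_trans; [apply Rplus_le_compat_r, Rabs_triang|].
  rewrite !Rabs_mult; unfold K.
  pose proof (Rabs_pos p1); pose proof (Rabs_pos p2); pose proof (Rabs_pos (x - x0)).
  pose proof (Rabs_pos (y - y0)); nra.
apply Rle_lt_trans with (K * (2 * (e / (3 * K)))).
  apply Rmult_le_compat_l; lra.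
replace (K * (2 * (e / (3 * K)))) with (2 * e / 3) by (field; lra); lra.
Qed.

Lemma cont2_of_closed_form P Q : closed_form P Q -> cont2 P /\ cont2 Q.
Proof.
intros H; split; intros x0 y0; destruct (H x0 y0) as (p1 & p2 & q2 & Hd);
  destruct (Hd 1 Rlt_0_1) as (d & Hdp & Hdd).
- apply (continuity_2d_of_linear_approx P x0 y0 p1 p2 d); auto.
  intros x y Hx Hy; exact (proj1 (Hdd x y Hx Hy)).
- apply (continuity_2d_of_linear_approx Q x0 y0 p2 q2 d); auto.
  intros x y Hx Hy; exact (proj2 (Hdd x y Hx Hy)).
Qed.

Lemma circ_closed P Q a c s r : closed_form P Q -> 0 <= s -> 0 <= r -> circ P Q a c s r = 0.
Proof.
intros H Hs Hr; destruct (cont2_of_closed_form P Q H).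
now apply circ_closed_aux.
Qed.

(** * Entire functions *)

Lemma Rabs_fst_le (z : C) : Rabs (fst z) <= Cmod z.
Proof. eapply Rle_trans; [|apply Rmax_Cmod]; apply Rmax_l. Qed.
Lemma Rabs_snd_le (z : C) : Rabs (snd z) <= Cmod z.
Proof. eapply Rle_trans; [|apply Rmax_Cmod]; apply Rmax_r. Qed.
Lemma Cmod_le_sum (z : C) : Cmod z <= Rabs (fst z) + Rabs (snd z).
Proof.
destruct z as [x y]; unfold Cmod; simpl fst; simpl snd.
pose proof (Rabs_pos x); pose proof (Rabs_pos y).
apply Rle_trans with (sqrt ((Rabs x + Rabs y) ^ 2)).
- apply sqrt_le_1_alt; rewrite <- (pow2_abs x), <- (pow2_abs y); nra.
- rewrite sqrt_pow2; lra.
Qed.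
Lemma Cmod_sqr (z : C) : Cmod z ^ 2 = fst z ^ 2 + snd z ^ 2.
Proof.
unfold Cmod; rewrite pow2_sqrt; auto.
pose proof (pow2_ge_0 (fst z)); pose proof (pow2_ge_0 (snd z)); lra.
Qed.

Lemma entire_eps F : entire F -> forall z, exists D : C, forall e, 0 < e ->
  exists d, 0 < d /\ forall z' : C, Cmod (z' - z)%C < d ->
    Cmod (F z' - F z - (z' - z) * D)%C <= e * Cmod (z' - z)%C.
Proof.
intros HF z; destruct (HF z) as [D [_ HD]]; exists D; intros e He.
destruct (HD z (fun P H => H) (mkposreal e He)) as [d Hd].
exists d; split; [apply cond_pos|]; intros z' Hz'; exact (Hd z' Hz').
Qed.

Lemma Cplus_minus_r (z y : C) : (z + (y - z))%C = y.
Proof. ring. Qed.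

Lemma is_derive_C_intro (F : C -> C) (z D : C) :
  (forall e, 0 < e -> exists d, 0 < d /\ forall h : C, Cmod h < d ->
    Cmod (F (z + h) - F z - h * D)%C <= e * Cmod h) ->
  is_derive (K := C_AbsRing) (V := C_NormedModule) F z D.
Proof.
intros H; split.
- apply (is_linear_scal_l (K := C_AbsRing) (V := C_NormedModule) D).
- intros x Hx.
  assert (E : z = x).
    apply (is_filter_lim_locally_unique (K := C_AbsRing) (V := AbsRing_NormedModule C_AbsRing)).
    exact Hx.
  subst x; intros [e He]; destruct (H e He) as (d & Hd & HH).
  exists (mkposreal d Hd); intros y Hy.
  change (Cmod (F y - F z - (y - z) * D)%C <= e * Cmod (y - z)%C).
  specialize (HH (y - z)%C Hy); now rewrite Cplus_minus_r in HH.
Qed.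

Lemma is_derive_quadratic (F : C -> C) (z D : C) (d K : R) : 0 < d ->
  (forall h : C, Cmod h < d -> Cmod (F (z + h) - F z - h * D)%C <= K * Cmod h ^ 2) ->
  is_derive (K := C_AbsRing) (V := C_NormedModule) F z D.
Proof.
intros Hd H; apply is_derive_C_intro; intros e He; pose proof (Rabs_pos K).
exists (Rmin d (e / (Rabs K + 1))); split.
  apply Rmin_glb_lt; auto; apply Rdiv_lt_0_compat; lra.
intros h Hh; set (m := Cmod h) in *.
assert (Hm0 : 0 <= m) by apply Cmod_ge_0.
assert (Hmd : m < d) by (eapply Rlt_le_trans; [exact Hh|apply Rmin_l]).
assert (Hme : m < e / (Rabs K + 1)) by (eapply Rlt_le_trans; [exact Hh|apply Rmin_r]).
eapply Rle_trans; [now apply H|]; fold m.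
assert (m * (Rabs K + 1) <= e).
  apply Rmult_le_reg_r with (/ (Rabs K + 1)); [apply Rinv_0_lt_compat; lra|].
  rewrite Rmult_assoc, Rinv_r, Rmult_1_r by lra; apply Rlt_le, Hme.
pose proof (Rle_abs K); nra.
Qed.

(* Coquelicot gives [C] two normed module structures over itself with the same norm. *)
Lemma is_derive_C_iff (F : C -> C) (z D : C) :
  is_derive (K := C_AbsRing) (V := C_NormedModule) F z D <->
  is_derive (K := C_AbsRing) (V := AbsRing_NormedModule C_AbsRing) F z D.
Proof.
split; intros [_ H]; split; try exact H.
- apply (is_linear_scal_l (K := C_AbsRing) (V := AbsRing_NormedModule C_AbsRing) D).
- apply (is_linear_scal_l (K := C_AbsRing) (V := C_NormedModule) D).
Qed.

Lemma entire_mult F G : entire F -> entire G -> entire (fun z => F z * G z)%C.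
Proof.
intros HF HG z; destruct (HF z) as [DF HDF]; destruct (HG z) as [DG HDG].
apply is_derive_C_iff in HDF, HDG.
eexists; apply is_derive_C_iff, (is_derive_mult (K := C_AbsRing) F G z DF DG HDF HDG).
intros n m; apply Cmult_comm.
Qed.
Lemma entire_comp_affine F (a b : C) : entire F -> entire (fun z => F (a * z + b))%C.
Proof.
intros HF z; destruct (HF (a * z + b)%C) as [D HD].
eexists; apply (is_derive_comp (K := C_AbsRing) (V := C_NormedModule) F
  (fun z => a * z + b)%C z D a HD).
apply is_derive_C_iff, (is_derive_quadratic (fun z => a * z + b)%C z a 1 0); [lra|].
intros h _; replace (a * (z + h) + b - (a * z + b) - h * a)%C with (RtoC 0) by ring.
rewrite Cmod_0; lra.
Qed.
Lemma entire_ext F G : (forall z, F z = G z) -> entire F -> entire G.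
Proof.
intros E HF z; destruct (HF z) as [D HD]; exists D.
apply (is_derive_ext (K := C_AbsRing) F); auto.
Qed.

(** * The complex exponential *)

Definition Cexp (z : C) : C := (exp (fst z) * cos (snd z), exp (fst z) * sin (snd z)).

Lemma Cexp_plus z w : Cexp (z + w)%C = (Cexp z * Cexp w)%C.
Proof.
apply injective_projections; simpl; rewrite exp_plus, ?cos_plus, ?sin_plus; ring.
Qed.
Lemma Cmod_Cexp z : Cmod (Cexp z) = exp (fst z).
Proof.
unfold Cmod, Cexp; simpl fst; simpl snd.
replace ((exp (fst z) * cos (snd z)) ^ 2 + (exp (fst z) * sin (snd z)) ^ 2)
  with (exp (fst z) ^ 2 * (Rsqr (sin (snd z)) + Rsqr (cos (snd z)))) by (unfold Rsqr; ring).
rewrite sin2_cos2, Rmult_1_r; apply sqrt_pow2, Rlt_le, exp_pos.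
Qed.

Lemma exp_quadratic x : Rabs x <= / 2 -> Rabs (exp x - 1 - x) <= 2 * x ^ 2.
Proof.
intros H; apply Rabs_le_between in H.
pose proof (exp_ineq1_le x); pose proof (exp_ineq1_le (- x)) as H1.
rewrite exp_Ropp in H1.
assert (exp x * (1 - x) <= 1).
  apply Rmult_le_compat_l with (r := exp x) in H1; [|apply Rlt_le, exp_pos].
  rewrite Rinv_r in H1 by (pose proof (exp_pos x); lra); lra.
rewrite Rabs_pos_eq by lra.
assert ((exp x - 1 - x) * (1 - x) <= x ^ 2) by nra. nra.
Qed.
Lemma cos_quadratic y : Rabs (cos y - 1) <= y ^ 2.
Proof.
replace (cos y - 1) with (- (2 * sin (y / 2) ^ 2)).
- rewrite Rabs_Ropp, Rabs_pos_eq by (pose proof (pow2_ge_0 (sin (y / 2))); lra).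
  pose proof (sin_lipschitz 0 (y / 2)) as H; rewrite sin_0, !Rminus_0_r in H.
  assert (sin (y / 2) ^ 2 <= (y / 2) ^ 2).
    rewrite <- (pow2_abs (sin _)), <- (pow2_abs (y / 2)); apply pow_incr; split; auto.
    apply Rabs_pos.
  pose proof (pow2_ge_0 y); lra.
- replace y with (2 * (y / 2)) at 2 by field; rewrite cos_2a_sin; ring.
Qed.
Lemma sin_quadratic y : Rabs y <= 1 -> Rabs (sin y - y) <= y ^ 2.
Proof.
intros Hy.
destruct (MVT_gen (fun x => sin x - x) 0 y (fun x => cos x - 1)) as (c & Hc & E).
- intros x _; auto_derive; auto; ring.
- intros x _; apply continuity_pt_filterlim.
  assert (Hs : cont (fun x => sin x - x)) by solve_cont; apply Hs.
- rewrite sin_0, Rminus_0_r in E; rewrite Rminus_0_r in E.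
  rewrite E, Rminus_0_r, Rabs_mult.
  pose proof (cos_quadratic c).
  assert (c ^ 2 <= y ^ 2).
    unfold Rmin, Rmax in Hc; destruct (Rle_dec 0 y) in Hc; nra.
  pose proof (Rabs_pos y); pose proof (Rabs_pos (cos c - 1)); pose proof (pow2_ge_0 y); nra.
Qed.

(** A crude second-order remainder with a convenient constant. With [Cexp_plus] it gives the
    derivative everywhere, and being uniform it also allows differentiation under the integral in
    [entire_synth]. *)
Lemma Cexp_quadratic h : Cmod h <= / 2 -> Cmod (Cexp h - 1 - h)%C <= 12 * Cmod h ^ 2.
Proof.
intros Hh; destruct h as [x y].
assert (Hx := Rle_trans _ _ _ (Rabs_fst_le (x, y)) Hh).
assert (Hy := Rle_trans _ _ _ (Rabs_snd_le (x, y)) Hh).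
simpl in Hx, Hy.
pose proof (exp_quadratic x Hx) as H1; pose proof (cos_quadratic y) as H2.
assert (H3 : Rabs (sin y - y) <= y ^ 2) by (apply sin_quadratic; lra).
rewrite Cmod_sqr; simpl fst; simpl snd.
eapply Rle_trans; [apply Cmod_le_sum|].
unfold Cexp, Cminus, Cplus, Copp; simpl fst; simpl snd.
assert (He : exp x <= 2).
  apply Rabs_le_between in H1; apply Rabs_le_between in Hx; nra.
pose proof (exp_pos x).
pose proof (pow2_ge_0 x); pose proof (pow2_ge_0 y).
assert (Hxy : Rabs (exp x - 1) * Rabs y <= 2 * (x ^ 2 + y ^ 2)).
  assert (Rabs (exp x - 1) <= 2 * Rabs x).
    replace (exp x - 1) with ((exp x - 1 - x) + x) by ring.
    eapply Rle_trans; [apply Rabs_triang|].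
    rewrite <- (pow2_abs x) in H1; pose proof (Rabs_pos x); nra.
  rewrite <- (pow2_abs x), <- (pow2_abs y).
  pose proof (Rabs_pos x); pose proof (Rabs_pos y); pose proof (pow2_ge_0 (Rabs x - Rabs y)).
  apply Rle_trans with (2 * Rabs x * Rabs y); [apply Rmult_le_compat_r; auto|nra].
replace (exp x * cos y + - (1) + - x) with ((exp x - 1 - x) + exp x * (cos y - 1)) by ring.
replace (exp x * sin y + - 0 + - y) with (exp x * (sin y - y) + (exp x - 1) * y) by ring.
pose proof (Rabs_triang (exp x - 1 - x) (exp x * (cos y - 1))) as T1.
pose proof (Rabs_triang (exp x * (sin y - y)) ((exp x - 1) * y)) as T2.
rewrite !Rabs_mult, (Rabs_pos_eq (exp x)) in * by lra.
pose proof (Rabs_pos (cos y - 1)); pose proof (Rabs_pos (sin y - y)).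
nra.
Qed.

Lemma entire_Cexp : entire Cexp.
Proof.
intro z; exists (Cexp z); apply (is_derive_quadratic Cexp z (Cexp z) (/ 2) (Cmod (Cexp z) * 12)); [lra|].
intros h Hh; rewrite Cexp_plus.
replace (Cexp z * Cexp h - Cexp z - h * Cexp z)%C with (Cexp z * (Cexp h - 1 - h))%C by ring.
rewrite Cmod_mult, Rmult_assoc; apply Rmult_le_compat_l; [apply Cmod_ge_0|].
apply Cexp_quadratic; lra.
Qed.

(* Cauchy-Riemann: both [Re (F dz)] and [Im (F dz)] are closed. *)
Lemma entire_closed F : entire F ->
  closed_form (fun x y => fst (F (x, y))) (fun x y => - snd (F (x, y))) /\
  closed_form (fun x y => snd (F (x, y))) (fun x y => fst (F (x, y))).
Proof.
intros HF.
assert (H : forall x0 y0, exists p q, forall e, 0 < e -> exists d, 0 < d /\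
  forall x y, Rabs (x - x0) < d -> Rabs (y - y0) < d ->
    Rabs (fst (F (x, y)) - (fst (F (x0, y0)) + p * (x - x0) + - q * (y - y0)))
      <= e * (Rabs (x - x0) + Rabs (y - y0)) /\
    Rabs (snd (F (x, y)) - (snd (F (x0, y0)) + q * (x - x0) + p * (y - y0)))
      <= e * (Rabs (x - x0) + Rabs (y - y0))).
  intros x0 y0; destruct (entire_eps F HF (x0, y0)) as [[p q] HD]; exists p, q.
  intros e He; destruct (HD e He) as (d & Hd & HH); exists (d / 2); split; [lra|].
  intros x y Hx Hy.
  assert (Hm : Cmod ((x, y) - (x0, y0))%C <= Rabs (x - x0) + Rabs (y - y0)).
    eapply Rle_trans; [apply Cmod_le_sum|]; simpl; unfold Rminus; lra.
  specialize (HH (x, y) ltac:(lra)).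
  assert (HHe : Cmod (F (x, y) - F (x0, y0) - ((x, y) - (x0, y0)) * (p, q))%C
    <= e * (Rabs (x - x0) + Rabs (y - y0))).
    eapply Rle_trans; [exact HH|]; apply Rmult_le_compat_l; lra.
  pose proof (Rabs_fst_le (F (x, y) - F (x0, y0) - ((x, y) - (x0, y0)) * (p, q))%C) as B1.
  pose proof (Rabs_snd_le (F (x, y) - F (x0, y0) - ((x, y) - (x0, y0)) * (p, q))%C) as B2.
  simpl in B1, B2; split.
  - eapply Rle_trans; [|exact HHe]; eapply Rle_trans; [|exact B1]; right; f_equal; ring.
  - eapply Rle_trans; [|exact HHe]; eapply Rle_trans; [|exact B2]; right; f_equal; ring.
split; intros x0 y0; destruct (H x0 y0) as (p & q & Hpq).
- exists p, (- q), (- p); intros e He; destruct (Hpq e He) as (d & Hd & HH).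
  exists d; split; auto; intros x y Hx Hy; destruct (HH x y Hx Hy) as [B1 B2]; split; auto.
  rewrite <- Rabs_Ropp; eapply Rle_trans; [|exact B2]; right; f_equal; ring.
- exists q, p, (- q); intros e He; destruct (Hpq e He) as (d & Hd & HH).
  exists d; split; auto; intros x y Hx Hy; destruct (HH x y Hx Hy) as [B1 B2]; split; auto.
Qed.

Lemma entire_cont2 F : entire F ->
  cont2 (fun x y => fst (F (x, y))) /\ cont2 (fun x y => snd (F (x, y))).
Proof.
intros HF; destruct (entire_closed F HF) as [_ H].
destruct (cont2_of_closed_form _ _ H); auto.
Qed.

(** * Analytic continuation of Laplace and Fourier integrals *)

(** [D k] is the [k]-th derivative of [D 0]. The common bound [exp (Rabs t)] treats [exp (- t)],
    [cos] and [sin] at once: against a weight decaying like [exp (- rho * x)], each yields an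
    integral analytic in the parameter. *)
Definition smooth_family (D : nat -> R -> R) : Prop :=
  (forall k t, is_derive (D k) t (D (S k) t)) /\ (forall k t, Rabs (D k t) <= exp (Rabs t)).

Lemma is_derive_n_family (D : nat -> R -> R) : (forall k t, is_derive (D k) t (D (S k) t)) ->
  forall k t, is_derive_n (D 0%nat) k t (D k t).
Proof.
intros HD k; induction k as [|k IH]; intro t; [reflexivity|].
apply (is_derive_ext (D k)); auto.
intro s; symmetry; apply is_derive_n_unique, IH.
Qed.

Definition taylor (D : nat -> R -> R) (n : nat) (y : R) : R :=
  sum_f_R0 (fun k => D k 0 / INR (fact k) * y ^ k) n.

(** Taylor's formula is applied on [[0, 1]] to [s] mapped to [D 0 (s * y)], so that the sign of [y]
    need not be distinguished. *)
Lemma taylor_remainder D n y : smooth_family D ->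
  Rabs (D 0%nat y - taylor D n y) <= Rabs y ^ S n / INR (fact (S n)) * exp (Rabs y).
Proof.
intros [HD HB].
set (G := fun k s => y ^ k * D k (s * y)).
assert (HG : forall k s, is_derive (G k) s (G (S k) s)).
  intros k s; unfold G.
  replace (y ^ S k * D (S k) (s * y)) with (scal (y ^ k) (scal y (D (S k) (s * y))))
    by (unfold scal; simpl; unfold mult; simpl; ring).
  apply (is_derive_scal (fun s => D k (s * y)) s (y ^ k)).
  apply (is_derive_comp (D k) (fun s => s * y)); auto.
  auto_derive; auto; ring.
pose proof (is_derive_n_family G HG) as Hn.
destruct (Taylor_Lagrange (G 0%nat) n 0 1 Rlt_0_1) as (z & Hz & E).
  intros t _ [|k] _; [exact I|]. eexists; apply (Hn (S k)).
rewrite (is_derive_n_unique _ _ _ _ (Hn (S n) z)) in E.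
replace (D 0%nat y - taylor D n y) with (y ^ S n / INR (fact (S n)) * D (S n) (z * y)).
- pose proof (INR_fact_lt_0 (S n)).
  unfold Rdiv; rewrite !Rabs_mult, <- RPow_abs, (Rabs_pos_eq (/ _)) by
    (apply Rlt_le, Rinv_0_lt_compat; auto).
  apply Rmult_le_compat_l.
    apply Rmult_le_pos; [apply pow_le, Rabs_pos|apply Rlt_le, Rinv_0_lt_compat; auto].
  eapply Rle_trans; [apply HB|]; apply exp_le.
  rewrite Rabs_mult, (Rabs_pos_eq z) by lra; pose proof (Rabs_pos y); nra.
- assert (Eg : G 0%nat 1 = D 0%nat y) by (unfold G; simpl; rewrite !Rmult_1_l; reflexivity).
  rewrite Eg in E; rewrite E.
  replace (sum_f_R0 (fun m => (1 - 0) ^ m / INR (fact m) * Derive_n (G 0%nat) m 0) n)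
    with (taylor D n y).
  + unfold G; rewrite Rminus_0_r, pow1; field; apply INR_fact_neq_0.
  + apply sum_eq; intros k _; rewrite (is_derive_n_unique _ _ _ _ (Hn k 0)).
    unfold G; rewrite Rminus_0_r, pow1, Rmult_0_l; field; apply INR_fact_neq_0.
Qed.

Lemma pow_div_fact_le_exp x k : 0 <= x -> x ^ k / INR (fact k) <= exp x.
Proof.
intros Hx; eapply Rle_trans; [|apply (exp_ge_taylor x k Hx)].
assert (Hp : forall j, 0 <= x ^ j / INR (fact j)).
  intro j; apply Rdiv_le_0_compat; [now apply pow_le|apply INR_fact_lt_0].
destruct k as [|k]; [simpl; lra|].
rewrite tech5.
pose proof (cond_pos_sum (fun j => x ^ j / INR (fact j)) k Hp); lra.
Qed.

Lemma L1_moment K rho k : 0 < rho -> cont K -> L1 (fun x => K x * exp (rho * x)) ->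
  L1 (fun x => K x * x ^ k).
Proof.
intros Hr Hc HK; apply (L1_dominated _ _ (INR (fact k) / rho ^ k)) with (2 := HK); [solve_cont|].
intros x Hx; rewrite !Rabs_mult.
rewrite (Rabs_pos_eq (x ^ k)) by now apply pow_le.
rewrite (Rabs_pos_eq (exp _)) by apply Rlt_le, exp_pos.
pose proof (pow_div_fact_le_exp (rho * x) k ltac:(nra)) as H.
pose proof (INR_fact_lt_0 k); assert (Hrk : 0 < rho ^ k) by now apply pow_lt.
assert (x ^ k <= INR (fact k) / rho ^ k * exp (rho * x)).
  replace (x ^ k) with (INR (fact k) / rho ^ k * ((rho * x) ^ k / INR (fact k))).
  - apply Rmult_le_compat_l; auto; apply Rlt_le, Rdiv_lt_0_compat; auto.
  - rewrite Rpow_mult_distr; field; split; lra.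
pose proof (Rabs_pos (K x)); nra.
Qed.

Lemma J_taylor K rho D n h : 0 < rho -> cont K -> L1 (fun x => K x * exp (rho * x)) ->
  L1 (fun x => K x * taylor D n (h * x)) /\
  J (fun x => K x * taylor D n (h * x))
  = sum_f_R0 (fun k => (D k 0 / INR (fact k) * J (fun x => K x * x ^ k)) * h ^ k) n.
Proof.
intros Hr Hc HK; induction n as [|n [IH1 IH2]].
- assert (E : forall x, D 0%nat 0 / INR (fact 0) * (K x * x ^ 0) = K x * taylor D 0 (h * x)).
    intro x; unfold taylor; simpl; field.
  split.
  + apply (L1_ext _ _ E), L1_mulc; now apply (L1_moment K rho).
  + rewrite <- (J_ext _ _ (fun x _ => E x)), J_mulc by now apply (L1_moment K rho).
    simpl; ring.
- set (a := D (S n) 0 / INR (fact (S n)) * h ^ S n).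
  assert (E : forall x, K x * taylor D n (h * x) + a * (K x * x ^ S n)
    = K x * taylor D (S n) (h * x)).
    intro x; unfold taylor; rewrite (tech5 _ n), Rpow_mult_distr; unfold a; ring.
  assert (Ha : L1 (fun x => a * (K x * x ^ S n))) by now apply L1_mulc, (L1_moment K rho).
  split.
  + apply (L1_ext _ _ E); now apply L1_plus.
  + rewrite <- (J_ext _ _ (fun x _ => E x)), J_plus, IH2, J_mulc by
      (auto; now apply (L1_moment K rho)).
    rewrite tech5; f_equal; unfold a; ring.
Qed.

(** The exponential weight leaves room for the factorials: the Taylor remainder of order [n],
    integrated against [K], decays geometrically like [q ^ S n]. *)
Lemma is_pseries_J K rho D h : 0 < rho -> cont K -> L1 (fun x => K x * exp (rho * x)) ->
  smooth_family D -> Rabs h < rho / 2 ->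
  L1 (fun x => K x * D 0%nat (h * x)) /\
  is_pseries (fun k => D k 0 / INR (fact k) * J (fun x => K x * x ^ k)) h
    (J (fun x => K x * D 0%nat (h * x))).
Proof.
intros Hr Hc HK HD Hh; pose proof (Rabs_pos h) as Hh0.
assert (HDc : cont (D 0%nat)) by (apply (cont_derivable _ (D 1%nat)), HD).
(* Splitting [exp (rho * x)] as [exp ((rho - |h|) * x)] times [exp (|h| * x)], the first factor
   absorbs the power over the factorial and the second the exponential in the remainder. What is
   left is [q], below 1 because [|h| < rho / 2]. *)
set (q := Rabs h / (rho - Rabs h)).
assert (Hq : 0 <= q < 1).
  unfold q; split; [apply Rdiv_le_0_compat; lra|].
  apply Rmult_lt_reg_r with (rho - Rabs h); [lra|]; field_simplify; lra.
assert (Hrem : forall n x, 0 <= x -> Rabs (K x * D 0%nat (h * x) - K x * taylor D n (h * x))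
  <= q ^ S n * Rabs (K x * exp (rho * x))).
  intros n x Hx; rewrite <- Rmult_minus_distr_l, !Rabs_mult.
  rewrite (Rabs_pos_eq (exp _)) by apply Rlt_le, exp_pos.
  replace (q ^ S n * (Rabs (K x) * exp (rho * x)))
    with (Rabs (K x) * (q ^ S n * exp (rho * x))) by ring.
  apply Rmult_le_compat_l; [apply Rabs_pos|].
  eapply Rle_trans; [now apply taylor_remainder|].
  rewrite Rabs_mult, (Rabs_pos_eq x) by auto.
  pose proof (INR_fact_lt_0 (S n)).
  replace ((Rabs h * x) ^ S n / INR (fact (S n)))
    with (q ^ S n * (((rho - Rabs h) * x) ^ S n / INR (fact (S n)))).
  2: { replace (Rabs h * x) with (q * ((rho - Rabs h) * x)) by (unfold q; field; lra).
    rewrite (Rpow_mult_distr q); field; lra. }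
  rewrite Rmult_assoc; apply Rmult_le_compat_l; [apply pow_le; lra|].
  replace (rho * x) with ((rho - Rabs h) * x + Rabs h * x) by ring; rewrite exp_plus.
  apply Rmult_le_compat_r; [apply Rlt_le, exp_pos|].
  apply pow_div_fact_le_exp; nra.
assert (HL : L1 (fun x => K x * D 0%nat (h * x))).
  apply (L1_ext (fun x => (K x * D 0%nat (h * x) - K x * taylor D 0 (h * x))
    + K x * taylor D 0 (h * x))); [intro; ring|].
  destruct (J_taylor K rho D 0 h Hr Hc HK) as [Ht _].
  apply L1_plus; auto.
  apply (L1_dominated _ (fun x => K x * exp (rho * x)) (q ^ 1)); auto.
  pose proof (L1_cont _ Ht); solve_cont.
split; auto.
apply is_pseries_R, is_series_Reals.
destruct (proj2 HK) as [M HM]; pose proof (L1_bound_nonneg _ _ HM) as HM0.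
intros e He.
destruct (pow_lt_1_zero q) with (y := e / (M + 1)) as [N HN].
  rewrite Rabs_pos_eq; lra.
  apply Rdiv_lt_0_compat; lra.
exists N; intros n Hn.
destruct (J_taylor K rho D n h Hr Hc HK) as [Ht Et].
unfold Rdist; rewrite <- Et, Rabs_minus_sym, <- J_minus by auto.
eapply Rle_lt_trans; [apply (J_dominated _ (fun x => q ^ S n * Rabs (K x * exp (rho * x))))|].
- pose proof (L1_cont _ Ht); solve_cont.
- now apply L1_mulc, L1_abs.
- intros; now apply (Hrem n).
- rewrite J_mulc by now apply L1_abs.
  pose proof (J_abs_bound _ M HK HM) as HJ.
  specialize (HN (S n) ltac:(lia)); pose proof (pow_le q (S n) (proj1 Hq)).
  rewrite Rabs_pos_eq in HN by auto.
  apply Rle_lt_trans with (q ^ S n * M); [apply Rmult_le_compat_l; auto|].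
  apply Rle_lt_trans with (q ^ S n * (M + 1)); [nra|].
  apply Rlt_le_trans with (e / (M + 1) * (M + 1)).
  + apply Rmult_lt_compat_r; lra.
  + right; field; lra.
Qed.

(** The identity theorem for one power series: convergence at [r / 2] gives a positive radius, and
    the coefficients are derivatives at 0 of a locally vanishing function. *)
Lemma pseries_zero (a : nat -> R) (r d : R) (f : R -> R) : 0 < d -> 0 < r ->
  (forall h, Rabs h < r -> is_pseries a h (f h)) ->
  (forall h, Rabs h < d -> f h = 0) ->
  forall h, Rabs h < r -> f h = 0.
Proof.
intros Hd Hr Ha Hz.
assert (Hcv : Rbar_lt 0 (CV_radius a)).
  apply Rbar_not_le_lt; intro Hle.
  assert (Hlt : Rbar_lt (CV_radius a) (Rabs (r / 2))).
    eapply Rbar_le_lt_trans; [exact Hle|]; simpl; rewrite Rabs_pos_eq; lra.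
  apply (CV_disk_outside a (r / 2) Hlt).
  apply ex_series_lim_0.
  exists (f (r / 2)); apply (proj1 (is_pseries_R a (r / 2) _)), Ha.
  rewrite Rabs_pos_eq; lra.
assert (H0 : forall n, a n = 0).
  intro n; pose proof (Derive_n_coef a n Hcv) as E.
  rewrite (Derive_n_ext_loc _ (fun _ => 0)) in E.
  - assert (E0 : Derive_n (fun _ : R => 0) n 0 = 0).
      destruct n as [|n]; [reflexivity|apply Derive_n_const].
    change (Derive_n (fun _ : R => 0) n 0 = a n * INR (fact n)) in E.
    rewrite E0 in E; symmetry in E; apply Rmult_integral in E; destruct E as [E|E]; auto.
    exfalso; exact (INR_fact_neq_0 n E).
  - assert (Hm : 0 < Rmin r d) by now apply Rmin_glb_lt.
    exists (mkposreal _ Hm); intros h Hh.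
    change (Rabs (h - 0) < Rmin r d) in Hh; rewrite Rminus_0_r in Hh.
    rewrite <- (Hz h) by (eapply Rlt_le_trans; [exact Hh|apply Rmin_r]).
    apply is_pseries_unique, Ha; eapply Rlt_le_trans; [exact Hh|apply Rmin_l].
intros h Hh; rewrite <- (is_pseries_unique _ _ _ (Ha h Hh)).
rewrite (PSeries_ext a (fun _ => 0) h H0).
apply PSeries_const_0.
Qed.

Lemma smooth_family_exp_neg : smooth_family (fun k t => (-1) ^ k * exp (- t)).
Proof.
split.
- intros k t; auto_derive; auto; simpl; ring.
- intros k t; rewrite Rabs_mult, pow_1_abs, Rmult_1_l, (Rabs_pos_eq (exp _)) by
    apply Rlt_le, exp_pos.
  apply exp_le; pose proof (Rle_abs (- t)); rewrite Rabs_Ropp in H; lra.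
Qed.
Lemma exp_abs_ge_1 t : 1 <= exp (Rabs t).
Proof. rewrite <- exp_0; apply exp_le, Rabs_pos. Qed.
Lemma smooth_family_cos : smooth_family (fun k t => cos (t + INR k * (PI / 2))).
Proof.
split.
- intros k t; auto_derive; auto.
  rewrite S_INR; replace (t + (INR k + 1) * (PI / 2)) with ((t + INR k * (PI / 2)) + PI / 2) by ring.
  rewrite cos_plus, cos_PI2, sin_PI2; ring.
- intros k t; eapply Rle_trans; [apply Rabs_cos_le|apply exp_abs_ge_1].
Qed.
Lemma smooth_family_sin : smooth_family (fun k t => sin (t + INR k * (PI / 2))).
Proof.
split.
- intros k t; auto_derive; auto.
  rewrite S_INR; replace (t + (INR k + 1) * (PI / 2)) with ((t + INR k * (PI / 2)) + PI / 2) by ring.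
  rewrite sin_plus, cos_PI2, sin_PI2; ring.
- intros k t; eapply Rle_trans; [apply Rabs_sin_le|apply exp_abs_ge_1].
Qed.

Lemma J_kernel_limit g (th : R -> R) : L1 g -> cont th ->
  (forall x, 0 <= x -> Rabs (th x) <= 1) -> (forall x, 0 <= x -> Rabs (th x - th 0) <= x) ->
  forall e, 0 < e -> exists d, 0 < d /\ forall s, 0 < s < d ->
  Rabs (J (fun x => g x * th (s * x)) - th 0 * J g) <= e.
Proof.
intros Hg Hth Hb Hl e He.
assert (Hc := L1_cont g Hg); destruct (proj2 Hg) as [M HM].
assert (HM0 := L1_bound_nonneg g M HM).
destruct (J_split g M Hg HM (e / 4)) as (A & HA & Hs); [lra|].
assert (HMA : 0 < A * (M + 1)) by nra.
exists (e / 4 / (A * (M + 1))); split; [apply Rdiv_lt_0_compat; nra|].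
intros s [Hs0 Hsd].
assert (HL : L1 (fun x => g x * th (s * x))).
  apply (L1_dominated _ g 1); auto; [solve_cont|].
  intros x Hx; rewrite Rmult_1_l; apply Rabs_mult_le_l, Hb; nra.
rewrite <- J_mulc, <- J_minus by auto using L1_mulc.
apply Rle_trans with (Rabs (s * A) * M + 2 * (e / 4)).
- apply Hs; try lra; [solve_cont| |]; intros x Hx;
    replace (g x * th (s * x) - th 0 * g x) with ((th (s * x) - th 0) * g x) by ring;
    rewrite Rabs_mult; apply Rmult_le_compat_r; try apply Rabs_pos.
  + eapply Rle_trans; [apply Rabs_triang|]; rewrite Rabs_Ropp.
    pose proof (Hb (s * x) ltac:(nra)); pose proof (Hb 0 (Rle_refl 0)); lra.
  + eapply Rle_trans; [apply Hl|]; nra.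
- rewrite (Rabs_pos_eq (s * A)) by nra.
  assert (s * (A * (M + 1)) < e / 4).
    apply Rmult_lt_reg_r with (/ (A * (M + 1))); [now apply Rinv_0_lt_compat|].
    rewrite Rmult_assoc, Rinv_r, Rmult_1_r by lra; exact Hsd.
  nra.
Qed.

Section Continuation.
Variables (U V W : R -> R) (rho s1 : R).
Hypothesis HU : L1 U.
Hypothesis Hrho : 0 < rho.
Hypothesis HVc : cont V.
Hypothesis HWc : cont W.
Hypothesis HV : L1 (fun x => V x * exp (rho * x)).
Hypothesis HW : L1 (fun x => W x * exp (rho * x)).

Let dif (s : R) : R :=
  J (fun x => U x * exp (- (s * x))) - J (fun x => V x * cos (s * x) + W x * sin (s * x)).

Lemma L1_of_exp_weight K : cont K -> L1 (fun x => K x * exp (rho * x)) -> L1 K.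
Proof.
intros Hc HK; apply (L1_ext (fun x => K x * x ^ 0)); [intro; simpl; ring|].
now apply (L1_moment K rho).
Qed.

Lemma L1_weight_le K r : cont K -> r <= rho -> L1 (fun x => K x * exp (rho * x)) ->
  L1 (fun x => K x * exp (r * x)).
Proof.
intros Hc Hr HK; apply (L1_dominated _ _ 1) with (2 := HK); [solve_cont|].
intros x Hx; rewrite !Rabs_mult, Rmult_1_l, !(Rabs_pos_eq (exp _)) by apply Rlt_le, exp_pos.
apply Rmult_le_compat_l; [apply Rabs_pos|]; apply exp_le; nra.
Qed.

(** Both integrals are analytic near [s0]. On the Laplace side [exp (- (s0 * x))] pays for the
    weight since [r <= s0]; on the trigonometric side the decay of [V] and [W] does since
    [r <= rho]. [K1] and [K2] are the coefficients produced by the addition formulas. *)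
Lemma dif_pseries s0 r : 0 < r -> r <= s0 -> r <= rho -> exists a : nat -> R,
  forall h, Rabs h < r / 2 -> is_pseries a h (dif (s0 + h)).
Proof.
intros Hr Hs0 Hrr; assert (HUc := L1_cont U HU).
assert (HVr := L1_weight_le V r HVc Hrr HV); assert (HWr := L1_weight_le W r HWc Hrr HW).
set (K0 := fun x => U x * exp (- (s0 * x))).
set (K1 := fun x => V x * cos (s0 * x) + W x * sin (s0 * x)).
set (K2 := fun x => W x * cos (s0 * x) - V x * sin (s0 * x)).
assert (C0 : cont K0) by (unfold K0; solve_cont).
assert (C1 : cont K1) by (unfold K1; solve_cont).
assert (C2 : cont K2) by (unfold K2; solve_cont).
assert (L0 : L1 (fun x => K0 x * exp (r * x))).
  apply (L1_dominated _ U 1); auto; [solve_cont|]; intros x Hx; unfold K0.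
  rewrite Rmult_assoc, <- exp_plus, Rmult_1_l; apply Rabs_mult_le_l.
  rewrite Rabs_pos_eq by apply Rlt_le, exp_pos; rewrite <- exp_0; apply exp_le; nra.
assert (LK1 : L1 (fun x => K1 x * exp (r * x))).
  apply (L1_ext (fun x => (V x * exp (r * x)) * cos (s0 * x) + (W x * exp (r * x)) * sin (s0 * x))).
    intro; unfold K1; ring.
  apply L1_plus; [apply (L1_cos_kernel (fun x => V x * exp (r * x)))
    |apply (L1_sin_kernel (fun x => W x * exp (r * x)))]; auto.
assert (LK2 : L1 (fun x => K2 x * exp (r * x))).
  apply (L1_ext (fun x => (W x * exp (r * x)) * cos (s0 * x) - (V x * exp (r * x)) * sin (s0 * x))).
    intro; unfold K2; ring.
  apply L1_minus; [apply (L1_cos_kernel (fun x => W x * exp (r * x)))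
    |apply (L1_sin_kernel (fun x => V x * exp (r * x)))]; auto.
eexists; intros h Hh.
destruct (is_pseries_J K0 r _ h Hr C0 L0 smooth_family_exp_neg Hh) as [M0 P0].
destruct (is_pseries_J K1 r _ h Hr C1 LK1 smooth_family_cos Hh) as [M1 P1].
destruct (is_pseries_J K2 r _ h Hr C2 LK2 smooth_family_sin Hh) as [M2 P2].
pose proof (is_pseries_minus _ _ _ _ _ P0 (is_pseries_plus _ _ _ _ _ P1 P2)) as P.
match type of P with is_pseries _ _ ?v => replace (dif (s0 + h)) with v end.
  exact P.
unfold dif; change plus with Rplus; change opp with Ropp.
match goal with |- (?a + - (?b + ?c))%R = _ => rewrite <- (J_plus _ _ M1 M2);
  unfold Rminus; f_equal; [|f_equal] end; apply J_ext; intros x Hx.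
- unfold K0; simpl; rewrite Rmult_1_l, Rmult_assoc, <- exp_plus; do 2 f_equal; ring.
- unfold K1, K2; simpl INR; rewrite Rmult_0_l, Rplus_0_r.
  replace ((s0 + h) * x) with (s0 * x + h * x) by ring; rewrite cos_plus, sin_plus; ring.
Qed.

(** Continuation to the left along the half-line: down to a fixed [sg] the expansions have a common
    radius, so finitely many steps of length [r / 8] suffice. *)
Lemma dif_zero : (forall s, s1 < s -> dif s = 0) -> forall s, 0 < s -> dif s = 0.
Proof.
intros Hz sg Hsg; set (r := Rmin sg rho).
assert (Hr : 0 < r) by (now apply Rmin_glb_lt).
assert (Hrs : r <= sg) by apply Rmin_l; assert (Hrr : r <= rho) by apply Rmin_r.
assert (HP : forall n s, sg <= s -> s1 - INR n * (r / 8) < s -> dif s = 0).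
  induction n as [|n IH]; intros s H1 H2.
  - apply Hz; simpl in H2; lra.
  - rewrite S_INR in H2.
    (* Around the centre [s + r / 4] the induction hypothesis covers the radius [r / 8], while the
       expansion is valid on the radius [r / 2] and so reaches [s] itself. *)
    destruct (dif_pseries (s + r / 4) r Hr ltac:(lra) Hrr) as [a Ha].
    replace s with ((s + r / 4) + - (r / 4)) by ring.
    apply (pseries_zero a (r / 2) (r / 8) (fun h => dif (s + r / 4 + h))); auto; try lra.
    + intros h Hh; apply Rabs_def2 in Hh; apply IH; lra.
    + rewrite Rabs_Ropp, Rabs_pos_eq; lra.
destruct (nfloor_ex (Rmax 0 ((s1 - sg) / (r / 8)))) as [n Hn]; [apply Rmax_l|].
apply (HP (n + 1)%nat sg); [lra|].
rewrite plus_INR; simpl.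
assert ((s1 - sg) / (r / 8) < INR n + 1) by (pose proof (Rmax_r 0 ((s1 - sg) / (r / 8))); lra).
apply Rmult_lt_compat_r with (r := r / 8) in H; [|lra].
unfold Rdiv in H at 1; rewrite Rmult_assoc, Rinv_l, Rmult_1_r in H by lra; lra.
Qed.

(** The second conclusion is the limit of the first as [s] decreases to 0. [U] is merely integrable,
    so nothing is analytic at 0; [J_kernel_limit] applied to [exp (- x)], [cos] and [sin] gives the
    limit instead. *)
Lemma Laplace_continuation :
  (forall s, s1 < s -> J (fun x => U x * exp (- (s * x)))
    = J (fun x => V x * cos (s * x) + W x * sin (s * x))) ->
  (forall s, 0 < s -> J (fun x => U x * exp (- (s * x)))
    = J (fun x => V x * cos (s * x) + W x * sin (s * x))) /\ J U = J V.
Proof.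
intros H.
assert (H1 : forall s, 0 < s -> J (fun x => U x * exp (- (s * x)))
    = J (fun x => V x * cos (s * x) + W x * sin (s * x))).
  intros s Hs; apply Rminus_diag_uniq, dif_zero; auto.
  intros t Ht; unfold dif; rewrite H by auto; ring.
split; auto.
assert (LV := L1_of_exp_weight V HVc HV); assert (LW := L1_of_exp_weight W HWc HW).
apply (eq_of_close _ _ 3); intros e He.
destruct (J_kernel_limit U (fun x => exp (- x)) HU) with (e := e) as (d1 & Hd1 & B1); auto.
- solve_cont.
- intros x Hx; rewrite Rabs_pos_eq by apply Rlt_le, exp_pos; now apply exp_neg_le_1.
- intros x Hx; rewrite Ropp_0, exp_0, Rabs_left1 by (pose proof (exp_neg_le_1 x Hx); lra).
  pose proof (exp_ineq1_le (- x)); lra.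
destruct (J_kernel_limit V cos LV) with (e := e) as (d2 & Hd2 & B2); auto.
- apply cont_cos, cont_id.
- intros; apply Rabs_cos_le.
- intros x Hx; eapply Rle_trans; [apply cos_lipschitz|]; rewrite Rminus_0_r, Rabs_pos_eq; lra.
destruct (J_kernel_limit W sin LW) with (e := e) as (d3 & Hd3 & B3); auto.
- apply cont_sin, cont_id.
- intros; apply Rabs_sin_le.
- intros x Hx; eapply Rle_trans; [apply sin_lipschitz|]; rewrite Rminus_0_r, Rabs_pos_eq; lra.
set (s := Rmin d1 (Rmin d2 d3) / 2).
assert (Hm : 0 < Rmin d1 (Rmin d2 d3)) by (repeat apply Rmin_glb_lt; auto).
pose proof (Rmin_l d1 (Rmin d2 d3)); pose proof (Rmin_r d1 (Rmin d2 d3)).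
pose proof (Rmin_l d2 d3); pose proof (Rmin_r d2 d3).
specialize (B1 s ltac:(unfold s; lra)); specialize (B2 s ltac:(unfold s; lra)).
specialize (B3 s ltac:(unfold s; lra)).
rewrite Ropp_0, exp_0, Rmult_1_l in B1; rewrite cos_0, Rmult_1_l in B2.
rewrite sin_0, Rmult_0_l in B3.
rewrite (H1 s) in B1 by (unfold s; lra).
rewrite (J_plus _ _ (L1_cos_kernel V s LV) (L1_sin_kernel W s LW)) in B1.
apply Rabs_le_between in B1, B2, B3; apply Rabs_le; lra.
Qed.
End Continuation.

(** * The spectrum of a function of exponential type *)

Lemma L1_exp_decay K A k : 0 < k -> cont K ->
  (forall x, 0 <= x -> Rabs (K x) <= A * exp (- k * x)) -> L1 K.
Proof.
intros Hk Hc H; split; auto; exists (Rabs A / k); intros N HN.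
apply Rle_trans with (Int (fun x => Rabs A * exp (- k * x)) 0 N).
- apply Int_mono; auto; [solve_cont..|]; intros x Hx.
  eapply Rle_trans; [apply H; lra|].
  apply Rmult_le_compat_r; [apply Rlt_le, exp_pos|apply Rle_abs].
- rewrite Int_mulc by solve_cont.
  rewrite (Int_primitive (fun x => - exp (- k * x) / k)).
  + rewrite Rmult_0_r, exp_0; unfold Rdiv; apply Rmult_le_compat_l; [apply Rabs_pos|].
    assert (0 < exp (- k * N) * / k).
      apply Rmult_lt_0_compat; [apply exp_pos|now apply Rinv_0_lt_compat].
    replace (- exp (- k * N) * / k - - (1) * / k) with (/ k - exp (- k * N) * / k) by ring.
    lra.
  + intro x; auto_derive; auto; field; lra.
  + solve_cont.
Qed.

Lemma linear_exp_decay k : 0 < k -> forall e, 0 < e -> exists N0, 0 <= N0 /\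
  forall N, N0 <= N -> N * exp (- k * N) <= e.
Proof.
intros Hk e He; destruct (exp_decay (k / 2) ltac:(lra) (e * (k / 2))) as (N0 & HN0 & H); [nra|].
exists N0; split; auto; intros N HN; specialize (H N HN).
replace (- k * N) with (- (k / 2) * N + - (k / 2) * N) by field; rewrite exp_plus.
pose proof (exp_ineq1_le (k / 2 * N)) as H1.
assert (H2 : exp (- (k / 2) * N) * exp (k / 2 * N) = 1).
  rewrite <- exp_plus, <- exp_0; f_equal; ring.
pose proof (exp_pos (- (k / 2) * N)) as H3.
assert (H4 : k / 2 * N * exp (- (k / 2) * N) <= 1) by nra.
apply Rmult_le_reg_l with (k / 2); [lra|].
apply Rle_trans with (1 * exp (- (k / 2) * N)); [|nra].
rewrite <- !Rmult_assoc; apply Rmult_le_compat_r; lra.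
Qed.

(** The bounds [N * exp (- k * N)] are those of a side of length [N] of a growing square on which
    the integrand decays exponentially. *)
Lemma J_eq_of_vanishing f g K1 K2 k1 k2 : L1 f -> L1 g -> 0 < k1 -> 0 < k2 ->
  (forall N, 0 <= N -> Rabs (Int f 0 N - Int g 0 N)
    <= K1 * (N * exp (- k1 * N)) + K2 * (N * exp (- k2 * N))) ->
  J f = J g.
Proof.
intros Hf Hg Hk1 Hk2 H.
apply (eq_of_close _ _ (2 + Rabs K1 + Rabs K2)); intros e He.
destruct (is_lim_seq_eps _ _ (J_is_lim f Hf) e He) as [n1 H1].
destruct (is_lim_seq_eps _ _ (J_is_lim g Hg) e He) as [n2 H2].
destruct (linear_exp_decay k1 Hk1 e He) as (N1 & HN1 & B1).
destruct (linear_exp_decay k2 Hk2 e He) as (N2 & HN2 & B2).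
destruct (nfloor_ex (N1 + N2)) as [n3 Hn3]; [lra|].
set (n := (n1 + n2 + n3 + 1)%nat).
assert (Hn : N1 + N2 <= INR n).
  unfold n; rewrite !plus_INR; simpl; pose proof (pos_INR n1); pose proof (pos_INR n2); lra.
specialize (H1 n ltac:(unfold n; lia)); specialize (H2 n ltac:(unfold n; lia)).
specialize (B1 (INR n) ltac:(lra)); specialize (B2 (INR n) ltac:(lra)).
specialize (H (INR n) (pos_INR n)).
assert (P1 : 0 <= INR n * exp (- k1 * INR n))
  by (apply Rmult_le_pos; [apply pos_INR|apply Rlt_le, exp_pos]).
assert (P2 : 0 <= INR n * exp (- k2 * INR n))
  by (apply Rmult_le_pos; [apply pos_INR|apply Rlt_le, exp_pos]).
pose proof (Rle_abs K1); pose proof (Rle_abs K2).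
pose proof (Rabs_pos K1); pose proof (Rabs_pos K2).
assert (Hb : Rabs (Int f 0 (INR n) - Int g 0 (INR n)) <= (Rabs K1 + Rabs K2) * e).
  eapply Rle_trans; [exact H|]; nra.
apply Rabs_def2 in H1; apply Rabs_def2 in H2; apply Rabs_le_between in Hb.
apply Rabs_le; nra.
Qed.

(* Real and imaginary parts of [F(x) e^(-i v x)] and of [F(-i y) e^(-v y)]. *)
Definition Ure (F : C -> C) (v x : R) : R :=
  fst (F (x, 0)) * cos (v * x) + snd (F (x, 0)) * sin (v * x).
Definition Uim (F : C -> C) (v x : R) : R :=
  snd (F (x, 0)) * cos (v * x) - fst (F (x, 0)) * sin (v * x).
Definition Vre (F : C -> C) (v y : R) : R := fst (F (0, - y)) * exp (- (v * y)).
Definition Vim (F : C -> C) (v y : R) : R := snd (F (0, - y)) * exp (- (v * y)).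

Definition growth (F : C -> C) (A tau : R) : Prop :=
  forall z, Cmod (F z) <= A * exp (tau * Cmod z).

Lemma entire_line F : entire F ->
  cont (fun x => fst (F (x, 0))) /\ cont (fun x => snd (F (x, 0))) /\
  cont (fun y => fst (F (0, y))) /\ cont (fun y => snd (F (0, y))).
Proof.
intros HF; destruct (entire_cont2 F HF) as [H1 H2]; repeat split.
- apply (cont2_slice_l _ 0 H1).
- apply (cont2_slice_l _ 0 H2).
- apply (cont2_slice_r _ 0 H1).
- apply (cont2_slice_r _ 0 H2).
Qed.

Lemma cont_UV F v : entire F ->
  cont (Ure F v) /\ cont (Uim F v) /\ cont (Vre F v) /\ cont (Vim F v).
Proof.
intros HF; destruct (entire_line F HF) as (C1 & C2 & C3 & C4).
assert (C3' : cont (fun y => fst (F (0, - y)))).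
  apply (cont_comp (fun y => fst (F (0, y))) Ropp); auto; solve_cont.
  apply cont_opp, cont_id.
assert (C4' : cont (fun y => snd (F (0, - y)))).
  apply (cont_comp (fun y => snd (F (0, y))) Ropp); auto.
  apply cont_opp, cont_id.
unfold Ure, Uim, Vre, Vim; repeat split; solve_cont.
Qed.

Lemma V_decay F A tau v y : growth F A tau -> 0 <= y ->
  Rabs (Vre F v y) <= A * exp (- (v - tau) * y) /\ Rabs (Vim F v y) <= A * exp (- (v - tau) * y).
Proof.
intros HG Hy.
assert (Hm : Cmod (F (0, - y)) * exp (- (v * y)) <= A * exp (- (v - tau) * y)).
  replace (- (v - tau) * y) with (tau * y + - (v * y)) by ring.
  rewrite exp_plus, <- Rmult_assoc; apply Rmult_le_compat_r; [apply Rlt_le, exp_pos|].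
  eapply Rle_trans; [apply HG|]; right; do 3 f_equal.
  unfold Cmod; simpl fst; simpl snd.
  replace (0 ^ 2 + (- y) ^ 2) with (y ^ 2) by ring; now apply sqrt_pow2.
unfold Vre, Vim; rewrite !Rabs_mult, (Rabs_pos_eq (exp _)) by apply Rlt_le, exp_pos.
pose proof (exp_pos (- (v * y))).
pose proof (Rabs_fst_le (F (0, - y))); pose proof (Rabs_snd_le (F (0, - y))).
split; (eapply Rle_trans; [|exact Hm]); apply Rmult_le_compat_r; lra.
Qed.

Lemma U_growth F A tau v x : growth F A tau -> 0 <= x ->
  Rabs (Ure F v x) <= 2 * A * exp (tau * x) /\ Rabs (Uim F v x) <= 2 * A * exp (tau * x).
Proof.
intros HG Hx.
assert (Hm : Cmod (F (x, 0)) <= A * exp (tau * x)).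
  eapply Rle_trans; [apply HG|]; right; do 3 f_equal.
  unfold Cmod; simpl fst; simpl snd.
  replace (x ^ 2 + 0 ^ 2) with (x ^ 2) by ring; now apply sqrt_pow2.
pose proof (Rabs_fst_le (F (x, 0))) as B1; pose proof (Rabs_snd_le (F (x, 0))) as B2.
pose proof (Rabs_mult_le_l (fst (F (x, 0))) _ (Rabs_cos_le (v * x))).
pose proof (Rabs_mult_le_l (snd (F (x, 0))) _ (Rabs_cos_le (v * x))).
pose proof (Rabs_mult_le_l (fst (F (x, 0))) _ (Rabs_sin_le (v * x))).
pose proof (Rabs_mult_le_l (snd (F (x, 0))) _ (Rabs_sin_le (v * x))).
unfold Ure, Uim; split; (eapply Rle_trans; [apply Rabs_triang|]); rewrite ?Rabs_Ropp; lra.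
Qed.

Lemma Cmod_le_xy x y : Cmod (x, y) <= Rabs x + Rabs y.
Proof. apply (Cmod_le_sum (x, y)). Qed.

(* Cauchy's theorem on the square [0, N] x [-N, 0] for F(z) exp(-(s + i v) z). *)
Lemma Laplace_quadrant F A tau s v : entire F -> growth F A tau -> 0 <= tau ->
  tau < s -> tau < v ->
  J (fun x => Ure F v x * exp (- (s * x)))
    = J (fun y => Vim F v y * cos (s * y) + Vre F v y * sin (s * y)) /\
  J (fun x => Uim F v x * exp (- (s * x)))
    = J (fun y => (- Vre F v y) * cos (s * y) + Vim F v y * sin (s * y)).
Proof.
intros HF HG Ht Hs Hv.
assert (HA : 0 <= A).
  pose proof (HG 0%C) as H0; rewrite Cmod_0, Rmult_0_r, exp_0 in H0.
  pose proof (Cmod_ge_0 (F 0%C)); lra.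
set (w := ((- s)%R, (- v)%R) : C).
set (H := fun z : C => (F z * Cexp (w * z + 0))%C).
assert (HH : entire H).
  apply entire_mult; auto; apply (entire_comp_affine Cexp); apply entire_Cexp.
assert (Hval : forall x y, H (x, y) =
  (exp (v * y - s * x) * (fst (F (x, y)) * cos (s * y + v * x) + snd (F (x, y)) * sin (s * y + v * x)),
   exp (v * y - s * x) * (snd (F (x, y)) * cos (s * y + v * x) - fst (F (x, y)) * sin (s * y + v * x)))).
  intros x y; unfold H, w, Cexp; apply injective_projections; simpl;
  replace (- s * x - - v * y + 0) with (v * y - s * x) by ring;
  replace (- s * y + - v * x + 0) with (- (s * y + v * x)) by ring;
  rewrite cos_neg, sin_neg; ring.
assert (Hmod : forall x y, Cmod (H (x, y)) <= A * exp (tau * (Rabs x + Rabs y) + (v * y - s * x))).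
  intros x y; unfold H; rewrite Cmod_mult, Cmod_Cexp.
  replace (fst (w * (x, y) + 0)%C) with (v * y - s * x) by (simpl; ring).
  rewrite exp_plus, <- Rmult_assoc; apply Rmult_le_compat_r; [apply Rlt_le, exp_pos|].
  eapply Rle_trans; [apply HG|]; apply Rmult_le_compat_l; auto; apply exp_le.
  apply Rmult_le_compat_l; auto; apply Cmod_le_xy.
destruct (entire_closed H HH) as [Cl1 Cl2]; destruct (entire_cont2 H HH) as [K1 K2].
destruct (cont_UV F v HF) as (CU1 & CU2 & CV1 & CV2).
(* On the two outer sides each strict inequality has its role: on the bottom [v > tau] gives the
   decay in [N] and [s > tau] absorbs [x]; on the right side the roles of [s] and [v] are
   exchanged. *)
assert (Hbot : forall N x, 0 <= N -> 0 <= x <= N ->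
  Cmod (H (x, - N)) <= A * exp (- (v - tau) * N)).
  intros N x HN Hx; eapply Rle_trans; [apply Hmod|]; apply Rmult_le_compat_l; auto.
  apply exp_le; rewrite Rabs_Ropp, !Rabs_pos_eq by lra; nra.
assert (Hrig : forall N y, 0 <= N -> - N <= y <= 0 ->
  Cmod (H (N, y)) <= A * exp (- (s - tau) * N)).
  intros N y HN Hy; eapply Rle_trans; [apply Hmod|]; apply Rmult_le_compat_l; auto.
  apply exp_le; rewrite (Rabs_left1 y), !Rabs_pos_eq by lra; nra.
assert (LU : forall U, cont U -> (forall x, 0 <= x -> Rabs (U x) <= 2 * A * exp (tau * x)) ->
  L1 (fun x => U x * exp (- (s * x)))).
  intros U HU HUb; apply (L1_exp_decay _ (2 * A) (s - tau)); [lra|solve_cont|].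
  intros x Hx; rewrite Rabs_mult, (Rabs_pos_eq (exp _)) by apply Rlt_le, exp_pos.
  replace (- (s - tau) * x) with (tau * x + - (s * x)) by ring.
  rewrite exp_plus, <- Rmult_assoc; apply Rmult_le_compat_r; [apply Rlt_le, exp_pos|auto].
assert (LV1 : L1 (Vre F v)).
  apply (L1_exp_decay _ A (v - tau)); auto; [lra|]; intros; now apply V_decay.
assert (LV2 : L1 (Vim F v)).
  apply (L1_exp_decay _ A (v - tau)); auto; [lra|]; intros; now apply V_decay.
assert (LV1n : L1 (fun y => - Vre F v y)).
  apply (L1_ext (fun y => (-1) * Vre F v y)); [intro; ring|now apply L1_mulc].
assert (Bnd : forall N f, 0 <= N -> cont f ->
  (forall x, 0 <= x <= N -> Rabs (f x) <= A * exp (- (v - tau) * N)) ->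
  Rabs (Int f 0 N) <= A * (N * exp (- (v - tau) * N))).
  intros N f HN Hf Hb; eapply Rle_trans; [apply (Int_abs_bound _ (fun _ => A * exp (- (v - tau) * N)))|];
    auto using cont_const.
  rewrite Int_cst; right; ring.
assert (Bnd' : forall N f, 0 <= N -> cont f ->
  (forall y, - N <= y <= 0 -> Rabs (f y) <= A * exp (- (s - tau) * N)) ->
  Rabs (Int f (- N) 0) <= A * (N * exp (- (s - tau) * N))).
  intros N f HN Hf Hb; eapply Rle_trans; [apply (Int_abs_bound _ (fun _ => A * exp (- (s - tau) * N)))|];
    auto using cont_const; [lra|].
  rewrite Int_cst; right; ring.
split; apply (J_eq_of_vanishing _ _ A A (v - tau) (s - tau)); try lra.
- apply LU; auto; intros; now apply (U_growth F A).
- apply L1_plus; [now apply L1_cos_kernel|now apply L1_sin_kernel].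
- intros N HN.
  pose proof (circ_closed _ _ 0 (- N) N N Cl1 HN HN) as E; unfold circ in E.
  rewrite Rplus_0_l, Rplus_opp_l in E.
  rewrite (Int_neg (fun y => snd (H (N, y)))), (Int_neg (fun y => snd (H (0, y)))) in E
    by (now apply (cont2_slice_r (fun x y => snd (H (x, y))))).
  rewrite (Int_eq_all (fun x => fst (H (x, 0))) (fun x => Ure F v x * exp (- (s * x)))) in E.
  2: { intro x; rewrite Hval; unfold Ure; simpl fst; rewrite !Rmult_0_r, Rplus_0_l.
    unfold Rminus; rewrite Rplus_0_l; ring. }
  assert (E2 : Int (fun y => snd (H (0, y))) (- N) 0
    = Int (fun y => Vim F v y * cos (s * y) + Vre F v y * sin (s * y)) 0 N).
    pose proof (Int_reflect (fun y => snd (H (0, y))) 0 N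
      (cont2_slice_r (fun x y => snd (H (x, y))) 0 K2)) as E3.
    rewrite Ropp_0 in E3; rewrite <- E3; apply Int_eq_all; intro y; rewrite Hval.
    unfold Vim, Vre; simpl snd.
    replace (v * - y - s * 0) with (- (v * y)) by ring.
    replace (s * - y + v * 0) with (- (s * y)) by ring; rewrite cos_neg, sin_neg; ring.
  rewrite E2 in E.
  assert (B1 : Rabs (Int (fun x => fst (H (x, - N))) 0 N) <= A * (N * exp (- (v - tau) * N))).
    apply Bnd; auto; [apply (cont2_slice_l _ (- N) K1)|].
    intros x Hx; eapply Rle_trans; [apply Rabs_fst_le|now apply Hbot].
  assert (B2 : Rabs (Int (fun y => snd (H (N, y))) (- N) 0) <= A * (N * exp (- (s - tau) * N))).
    apply Bnd'; auto; [apply (cont2_slice_r (fun x y => snd (H (x, y))) N K2)|].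
    intros y Hy; eapply Rle_trans; [apply Rabs_snd_le|now apply Hrig].
  apply Rabs_le_between in B1, B2; apply Rabs_le; lra.
- apply LU; auto; intros; now apply (U_growth F A).
- apply L1_plus; [now apply (L1_cos_kernel (fun y => - Vre F v y))|now apply L1_sin_kernel].
- intros N HN.
  pose proof (circ_closed _ _ 0 (- N) N N Cl2 HN HN) as E; unfold circ in E.
  rewrite Rplus_0_l, Rplus_opp_l in E.
  rewrite (Int_eq_all (fun x => snd (H (x, 0))) (fun x => Uim F v x * exp (- (s * x)))) in E.
  2: { intro x; rewrite Hval; unfold Uim; simpl snd; rewrite !Rmult_0_r, Rplus_0_l.
    unfold Rminus; rewrite Rplus_0_l; ring. }
  assert (E2 : Int (fun y => fst (H (0, y))) (- N) 0
    = - Int (fun y => - Vre F v y * cos (s * y) + Vim F v y * sin (s * y)) 0 N).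
    pose proof (Int_reflect (fun y => fst (H (0, y))) 0 N
      (cont2_slice_r (fun x y => fst (H (x, y))) 0 K1)) as E3.
    rewrite Ropp_0 in E3; rewrite <- E3, <- Int_neg by solve_cont.
    apply Int_eq_all; intro y; rewrite Hval.
    unfold Vim, Vre; simpl fst.
    replace (v * - y - s * 0) with (- (v * y)) by ring.
    replace (s * - y + v * 0) with (- (s * y)) by ring; rewrite cos_neg, sin_neg; ring.
  rewrite E2 in E.
  assert (B1 : Rabs (Int (fun x => snd (H (x, - N))) 0 N) <= A * (N * exp (- (v - tau) * N))).
    apply Bnd; auto; [apply (cont2_slice_l _ (- N) K2)|].
    intros x Hx; eapply Rle_trans; [apply Rabs_snd_le|now apply Hbot].
  assert (B2 : Rabs (Int (fun y => fst (H (N, y))) (- N) 0) <= A * (N * exp (- (s - tau) * N))).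
    apply Bnd'; auto; [apply (cont2_slice_r (fun x y => fst (H (x, y))) N K1)|].
    intros y Hy; eapply Rle_trans; [apply Rabs_fst_le|now apply Hrig].
  apply Rabs_le_between in B1, B2; apply Rabs_le; lra.
Qed.

(** At [s = 0] this says that the integral of [F(x) exp(-i v x)] over the positive axis is [-i]
    times that of [F(-i y) exp(-v y)]. The right side decays at rate [v - tau]; half of that rate
    serves as the weight [rho] of the continuation. *)
Lemma Laplace_axis F A tau v : entire F -> growth F A tau -> 0 <= tau -> tau < v ->
  L1 (Ure F v) -> L1 (Uim F v) ->
  (forall s, 0 < s ->
    J (fun x => Ure F v x * exp (- (s * x)))
      = J (fun y => Vim F v y * cos (s * y) + Vre F v y * sin (s * y)) /\
    J (fun x => Uim F v x * exp (- (s * x)))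
      = J (fun y => (- Vre F v y) * cos (s * y) + Vim F v y * sin (s * y))) /\
  J (Ure F v) = J (Vim F v) /\ J (Uim F v) = - J (Vre F v).
Proof.
intros HF HG Ht Hv L1U L2U.
destruct (cont_UV F v HF) as (CU1 & CU2 & CV1 & CV2).
set (rho := (v - tau) / 2).
assert (LW : forall V, cont V -> (forall y, 0 <= y -> Rabs (V y) <= A * exp (- (v - tau) * y)) ->
  L1 (fun y => V y * exp (rho * y))).
  intros V HV Hb; apply (L1_exp_decay _ A rho); [unfold rho; lra|solve_cont|].
  intros y Hy; rewrite Rabs_mult, (Rabs_pos_eq (exp _)) by apply Rlt_le, exp_pos.
  replace (- rho * y) with (- (v - tau) * y + rho * y) by (unfold rho; field).
  rewrite exp_plus, <- Rmult_assoc; apply Rmult_le_compat_r; [apply Rlt_le, exp_pos|auto].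
assert (W1 : L1 (fun y => Vre F v y * exp (rho * y))).
  apply LW; auto; intros; now apply V_decay.
assert (W2 : L1 (fun y => Vim F v y * exp (rho * y))).
  apply LW; auto; intros; now apply V_decay.
assert (W1n : L1 (fun y => - Vre F v y * exp (rho * y))).
  apply LW; [solve_cont|]; intros; rewrite Rabs_Ropp; now apply V_decay.
assert (CV1n : cont (fun y => - Vre F v y)) by solve_cont.
assert (Hrho : 0 < rho) by (unfold rho; lra).
destruct (Laplace_continuation (Ure F v) (Vim F v) (Vre F v) rho tau) as [A1 A2]; auto.
  intros s Hs; now apply (Laplace_quadrant F A tau s v).
destruct (Laplace_continuation (Uim F v) (fun y => - Vre F v y) (Vim F v) rho tau) as [B1 B2]; auto.
  intros s Hs; now apply (Laplace_quadrant F A tau s v).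
repeat split; auto.
rewrite B2, (J_ext _ (fun y => (-1) * Vre F v y)) by (intros; ring).
rewrite J_mulc; [ring|now apply (L1_of_exp_weight rho)].
Qed.

(* [conj (F (- conj z))] *)
Definition Fstar (F : C -> C) (z : C) : C := Cconj (F (- fst z, snd z)%R).

Lemma entire_Fstar F : entire F -> entire (Fstar F).
Proof.
intros HF z; destruct (entire_eps F HF (- fst z, snd z)%R) as [D HD].
exists (- Cconj D)%C; apply is_derive_C_intro; intros e He.
destruct (HD e He) as (d & Hd & H); exists d; split; auto; intros h Hh.
set (w' := ((- fst (z + h)%C)%R, snd (z + h)%C) : C).
assert (Ew : Cmod (w' - ((- fst z)%R, snd z))%C = Cmod h).
  unfold w', Cmod; simpl fst; simpl snd; f_equal; ring.
specialize (H w'); rewrite Ew in H; specialize (H Hh).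
eapply Rle_trans; [|exact H]; right.
rewrite <- (Cmod_conj (_ - _ - _ * D)%C); f_equal.
unfold Fstar; fold w'.
apply injective_projections; simpl; ring.
Qed.

Lemma growth_Fstar F A tau : growth F A tau -> growth (Fstar F) A tau.
Proof.
intros HG z; unfold Fstar; rewrite Cmod_conj; eapply Rle_trans; [apply HG|].
right; do 3 f_equal; unfold Cmod; simpl fst; simpl snd; f_equal; ring.
Qed.

Lemma growth_opp F A tau : growth F A tau -> growth (fun z => F (- z)%C) A tau.
Proof. intros HG z; eapply Rle_trans; [apply HG|]; rewrite Cmod_opp; lra. Qed.
Lemma entire_opp_arg F : entire F -> entire (fun z => F (- z)%C).
Proof.
intros HF; apply (entire_ext (fun z => F (- (1) * z + 0)%C)).
- intro z; f_equal; ring.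
- now apply entire_comp_affine.
Qed.

(** On the positive axis [Fstar F] is the conjugate of [F (- x)], and on the imaginary axis the
    conjugate of [F]. So [Laplace_axis] for [F] and for [Fstar F] rotates both half-lines onto the
    same imaginary half-axis with opposite signs. The two equations are the real and imaginary parts
    of the vanishing Fourier integral at [v]. *)
Lemma spectrum_half F A tau v : entire F -> growth F A tau -> 0 <= tau -> tau < v ->
  L1R (fun x => fst (F (x, 0))) -> L1R (fun x => snd (F (x, 0))) ->
  ch (fun x => fst (F (x, 0))) v + sh (fun x => snd (F (x, 0))) v = 0 /\
  ch (fun x => snd (F (x, 0))) v - sh (fun x => fst (F (x, 0))) v = 0.
Proof.
intros HF HG Ht Hv H1 H2.
set (f1 := fun x => fst (F (x, 0))) in *; set (f2 := fun x => snd (F (x, 0))) in *.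
pose proof (L1R_L1 _ H1) as P1; pose proof (L1R_L1 _ H2) as P2.
pose proof (L1R_L1 _ (L1R_opp _ H1)) as N1; pose proof (L1R_L1 _ (L1R_opp _ H2)) as N2.
assert (LU1 : L1 (Ure F v)).
  apply L1_plus; [now apply (L1_cos_kernel f1)|now apply (L1_sin_kernel f2)].
assert (LU2 : L1 (Uim F v)).
  apply L1_minus; [now apply (L1_cos_kernel f2)|now apply (L1_sin_kernel f1)].
assert (E1 : forall x, Ure (Fstar F) v x = f1 (- x) * cos (v * x) - f2 (- x) * sin (v * x)).
  intro x; unfold Ure, Fstar, f1, f2; simpl; ring.
assert (E2 : forall x, Uim (Fstar F) v x = - (f2 (- x) * cos (v * x) + f1 (- x) * sin (v * x))).
  intro x; unfold Uim, Fstar, f1, f2; simpl; ring.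
assert (LS1 : L1 (Ure (Fstar F) v)).
  apply (L1_ext _ _ (fun x => eq_sym (E1 x))).
  apply L1_minus; [now apply (L1_cos_kernel (fun x => f1 (- x)))
    |now apply (L1_sin_kernel (fun x => f2 (- x)))].
assert (LS2 : L1 (Uim (Fstar F) v)).
  apply (L1_ext (fun x => (-1) * (f2 (- x) * cos (v * x) + f1 (- x) * sin (v * x)))).
    intro x; rewrite E2; ring.
  apply L1_mulc, L1_plus; [now apply (L1_cos_kernel (fun x => f2 (- x)))
    |now apply (L1_sin_kernel (fun x => f1 (- x)))].
destruct (Laplace_axis F A tau v) as (_ & A1 & A2); auto.
destruct (Laplace_axis (Fstar F) A tau v) as (_ & B1 & B2);
  auto using entire_Fstar, growth_Fstar.
assert (V1 : J (Vre (Fstar F) v) = J (Vre F v)).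
  apply J_ext; intros y _; unfold Vre, Fstar; simpl; now rewrite Ropp_0.
assert (V2 : J (Vim (Fstar F) v) = - J (Vim F v)).
  rewrite <- (Rmult_1_l (J (Vim F v))), Ropp_mult_distr_l, <- J_mulc.
  - apply J_ext; intros y _; unfold Vim, Fstar; simpl; rewrite Ropp_0; ring.
  - destruct (cont_UV F v HF) as (_ & _ & _ & CV).
    apply (L1_exp_decay _ A (v - tau)); auto; [lra|]; intros; now apply V_decay.
unfold ch, sh; split.
- rewrite <- J_plus.
  + transitivity (J (fun x => Ure F v x + Ure (Fstar F) v x)).
      apply J_ext; intros x _; rewrite E1; unfold Ure, f1, f2; ring.
    rewrite J_plus by auto; lra.
  + apply (L1_cos_kernel (fun x => f1 x + f1 (- x))); now apply L1R_even.
  + apply (L1_sin_kernel (fun x => f2 x - f2 (- x))); now apply L1R_odd.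
- rewrite <- J_minus.
  + transitivity (J (fun x => Uim F v x - Uim (Fstar F) v x)).
      apply J_ext; intros x _; rewrite E2; unfold Uim, f1, f2; ring.
    rewrite J_minus by auto; lra.
  + apply (L1_cos_kernel (fun x => f2 x + f2 (- x))); now apply L1R_even.
  + apply (L1_sin_kernel (fun x => f1 x - f1 (- x))); now apply L1R_odd.
Qed.

Lemma ch_opp_arg h w : ch (fun x => h (- x)) w = ch h w.
Proof. apply J_ext; intros x _; rewrite Ropp_involutive; ring. Qed.
Lemma sh_opp_arg h w : L1R h -> sh (fun x => h (- x)) w = - sh h w.
Proof.
intros Hh; unfold sh; rewrite (J_ext _ (fun x => (-1) * ((h x - h (- x)) * sin (w * x)))).
- rewrite J_mulc by (apply (L1_sin_kernel (fun x => h x - h (- x))); now apply L1R_odd); ring.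
- intros x _; rewrite Ropp_involutive; ring.
Qed.

(** The reflection of [F] supplies the frequency [- v]: it reverses the sign of both [sh] terms, and
    sums and differences isolate the four coefficients. *)
Lemma spectrum F A tau v : entire F -> growth F A tau -> 0 <= tau -> tau < v ->
  L1R (fun x => fst (F (x, 0))) -> L1R (fun x => snd (F (x, 0))) ->
  (ch (fun x => fst (F (x, 0))) v = 0 /\ sh (fun x => fst (F (x, 0))) v = 0) /\
  (ch (fun x => snd (F (x, 0))) v = 0 /\ sh (fun x => snd (F (x, 0))) v = 0).
Proof.
intros HF HG Ht Hv H1 H2.
destruct (spectrum_half F A tau v) as [A1 A2]; auto.
assert (Eo : forall x, F (- (x, 0))%C = F (- x, 0)%R).
  intro x; f_equal; apply injective_projections; simpl; ring.
assert (Ef : forall x, fst (F (- (x, 0))%C) = fst (F (- x, 0)%R)) by (intro; now rewrite Eo).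
assert (Es : forall x, snd (F (- (x, 0))%C) = snd (F (- x, 0)%R)) by (intro; now rewrite Eo).
assert (H1o := L1R_opp _ H1); assert (H2o := L1R_opp _ H2); cbv beta in H1o, H2o.
assert (Hext : forall h k, (forall x, h x = k x) -> L1R k -> L1R h).
  intros h k E [Hk [M HM]]; split; [apply (cont_ext k); auto|].
  exists M; intros p q Hpq; rewrite (Int_eq_all _ (fun x => Rabs (k x))); auto.
  intro; now rewrite E.
destruct (spectrum_half (fun z => F (- z)%C) A tau v) as [B1 B2];
  auto using entire_opp_arg, growth_opp.
- now apply (Hext _ (fun x => fst (F (- x, 0)%R))).
- now apply (Hext _ (fun x => snd (F (- x, 0)%R))).
- assert (C1 : ch (fun x => fst (F (- (x, 0))%C)) v = ch (fun x => fst (F (x, 0))) v).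
    rewrite <- (ch_opp_arg (fun x => fst (F (x, 0)))).
    apply J_ext; intros x _; now rewrite !Ef.
  assert (C2 : ch (fun x => snd (F (- (x, 0))%C)) v = ch (fun x => snd (F (x, 0))) v).
    rewrite <- (ch_opp_arg (fun x => snd (F (x, 0)))).
    apply J_ext; intros x _; now rewrite !Es.
  assert (S1 : sh (fun x => fst (F (- (x, 0))%C)) v = - sh (fun x => fst (F (x, 0))) v).
    rewrite <- (sh_opp_arg (fun x => fst (F (x, 0)))) by auto.
    apply J_ext; intros x _; now rewrite !Ef.
  assert (S2 : sh (fun x => snd (F (- (x, 0))%C)) v = - sh (fun x => snd (F (x, 0))) v).
    rewrite <- (sh_opp_arg (fun x => snd (F (x, 0)))) by auto.
    apply J_ext; intros x _; now rewrite !Es.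
  rewrite C1, S2 in B1; rewrite C2, S1 in B2; lra.
Qed.

(** * Entire functions of exponential type that vanish on the real line *)

(** The condition [V 0 = 0] makes the extension of [V] by zero continuous, so injectivity on the
    whole line applies; [Rmax x 0] encodes this extension. *)
Lemma L1_zero_transform V : L1 V -> V 0 = 0 ->
  (forall s, 0 < s -> J (fun y => V y * cos (s * y)) = 0 /\ J (fun y => V y * sin (s * y)) = 0) ->
  forall y, 0 <= y -> V y = 0.
Proof.
intros HV H0 Hz y Hy; assert (Hc := L1_cont V HV); destruct (proj2 HV) as [M HM].
set (h := fun x => V (Rmax x 0)).
assert (Hh : cont h) by (unfold h; solve_cont).
assert (Hp : forall x, 0 <= x -> h x = V x) by (intros x Hx; unfold h; rewrite Rmax_left; auto).
assert (Hn : forall x, 0 <= x -> h (- x) = 0).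
  intros x Hx; unfold h; rewrite Rmax_right; auto; lra.
assert (HL : L1R h).
  apply (L1R_sym_bound h M); auto; intros N HN; rewrite Int_sym by solve_cont.
  rewrite (Int_eq _ (fun x => Rabs (V x))); auto.
  intros x Hx; rewrite Hp, Hn, Rabs_R0 by lra; ring.
rewrite <- Hp by auto; apply Fourier_injective; auto.
intros w Hw; destruct (Hz w Hw) as [A1 A2]; unfold ch, sh; split.
- rewrite <- A1; apply J_ext; intros x Hx; rewrite Hp, Hn by auto; ring.
- rewrite <- A2; apply J_ext; intros x Hx; rewrite Hp, Hn by auto; ring.
Qed.

(** This takes the place of the identity theorem and will show that a nonzero [F] has positive norm.
    The left sides in [Laplace_axis] vanish for [F] and for [Fstar F]; combining the four relations,
    the cosine and sine transforms of [Vre] and [Vim] vanish separately. *)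
Lemma entire_zero_lower_axis F A tau : entire F -> growth F A tau -> 0 <= tau ->
  (forall x, F (x, 0) = 0%C) -> forall y, 0 <= y -> F (0, - y)%R = 0%C.
Proof.
intros HF HG Ht Hz y Hy; set (v := tau + 1); assert (Hv : tau < v) by (unfold v; lra).
assert (Z1 : forall G : C -> C, (forall x, G (x, 0) = 0%C) ->
  (forall x, Ure G v x = 0) /\ (forall x, Uim G v x = 0)).
  intros G HGz; split; intro x; unfold Ure, Uim; rewrite HGz; simpl; ring.
assert (HzS : forall x, Fstar F (x, 0) = 0%C).
  intro x; unfold Fstar; simpl fst; simpl snd; rewrite Hz.
  apply injective_projections; simpl; ring.
assert (LZ : forall U, (forall x, U x = 0) -> L1 U).
  intros U HU; apply (L1_ext (fun _ => 0)); [intro; now rewrite HU|].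
  split; [apply cont_const|]; exists 0; intros N HN.
  rewrite (Int_eq_all _ (fun _ => 0)) by (intro; apply Rabs_R0); rewrite Int_cst; lra.
assert (JZ : forall U s, (forall x, U x = 0) -> J (fun x => U x * exp (- (s * x))) = 0).
  intros U s HU; apply J_0; intros x _; rewrite HU; ring.
destruct (Z1 F Hz) as [U1 U2]; destruct (Z1 _ HzS) as [S1 S2].
destruct (Laplace_axis F A tau v) as (A1 & _); auto.
destruct (Laplace_axis (Fstar F) A tau v) as (B1 & _); auto using entire_Fstar, growth_Fstar.
destruct (cont_UV F v HF) as (_ & _ & CV1 & CV2).
assert (LV1 : L1 (Vre F v)).
  apply (L1_exp_decay _ A (v - tau)); auto; [lra|]; intros; now apply V_decay.
assert (LV2 : L1 (Vim F v)).
  apply (L1_exp_decay _ A (v - tau)); auto; [lra|]; intros; now apply V_decay.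
assert (E1 : forall t, Vre (Fstar F) v t = Vre F v t).
  intro t; unfold Vre, Fstar; simpl; now rewrite Ropp_0.
assert (E2 : forall t, Vim (Fstar F) v t = - Vim F v t).
  intro t; unfold Vim, Fstar; simpl; rewrite Ropp_0; ring.
assert (HJ : forall s, 0 < s ->
  (J (fun y => Vre F v y * cos (s * y)) = 0 /\ J (fun y => Vre F v y * sin (s * y)) = 0) /\
  (J (fun y => Vim F v y * cos (s * y)) = 0 /\ J (fun y => Vim F v y * sin (s * y)) = 0)).
  intros s Hs; destruct (A1 s Hs) as [X1 X2]; destruct (B1 s Hs) as [Y1 Y2].
  rewrite JZ in X1, X2, Y1, Y2 by auto.
  pose proof (L1_cos_kernel _ s LV1) as c1; pose proof (L1_sin_kernel _ s LV1) as s1.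
  pose proof (L1_cos_kernel _ s LV2) as c2; pose proof (L1_sin_kernel _ s LV2) as s2.
  rewrite (J_plus _ _ c2 s1) in X1.
  rewrite (J_ext _ (fun y => Vim F v y * sin (s * y) - Vre F v y * cos (s * y))) in X2
    by (intros; ring).
  rewrite (J_minus _ _ s2 c1) in X2.
  rewrite (J_ext _ (fun y => Vre F v y * sin (s * y) - Vim F v y * cos (s * y))) in Y1
    by (intros; rewrite E1, E2; ring).
  rewrite (J_minus _ _ s1 c2) in Y1.
  rewrite (J_ext _ (fun y => (-1) * (Vim F v y * sin (s * y) + Vre F v y * cos (s * y)))) in Y2
    by (intros; rewrite E1, E2; ring).
  rewrite J_mulc in Y2 by now apply L1_plus.
  rewrite (J_plus _ _ s2 c1) in Y2.
  lra.
assert (V1 : Vre F v y = 0).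
  apply L1_zero_transform; auto; [unfold Vre; rewrite Ropp_0, Hz; simpl; ring|].
  intros s Hs; exact (proj1 (HJ s Hs)).
assert (V2 : Vim F v y = 0).
  apply L1_zero_transform; auto; [unfold Vim; rewrite Ropp_0, Hz; simpl; ring|].
  intros s Hs; exact (proj2 (HJ s Hs)).
unfold Vre, Vim in V1, V2; pose proof (exp_pos (- (v * y))).
apply Rmult_integral in V1, V2; apply injective_projections; simpl; lra.
Qed.

Lemma entire_zero_lower F A tau : entire F -> growth F A tau -> 0 <= tau ->
  (forall x, F (x, 0) = 0%C) -> forall x y, 0 <= y -> F (x, - y)%R = 0%C.
Proof.
intros HF HG Ht Hz x y Hy.
assert (HA : 0 <= A).
  pose proof (HG 0%C) as H0; rewrite Cmod_0, Rmult_0_r, exp_0 in H0.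
  pose proof (Cmod_ge_0 (F 0%C)); lra.
assert (E : forall u t, (1 * (u, t) + (x, 0))%C = (u + x, t)%R).
  intros; apply injective_projections; simpl; ring.
replace (x, - y)%R with (1 * (0, (- y)%R) + (x, 0%R))%C by
  (rewrite E; apply injective_projections; simpl; ring).
apply (entire_zero_lower_axis (fun z => F (1 * z + (x, 0%R))%C) (A * exp (tau * Rabs x)) tau); auto.
- now apply (entire_comp_affine F).
- intro z; eapply Rle_trans; [apply HG|].
  rewrite Rmult_assoc, <- exp_plus; apply Rmult_le_compat_l; auto; apply exp_le.
  rewrite <- Rmult_plus_distr_l; apply Rmult_le_compat_l; auto.
  eapply Rle_trans; [apply Cmod_triangle|]; rewrite Cmult_1_l.
  pose proof (Cmod_le_xy x 0); rewrite Rabs_R0 in H; lra.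
- intro u; rewrite E; apply Hz.
Qed.

Lemma entire_zero F A tau : entire F -> growth F A tau -> 0 <= tau ->
  (forall x, F (x, 0) = 0%C) -> forall z, F z = 0%C.
Proof.
intros HF HG Ht Hz [x y]; destruct (Rle_dec 0 y) as [Hy|Hy].
- replace (x, y) with (- ((- x)%R, (- y)%R))%C by (apply injective_projections; simpl; ring).
  apply (entire_zero_lower (fun z => F (- z)%C) A tau); auto using entire_opp_arg, growth_opp.
  intro u; replace (- (u, 0%R))%C with ((- u)%R, 0%R); [apply Hz|].
  apply injective_projections; simpl; ring.
- rewrite <- (Ropp_involutive y); apply (entire_zero_lower F A tau); auto; lra.
Qed.

(** * Fourier synthesis *)

Definition wave (t : R) (z : C) : C := Cexp ((0%R, (2 * PI * t)%R) * z)%C.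

Definition synth (f : R -> R) (b : R) (z : C) : C :=
  (Int (fun t => f t * fst (wave t z)) (- b) b, Int (fun t => f t * snd (wave t z)) (- b) b).

Lemma cont_wave z : cont (fun t => fst (wave t z)) /\ cont (fun t => snd (wave t z)).
Proof. unfold wave, Cexp; simpl; split; solve_cont. Qed.

Lemma Cmod_freq t : Cmod (0%R, (2 * PI * t)%R) = 2 * PI * Rabs t.
Proof.
unfold Cmod; simpl fst; simpl snd; pose proof PI_RGT_0.
replace (0 ^ 2 + (2 * PI * t) ^ 2) with ((2 * PI * Rabs t) ^ 2).
- apply sqrt_pow2; pose proof (Rabs_pos t); nra.
- rewrite Rpow_mult_distr, pow2_abs; ring.
Qed.

Lemma Cmod_wave b t z : - b <= t <= b -> Cmod (wave t z) <= exp (2 * PI * b * Cmod z).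
Proof.
intros Ht; unfold wave; rewrite Cmod_Cexp; apply exp_le.
eapply Rle_trans; [apply Rle_abs|]; eapply Rle_trans; [apply Rabs_fst_le|].
rewrite Cmod_mult, Cmod_freq; apply Rmult_le_compat_r; [apply Cmod_ge_0|].
assert (Rabs t <= b) by (apply Rabs_le; lra); pose proof PI_RGT_0; nra.
Qed.

Lemma Int_mult_bound f k K a b : a <= b -> cont f -> cont k ->
  (forall t, a <= t <= b -> Rabs (k t) <= K) ->
  Rabs (Int (fun t => f t * k t) a b) <= K * Int (fun t => Rabs (f t)) a b.
Proof.
intros Hab Hf Hk H; rewrite <- Int_mulc by solve_cont.
apply Int_abs_bound; auto; [solve_cont..|].
intros t Ht; rewrite Rabs_mult, Rmult_comm; apply Rmult_le_compat_r; auto; apply Rabs_pos.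
Qed.

Lemma synth_growth f b : cont f -> 0 <= b ->
  growth (synth f b) (2 * Int (fun t => Rabs (f t)) (- b) b) (2 * PI * b).
Proof.
intros Hf Hb z; destruct (cont_wave z) as [C1 C2].
eapply Rle_trans; [apply Cmod_le_sum|]; unfold synth; cbn [fst snd].
assert (B1 := Int_mult_bound f (fun t => fst (wave t z)) (exp (2 * PI * b * Cmod z)) (- b) b
  ltac:(lra) Hf C1 (fun t Ht => Rle_trans _ _ _ (Rabs_fst_le _) (Cmod_wave b t z Ht))).
assert (B2 := Int_mult_bound f (fun t => snd (wave t z)) (exp (2 * PI * b * Cmod z)) (- b) b
  ltac:(lra) Hf C2 (fun t Ht => Rle_trans _ _ _ (Rabs_snd_le _) (Cmod_wave b t z Ht))).
cbv beta in B1, B2; lra.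
Qed.

Lemma entire_synth f b : cont f -> 0 <= b -> entire (synth f b).
Proof.
intros Hf Hb z; pose proof PI_RGT_0 as HPI.
set (k := fun t => (0%R, (2 * PI * t)%R) : C).
set (D := (Int (fun t => f t * fst (k t * wave t z)%C) (- b) b,
           Int (fun t => f t * snd (k t * wave t z)%C) (- b) b) : C).
set (B := exp (2 * PI * b * Cmod z) * (12 * (2 * PI * b) ^ 2)).
set (I := Int (fun t => Rabs (f t)) (- b) b).
assert (HI : 0 <= I) by (apply Int_pos; [lra|solve_cont|intros; apply Rabs_pos]).
(* This radius keeps [2 * PI * |t| * |h|] below 1/2 for all [|t| <= b], the range of
   [Cexp_quadratic]. *)
assert (Hd : 0 < / (2 * (2 * PI * b + 1))) by (apply Rinv_0_lt_compat; nra).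
exists D; apply (is_derive_quadratic (synth f b) z D (/ (2 * (2 * PI * b + 1))) (2 * B * I)); auto.
intros h Hh.
set (r := fun t => (wave t z * (Cexp (k t * h) - 1 - k t * h))%C).
assert (Cr1 : cont (fun t => fst (r t))) by (unfold r, wave, Cexp, k; simpl; solve_cont).
assert (Cr2 : cont (fun t => snd (r t))) by (unfold r, wave, Cexp, k; simpl; solve_cont).
destruct (cont_wave z) as [C1 C2]; destruct (cont_wave (z + h)%C) as [C3 C4].
assert (Ck1 : cont (fun t => fst (k t * wave t z)%C)) by (unfold wave, Cexp, k; simpl; solve_cont).
assert (Ck2 : cont (fun t => snd (k t * wave t z)%C)) by (unfold wave, Cexp, k; simpl; solve_cont).
assert (Hr : forall t, r t = (wave t (z + h) - wave t z - h * (k t * wave t z))%C).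
  intro t; unfold r, wave; fold (k t); rewrite Cmult_plus_distr_l, Cexp_plus; ring.
assert (E : (synth f b (z + h) - synth f b z - h * D)%C
  = (Int (fun t => f t * fst (r t)) (- b) b, Int (fun t => f t * snd (r t)) (- b) b)).
  apply injective_projections.
  - transitivity (Int (fun t => f t * fst (wave t (z + h)%C)) (- b) b
      - Int (fun t => f t * fst (wave t z)) (- b) b
      - (fst h * Int (fun t => f t * fst (k t * wave t z)%C) (- b) b
         - snd h * Int (fun t => f t * snd (k t * wave t z)%C) (- b) b)).
      unfold synth, D; simpl; ring.
    rewrite <- !Int_mulc, <- !Int_sub by solve_cont.
    apply Int_eq_all; intro t; rewrite Hr; generalize (wave t (z + h)%C) (wave t z) (k t).
    intros; simpl; ring.
  - transitivity (Int (fun t => f t * snd (wave t (z + h)%C)) (- b) b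
      - Int (fun t => f t * snd (wave t z)) (- b) b
      - (fst h * Int (fun t => f t * snd (k t * wave t z)%C) (- b) b
         + snd h * Int (fun t => f t * fst (k t * wave t z)%C) (- b) b)).
      unfold synth, D; simpl; ring.
    rewrite <- !Int_mulc, <- Int_add, <- !Int_sub by solve_cont.
    apply Int_eq_all; intro t; rewrite Hr; generalize (wave t (z + h)%C) (wave t z) (k t).
    intros; simpl; ring.
rewrite E; eapply Rle_trans; [apply Cmod_le_sum|]; cbn [fst snd].
assert (Hb1 : forall t, - b <= t <= b -> Cmod (r t) <= B * Cmod h ^ 2).
  intros t Ht; assert (Hta : Rabs t <= b) by (apply Rabs_le; lra).
  pose proof (Cmod_ge_0 h) as Hh0; pose proof (Rabs_pos t).
  assert (Hk : Cmod (k t * h)%C <= 2 * PI * b * Cmod h).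
    rewrite Cmod_mult; unfold k; rewrite Cmod_freq; apply Rmult_le_compat_r; nra.
  assert (Hk2 : Cmod (k t * h)%C <= / 2).
    eapply Rle_trans; [exact Hk|].
    assert ((2 * PI * b + 1) * Cmod h <= / 2); [|nra].
    apply Rle_trans with ((2 * PI * b + 1) * / (2 * (2 * PI * b + 1))).
      apply Rmult_le_compat_l; nra.
    right; field; nra.
  unfold r; rewrite Cmod_mult; unfold B; rewrite Rmult_assoc.
  apply Rmult_le_compat; try apply Cmod_ge_0; [now apply Cmod_wave|].
  eapply Rle_trans; [now apply Cexp_quadratic|].
  rewrite Rmult_assoc; apply Rmult_le_compat_l; [lra|].
  rewrite <- Rpow_mult_distr; apply pow_incr; split; auto; apply Cmod_ge_0.
assert (B1 := Int_mult_bound f (fun t => fst (r t)) (B * Cmod h ^ 2) (- b) b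
  ltac:(lra) Hf Cr1 (fun t Ht => Rle_trans _ _ _ (Rabs_fst_le _) (Hb1 t Ht))).
assert (B2 := Int_mult_bound f (fun t => snd (r t)) (B * Cmod h ^ 2) (- b) b
  ltac:(lra) Hf Cr2 (fun t Ht => Rle_trans _ _ _ (Rabs_snd_le _) (Hb1 t Ht))).
cbv beta in B1, B2; fold I in B1, B2; lra.
Qed.

Lemma synth_real f b x : synth f b (x, 0) = (ct f b (2 * PI * x), st f b (2 * PI * x)).
Proof.
unfold synth, wave, Cexp, ct, st; apply injective_projections; simpl;
  apply Int_eq_all; intro t; rewrite !Rmult_0_l, !Rmult_0_r, Rplus_0_l, Rminus_0_r, exp_0;
  rewrite Rmult_1_l; do 2 f_equal; ring.
Qed.

Lemma Cmod_synth_sqr f b x : Cmod (synth f b (x, 0)) ^ 2 = power f b (2 * PI * x).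
Proof. rewrite Cmod_sqr, synth_real; reflexivity. Qed.

(** * Approximation inside the Paley-Wiener space *)

Lemma lim_sym_nonneg_bound h l : cont h -> (forall x, 0 <= h x) -> lim_sym h l ->
  forall p q, p <= q -> Int h p q <= l.
Proof.
intros Hc H0 Hl p q Hpq; apply Rnot_lt_le; intro Habs.
destruct (Hl ((Int h p q - l) / 2)) as (N0 & HN0 & B); [lra|].
set (N := Rmax N0 (Rmax (Rabs p) (Rabs q))).
specialize (B N (Rmax_l _ _)).
pose proof (Rmax_r N0 (Rmax (Rabs p) (Rabs q))); fold N in H.
pose proof (Rmax_l (Rabs p) (Rabs q)); pose proof (Rmax_r (Rabs p) (Rabs q)).
pose proof (Rle_abs (- p)); rewrite Rabs_Ropp in H3; pose proof (Rle_abs q).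
assert (Int h p q <= Int h (- N) N) by (apply Int_widen; auto; lra).
apply Rabs_le_between in B; lra.
Qed.

Lemma lim_sym_of_RInt_gen h l : cont h ->
  is_RInt_gen h (Rbar_locally m_infty) (Rbar_locally p_infty) l -> lim_sym h l.
Proof.
intros Hc H e He.
destruct (H (fun y => Rabs (y - l) < e)) as [Q T [MQ HQ] [MT HT] HP].
  exists (mkposreal e He); intros y Hy; exact Hy.
exists (Rmax 0 (Rmax (1 - MQ) (1 + MT))); split; [apply Rmax_l|].
intros N HN.
pose proof (Rmax_r 0 (Rmax (1 - MQ) (1 + MT))).
pose proof (Rmax_l (1 - MQ) (1 + MT)); pose proof (Rmax_r (1 - MQ) (1 + MT)).
destruct (HP (- N) N) as (y & Hy & Hyl).
- apply HQ; lra.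
- apply HT; lra.
- simpl in Hy; replace (Int h (- N) N) with y; [lra|].
  symmetry; apply (is_RInt_unique h (- N) N y Hy).
Qed.

(** The two ends of [RInt_gen] move independently; for a nonnegative integrand every large window is
    squeezed between a symmetric integral and the limit. *)
Lemma RInt_gen_of_lim_sym h l : cont h -> (forall x, 0 <= h x) -> lim_sym h l ->
  is_RInt_gen h (Rbar_locally m_infty) (Rbar_locally p_infty) l.
Proof.
intros Hc H0 Hl P [[e He] HP].
destruct (Hl (e / 2)) as (N0 & HN0 & B); [lra|].
exists (fun x => x < - N0) (fun x => N0 < x).
- exists (- N0); auto.
- exists N0; auto.
- intros a b Ha Hb; exists (Int h a b); split.
    simpl; apply (RInt_correct h); now apply ex_RInt_of_cont.
  apply HP; change (Rabs (Int h a b - l) < e).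
  pose proof (lim_sym_nonneg_bound h l Hc H0 Hl a b ltac:(lra)).
  specialize (B N0 (Rle_refl _)).
  assert (Int h (- N0) N0 <= Int h a b) by (apply Int_widen; auto; lra).
  apply Rabs_le_between in B; apply Rabs_def1; lra.
Qed.

Definition dens (F : C -> C) (x : R) : R := Cmod (F (x, 0)) ^ 2.

Lemma cont_dens F : entire F -> cont (dens F).
Proof.
intros HF; destruct (entire_line F HF) as (C1 & C2 & _).
apply (cont_ext (fun x => fst (F (x, 0)) ^ 2 + snd (F (x, 0)) ^ 2)).
  intro; unfold dens; now rewrite Cmod_sqr.
solve_cont.
Qed.
Lemma dens_nonneg F x : 0 <= dens F x.
Proof. apply pow2_ge_0. Qed.

(** A continuous probability density on [[-1, 1]]. Its unit mass makes the multiplier below equal to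
    1 at the origin; its nonnegativity keeps the multiplier at most 1 in modulus on the line. *)
Definition tent (t : R) : R := Rmax 0 (1 - Rabs t).

Lemma cont_tent : cont tent.
Proof. unfold tent; solve_cont. Qed.
Lemma tent_supported : supported tent 1.
Proof. intros x Hx; unfold tent; rewrite Rmax_left; lra. Qed.
Lemma tent_nonneg t : 0 <= tent t.
Proof. apply Rmax_l. Qed.
Lemma Int_tent : Int tent (-1) 1 = 1.
Proof.
rewrite (Int_sym tent 1 cont_tent : Int tent (-1) 1 = _).
rewrite (Int_eq _ (fun x => 2 - 2 * x)); [|lra|].
- rewrite (Int_primitive (fun x => 2 * x - x ^ 2)).
  + ring.
  + intro x; auto_derive; auto; ring.
  + solve_cont.
- intros x Hx; unfold tent; rewrite Rabs_Ropp, Rabs_pos_eq, Rmax_right; lra.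
Qed.
Lemma power_tent_0 : power tent 1 0 = 1.
Proof.
unfold power, ct, st.
rewrite (Int_eq_all _ tent), (Int_eq_all (fun t => tent t * sin (0 * t)) (fun _ => 0)).
- rewrite Int_cst; change (- (1)) with (-1); rewrite Int_tent; ring.
- intro; rewrite Rmult_0_l, sin_0; ring.
- intro; rewrite Rmult_0_l, cos_0; ring.
Qed.
(* Cauchy-Schwarz against the probability density [tent]. *)
Lemma power_tent_le w : power tent 1 w <= 1.
Proof.
pose proof cont_tent as Ht; unfold power.
set (c := ct tent 1 w); set (s := st tent 1 w).
assert (H : 0 <= Int (fun t => tent t * ((cos (w * t) - c) ^ 2 + (sin (w * t) - s) ^ 2)) (- (1)) 1).
  apply Int_pos; [lra|solve_cont|]; intros t _; apply Rmult_le_pos; [apply tent_nonneg|].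
  pose proof (pow2_ge_0 (cos (w * t) - c)); pose proof (pow2_ge_0 (sin (w * t) - s)); lra.
rewrite (Int_eq_all _ (fun t => (1 + c ^ 2 + s ^ 2) * tent t
  - (2 * c * (tent t * cos (w * t)) + 2 * s * (tent t * sin (w * t))))) in H.
- rewrite Int_sub, Int_add, !Int_mulc in H by solve_cont.
  change (Int (fun t => tent t * cos (w * t)) (- (1)) 1) with c in H.
  change (Int (fun t => tent t * sin (w * t)) (- (1)) 1) with s in H.
  change (- (1)) with (-1) in H; rewrite Int_tent in H; lra.
- intro t; pose proof (sin2_cos2 (w * t)) as E; unfold Rsqr in E.
  replace ((cos (w * t) - c) ^ 2 + (sin (w * t) - s) ^ 2) with
    ((sin (w * t) * sin (w * t) + cos (w * t) * cos (w * t)) + c ^ 2 + s ^ 2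
     - 2 * (c * cos (w * t) + s * sin (w * t))) by ring.
  rewrite E; ring.
Qed.

Lemma Int_dilate p lam a b : cont p -> 0 < lam ->
  Int (fun x => p (lam * x)) a b = / lam * Int p (lam * a) (lam * b).
Proof.
intros Hp Hl; pose proof (Int_lin p lam 0 a b Hp) as E; rewrite !Rplus_0_r in E.
rewrite <- E, <- Rmult_assoc, Rinv_l, Rmult_1_l by lra.
apply Int_eq_all; intro; now rewrite Rplus_0_r.
Qed.

Section Approximation.
Variables (F : C -> C) (Delta I : R).
Hypothesis HD : 0 < Delta.
Hypothesis HF : entire F.
Hypothesis HT : exp_type_le (PI * Delta) F.
Hypothesis HI : lim_sym (dens F) I.

Let ep (lam : R) : R := (1 - lam) * Delta / 4.

(** Dilation by [lam < 1] frees [(1 - lam) * PI * Delta] of exponential type. Half of it is spent on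
    the multiplier, which makes the product integrable, and half on the arbitrary [eps] of
    [exp_type_le], so the type is at most [PI * Delta] with a fixed constant. *)
Definition approx (lam : R) (z : C) : C := (F (RtoC lam * z + 0) * synth tent 1 (RtoC (ep lam) * z + 0))%C.

Lemma entire_approx lam : entire (approx lam).
Proof.
apply entire_mult.
- now apply (entire_comp_affine F).
- apply (entire_comp_affine (synth tent 1)), entire_synth; [apply cont_tent|lra].
Qed.

Lemma growth_approx lam : / 2 < lam < 1 -> exists A, growth (approx lam) A (PI * Delta).
Proof.
intros Hl; pose proof PI_RGT_0 as HPI; pose proof cont_tent as Ht.
assert (HPD : 0 < PI * Delta) by (apply Rmult_lt_0_compat; lra).
assert (Hde : 0 < PI * Delta * (1 - lam) / 2) by (apply Rdiv_lt_0_compat; [apply Rmult_lt_0_compat|]; lra).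
destruct (HT (PI * Delta * (1 - lam) / 2) Hde) as [A HA].
set (A' := 2 * Int (fun t => Rabs (tent t)) (- (1)) 1).
assert (HA0 : 0 <= A).
  pose proof (HA 0%C) as H0; rewrite Cmod_0, Rmult_0_r, exp_0 in H0.
  pose proof (Cmod_ge_0 (F 0%C)); lra.
assert (HA'0 : 0 <= A').
  assert (0 <= Int (fun t => Rabs (tent t)) (- (1)) 1); [|unfold A'; lra].
  apply Int_pos; [lra|solve_cont|intros; apply Rabs_pos].
exists (A * A'); intro z; unfold approx; rewrite Cmod_mult.
pose proof (Cmod_ge_0 z) as Hz.
assert (Hep : 0 <= ep lam) by (unfold ep, Rdiv; apply Rmult_le_pos; [apply Rmult_le_pos|]; lra).
assert (M1 : Cmod (RtoC lam * z + 0)%C = lam * Cmod z).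
  rewrite Cplus_0_r, Cmod_mult, Cmod_R, Rabs_pos_eq by lra; ring.
assert (M2 : Cmod (RtoC (ep lam) * z + 0)%C = ep lam * Cmod z).
  rewrite Cplus_0_r, Cmod_mult, Cmod_R, Rabs_pos_eq by lra; ring.
assert (B1 := HA (RtoC lam * z + 0)%C); rewrite M1 in B1.
assert (B2 := synth_growth tent 1 Ht ltac:(lra) (RtoC (ep lam) * z + 0)%C).
rewrite M2 in B2; fold A' in B2.
eapply Rle_trans; [apply Rmult_le_compat; [apply Cmod_ge_0|apply Cmod_ge_0|exact B1|exact B2]|].
match goal with |- A * ?x * (A' * ?y) <= _ =>
  replace (A * x * (A' * y)) with (A * A' * (x * y)) by ring end.
rewrite <- exp_plus; apply Rmult_le_compat_l; [nra|]; apply exp_le.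
unfold ep; rewrite <- !Rmult_assoc, <- Rmult_plus_distr_r; apply Rmult_le_compat_r; auto.
assert (0 < PI * Delta * (1 - lam) * (1 - lam)) by (apply Rmult_lt_0_compat; [apply Rmult_lt_0_compat|]; lra).
nra.
Qed.

Lemma dens_approx lam x :
  dens (approx lam) x = dens F (lam * x) * power tent 1 (2 * PI * (ep lam * x)).
Proof.
unfold dens, approx; rewrite Cmod_mult, Rpow_mult_distr.
replace (RtoC lam * (x, 0) + 0)%C with ((lam * x)%R, 0%R)
  by (apply injective_projections; simpl; ring).
replace (RtoC (ep lam) * (x, 0) + 0)%C with ((ep lam * x)%R, 0%R)
  by (apply injective_projections; simpl; ring).
now rewrite Cmod_synth_sqr.
Qed.

(** Both factors are square-integrable on the line, and the modulus of the product is at most half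
    the sum of their squares. *)
Lemma L1R_approx lam : / 2 < lam < 1 ->
  L1R (fun x => fst (approx lam (x, 0))) /\ L1R (fun x => snd (approx lam (x, 0))).
Proof.
intros Hl; pose proof PI_RGT_0 as HPI.
assert (Hep : 0 < ep lam) by (unfold ep; apply Rdiv_lt_0_compat; [apply Rmult_lt_0_compat|]; lra).
destruct (entire_line _ (entire_approx lam)) as (C1 & C2 & _).
pose proof (cont_dens F HF) as Cd; pose proof cont_tent as Ht.
pose proof (cont_power tent 1 Ht) as Cp.
assert (Cp2 : cont (fun x => power tent 1 (2 * PI * x))) by solve_cont.
pose proof (Plancherel tent 1 Ht tent_supported ltac:(lra)) as HP.
set (E := Int (fun t => tent t ^ 2) (- (1)) 1) in HP.
set (M := (/ lam * I + / ep lam * E) / 2).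
assert (Hbound : forall N, 0 <= N ->
  Int (fun x => (dens F (lam * x) + power tent 1 (2 * PI * (ep lam * x))) / 2) (- N) N <= M).
  intros N HN.
  rewrite (Int_eq_all _ (fun x => / 2 * (dens F (lam * x)
    + (fun y => power tent 1 (2 * PI * y)) (ep lam * x)))) by (intro; field).
  rewrite Int_mulc, Int_add by solve_cont.
  rewrite (Int_dilate (dens F)), (Int_dilate (fun y => power tent 1 (2 * PI * y))) by (auto; lra).
  pose proof (lim_sym_nonneg_bound _ _ Cd (dens_nonneg F) HI (lam * - N) (lam * N) ltac:(nra)) as B1.
  pose proof (lim_sym_nonneg_bound _ _ Cp2 (fun x => power_nonneg _ _ _) HP
    (ep lam * - N) (ep lam * N) ltac:(nra)) as B2.
  assert (0 < / lam) by (apply Rinv_0_lt_compat; lra).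
  assert (0 < / ep lam) by (apply Rinv_0_lt_compat; lra).
  unfold M; nra.
assert (Hmod : forall x, Cmod (approx lam (x, 0))
  <= (dens F (lam * x) + power tent 1 (2 * PI * (ep lam * x))) / 2).
  intro x; pose proof (dens_approx lam x) as Ed; unfold dens at 1 in Ed.
  pose proof (dens_nonneg F (lam * x)); pose proof (power_nonneg tent 1 (2 * PI * (ep lam * x))).
  set (u := dens F (lam * x)) in *; set (w := power tent 1 (2 * PI * (ep lam * x))) in *.
  apply Rsqr_incr_0_var; [|lra]; unfold Rsqr.
  replace (Cmod (approx lam (x, 0)) * Cmod (approx lam (x, 0))) with (u * w) by (rewrite <- Ed; ring).
  pose proof (pow2_ge_0 (u - w)); nra.
split; apply (L1R_sym_bound _ M); auto; intros N HN;
  (eapply Rle_trans; [|apply (Hbound N HN)]); apply Int_mono; try lra; try solve_cont.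
- intros x _; eapply Rle_trans; [apply Rabs_fst_le|apply Hmod].
- intros x _; eapply Rle_trans; [apply Rabs_snd_le|apply Hmod].
Qed.

Variables (al be : R).
Hypothesis Hform : forall f, cont f -> supported f (Delta / 2) ->
  0 <= al * Int (fun t => f t ^ 2) (- (Delta / 2)) (Delta / 2)
     + be * Int (fun t => f t * mean f t) (- (Delta / 2)) (Delta / 2).

Let wt (x : R) : R := al + be * sinc (2 * PI * x).

Lemma cont_wt : cont wt.
Proof. pose proof cont_sinc; unfold wt; solve_cont. Qed.
Lemma Rabs_wt_le x : Rabs (wt x) <= Rabs al + Rabs be.
Proof.
unfold wt; eapply Rle_trans; [apply Rabs_triang|].
pose proof (Rabs_mult_le_l be _ (Rabs_sinc_le (2 * PI * x))); lra.
Qed.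

(** The real and imaginary parts of [approx lam] are integrable with spectrum in the band; each has
    two densities, and the limit is the sum of the form over these four. *)
Lemma approx_form lam : / 2 < lam < 1 ->
  exists L, 0 <= L /\ lim_sym (fun x => dens (approx lam) x * wt x) L.
Proof.
intros Hl; pose proof PI_RGT_0 as HPI; pose proof cont_sinc as Csi.
destruct (L1R_approx lam Hl) as [L1 L2]; destruct (growth_approx lam Hl) as [A HA].
assert (HPD : 0 <= PI * Delta) by nra.
assert (Hsp := fun v Hv => spectrum (approx lam) A (PI * Delta) v (entire_approx lam) HA HPD Hv L1 L2).
destruct (entire_line _ (entire_approx lam)) as (C1 & C2 & _).
destruct (Plancherel_band_limited _ (Delta / 2) L1) as (f1 & f2 & K1 & K2 & S1 & S2 & P1 & Q1).
- lra.
- intros w Hw; apply (Hsp w); lra.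
destruct (Plancherel_band_limited _ (Delta / 2) L2) as (f3 & f4 & K3 & K4 & S3 & S4 & P2 & Q2).
- lra.
- intros w Hw; apply (Hsp w); lra.
pose proof (Hform f1 K1 S1); pose proof (Hform f2 K2 S2).
pose proof (Hform f3 K3 S3); pose proof (Hform f4 K4 S4).
assert (D1 : cont (fun x => fst (approx lam (x, 0)) ^ 2)) by solve_cont.
assert (D2 : cont (fun x => snd (approx lam (x, 0)) ^ 2)) by solve_cont.
assert (D3 : cont (fun x => fst (approx lam (x, 0)) ^ 2 * sinc (2 * PI * x))) by solve_cont.
assert (D4 : cont (fun x => snd (approx lam (x, 0)) ^ 2 * sinc (2 * PI * x))) by solve_cont.
pose proof (lim_sym_plus _ _ _ _ D1 D2 P1 P2) as P.
pose proof (lim_sym_plus _ _ _ _ D3 D4 Q1 Q2) as Q.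
pose proof (cont_plus _ _ D1 D2) as D5; pose proof (cont_plus _ _ D3 D4) as D6.
pose proof (lim_sym_plus _ _ _ _ (cont_mult _ _ (cont_const al) D5) (cont_mult _ _ (cont_const be) D6)
  (lim_sym_mulc al _ _ D5 P) (lim_sym_mulc be _ _ D6 Q)) as R.
eexists; split; [|eapply lim_sym_ext; [|exact R]].
- lra.
- intro x; unfold dens, wt; rewrite Cmod_sqr; ring.
Qed.

(** The limit [lam -> 1] is taken on a fixed window, where [Phi] is continuous in [lam] and at 1
    gives the integral for [F] itself. The tails are bounded uniformly in [lam] by those of
    [dens F], as the multiplier is at most 1 and [wt] is bounded. *)
Lemma form_nonneg L : lim_sym (fun x => dens F x * wt x) L -> 0 <= L.
Proof.
intros HL; pose proof (cont_dens F HF) as Cd; pose proof cont_wt as Cw.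
pose proof cont_tent as Ht; pose proof (cont_power tent 1 Ht) as Cp.
pose proof PI_RGT_0 as HPI.
set (ka := Rabs al + Rabs be).
assert (Hka : 0 <= ka) by (unfold ka; pose proof (Rabs_pos al); pose proof (Rabs_pos be); lra).
assert (Hmain : forall e, 0 < e -> - (2 + 2 * ka) * e <= L).
2: { apply Rnot_lt_le; intro Hneg.
  specialize (Hmain (- L / (2 * (2 + 2 * ka))) ltac:(apply Rdiv_lt_0_compat; lra)).
  replace (- (2 + 2 * ka) * (- L / (2 * (2 + 2 * ka)))) with (L / 2) in Hmain by (field; lra).
  lra. }
intros e He.
destruct (HI e He) as (N1 & HN1 & B1); specialize (B1 N1 (Rle_refl _)).
destruct (HL e He) as (N2 & HN2 & B2).
(* The factor 2 guarantees [lam * N >= N1] for all [lam > / 2], so the dilated tails lie outside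
   [[- N1, N1]]. *)
set (N := Rmax (2 * N1) N2).
assert (HNN1 : 2 * N1 <= N) by apply Rmax_l; specialize (B2 N (Rmax_r _ _)).
set (Phi := fun lam => Int (fun x => dens F (lam * x)
  * power tent 1 (2 * PI * ((1 - lam) * Delta / 4 * x)) * wt x) (- N) N).
assert (HPhi : cont Phi).
  apply (cont_Int_param (fun lam x => dens F (lam * x)
    * power tent 1 (2 * PI * ((1 - lam) * Delta / 4 * x)) * wt x)).
  solve_cont2.
assert (HPhi1 : Phi 1 = Int (fun x => dens F x * wt x) (- N) N).
  apply Int_eq_all; intro x; rewrite Rmult_1_l.
  replace (2 * PI * ((1 - 1) * Delta / 4 * x)) with 0 by field; rewrite power_tent_0; ring.
assert (HPhib : forall lam, / 2 < lam < 1 -> - (1 + 2 * ka) * e <= Phi lam).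
  intros lam Hl; destruct (approx_form lam Hl) as (La & HLa & Hlim).
  destruct (Hlim e He) as (N3 & HN3 & B3).
  set (N' := Rmax N N3); specialize (B3 N' (Rmax_r _ _)).
  assert (HNN' : N <= N') by apply Rmax_l.
  set (g := fun x => dens (approx lam) x * wt x) in *.
  assert (Cda := cont_dens _ (entire_approx lam)).
  assert (Hg : cont g) by (unfold g; solve_cont).
  assert (Cdl : cont (fun x => dens F (lam * x))) by solve_cont.
  assert (Hgb : forall x, Rabs (g x) <= ka * dens F (lam * x)).
    intro x; unfold g; rewrite Rabs_mult, (Rabs_pos_eq (dens _ x)), Rmult_comm by apply dens_nonneg.
    apply Rmult_le_compat; [apply Rabs_pos|apply dens_nonneg|apply Rabs_wt_le|].
    rewrite dens_approx; pose proof (dens_nonneg F (lam * x)).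
    pose proof (power_tent_le (2 * PI * (ep lam * x))); nra.
  assert (Hgt : forall p q, p <= q -> Rabs (Int g p q) <= ka * (/ lam * Int (dens F) (lam * p) (lam * q))).
    intros p q Hpq; rewrite <- Int_dilate, <- Int_mulc by (auto; lra).
    apply Int_abs_bound; auto; solve_cont.
  assert (EPhi : Phi lam = Int g (- N) N).
    apply Int_eq_all; intro x; unfold g; now rewrite dens_approx.
  rewrite <- (Int_concat g (- N') (- N) N'), <- (Int_concat g (- N) N N'), <- EPhi in B3 by auto.
  pose proof (Hgt (- N') (- N) ltac:(lra)) as T1; pose proof (Hgt N N' HNN') as T2.
  assert (Htail : Int (dens F) (lam * - N') (lam * - N) + Int (dens F) (lam * N) (lam * N') <= e).
    pose proof (lim_sym_nonneg_bound _ _ Cd (dens_nonneg F) HI (lam * - N') (lam * N') ltac:(nra)) as B4.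
    rewrite <- (Int_concat _ (lam * - N') (lam * - N) (lam * N')) in B4 by auto.
    rewrite <- (Int_concat _ (lam * - N) (lam * N) (lam * N')) in B4 by auto.
    assert (Int (dens F) (- N1) N1 <= Int (dens F) (lam * - N) (lam * N)).
      apply Int_widen; auto; try apply dens_nonneg; nra.
    apply Rabs_le_between in B1; lra.
  assert (Hil : / lam <= 2).
    replace 2 with (/ / 2) by (field); apply Rinv_le_contravar; lra.
  assert (0 < / lam) by (apply Rinv_0_lt_compat; lra).
  assert (0 <= Int (dens F) (lam * - N') (lam * - N)).
    apply Int_pos; auto; [nra|intros; apply dens_nonneg].
  assert (0 <= Int (dens F) (lam * N) (lam * N')).
    apply Int_pos; auto; [nra|intros; apply dens_nonneg].
  assert (Rabs (Int g (- N') (- N)) + Rabs (Int g N N') <= ka * (2 * e)).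
    eapply Rle_trans; [apply Rplus_le_compat; [exact T1|exact T2]|].
    rewrite <- Rmult_plus_distr_l; apply Rmult_le_compat_l; auto.
    rewrite <- Rmult_plus_distr_l; apply Rmult_le_compat; lra.
  pose proof (Rle_abs (Int g (- N') (- N))); pose proof (Rle_abs (Int g N N')).
  apply Rabs_le_between in B3; lra.
assert (HPhi1b : - (1 + 2 * ka) * e <= Phi 1).
  apply Rnot_lt_le; intro Hlt.
  destruct (proj1 (cont_eps Phi 1) (HPhi 1) (- (1 + 2 * ka) * e - Phi 1)) as (d & Hd & Hdd); [lra|].
  set (lam := 1 - Rmin (d / 2) (/ 4)).
  assert (Hm : 0 < Rmin (d / 2) (/ 4)) by (apply Rmin_glb_lt; lra).
  pose proof (Rmin_l (d / 2) (/ 4)); pose proof (Rmin_r (d / 2) (/ 4)).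
  specialize (HPhib lam ltac:(unfold lam; lra)).
  specialize (Hdd lam ltac:(unfold lam; apply Rabs_def1; lra)).
  apply Rabs_def2 in Hdd; lra.
rewrite HPhi1 in HPhi1b; apply Rabs_le_between in B2; lra.
Qed.
End Approximation.

(** * The truncated averaging operator *)

(** The compression of [mean] to [[- a, a]]. Clipping the limits, rather than extending [f] by zero,
    admits continuous [f] that do not vanish at the ends, as is the case for eigenfunctions. *)
Definition avg (a : R) (f : R -> R) (s : R) : R :=
  / 2 * Int f (Rmax (- a) (s - 1)) (Rmin a (s + 1)).
Definition nrm (a : R) (f : R -> R) : R := Int (fun t => f t ^ 2) (- a) a.
Definition qform (a : R) (f : R -> R) : R := Int (fun t => f t * avg a f t) (- a) a.

Lemma cont_avg a f : cont f -> cont (avg a f).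
Proof.
intros Hf; pose proof (cont_primitive f 0 Hf) as HP.
apply (cont_ext (fun s => / 2 * (Int f 0 (Rmin a (s + 1)) - Int f 0 (Rmax (- a) (s - 1))))).
  intro s; unfold avg; f_equal.
  rewrite <- (Int_concat f 0 (Rmax (- a) (s - 1)) (Rmin a (s + 1))) by auto; ring.
solve_cont.
Qed.

Lemma avg_lin a f g u v s : cont f -> cont g ->
  avg a (fun t => u * f t + v * g t) s = u * avg a f s + v * avg a g s.
Proof. intros; unfold avg; rewrite Int_add, !Int_mulc by solve_cont; ring. Qed.

Lemma mean_avg a f s : 0 < a <= 1 -> cont f -> supported f a -> - a <= s <= a ->
  mean f s = avg a f s.
Proof.
intros Ha Hf Hsf Hs; unfold mean, avg; f_equal.
assert (H1 : Int f (s - 1) (Rmax (- a) (s - 1)) = 0).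
  rewrite (Int_eq_open f (fun _ => 0)); [rewrite Int_cst; ring|apply Rmax_r|].
  intros x Hx; apply Hsf.
  unfold Rmax in Hx; destruct (Rle_dec _ _) in Hx; [lra|].
  rewrite Rabs_left1; lra.
assert (H2 : Int f (Rmin a (s + 1)) (s + 1) = 0).
  rewrite (Int_eq_open f (fun _ => 0)); [rewrite Int_cst; ring|apply Rmin_r|].
  intros x Hx; apply Hsf.
  unfold Rmin in Hx; destruct (Rle_dec _ _) in Hx; [|lra].
  rewrite Rabs_pos_eq; lra.
rewrite <- (Int_concat f (s - 1) (Rmax (- a) (s - 1)) (s + 1)) by auto.
rewrite <- (Int_concat f (Rmax (- a) (s - 1)) (Rmin a (s + 1)) (s + 1)) by auto; lra.
Qed.

Lemma avg_abs_le a f s : 0 < a <= 1 -> cont f -> - a <= s <= a ->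
  Rabs (avg a f s) <= / 2 * Int (fun t => Rabs (f t)) (- a) a.
Proof.
intros Ha Hf Hs; unfold avg; rewrite Rabs_mult, (Rabs_pos_eq (/ 2)) by lra.
apply Rmult_le_compat_l; [lra|].
assert (Hle : Rmax (- a) (s - 1) <= Rmin a (s + 1)).
  unfold Rmax, Rmin; destruct (Rle_dec _ _), (Rle_dec _ _); lra.
eapply Rle_trans; [apply (Int_abs_bound f (fun t => Rabs (f t))); auto; [solve_cont|intros; lra]|].
apply Int_widen; auto; [solve_cont|intro; apply Rabs_pos|apply Rmax_l|apply Rmin_l].
Qed.

Lemma nrm_nonneg a f : 0 < a -> cont f -> 0 <= nrm a f.
Proof. intros; apply Int_pos; [lra|solve_cont|intros; apply pow2_ge_0]. Qed.

Lemma Int_abs_sqr_le a f : 0 < a -> cont f ->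
  Int (fun t => Rabs (f t)) (- a) a ^ 2 <= 2 * a * nrm a f.
Proof.
intros Ha Hf.
pose proof (Int_Cauchy_Schwarz (fun _ => 1) (fun t => Rabs (f t)) (- a) a) as H.
rewrite (Int_eq_all (fun t => 1 * Rabs (f t)) (fun t => Rabs (f t))) in H by (intro; ring).
rewrite (Int_eq_all (fun t => Rabs (f t) ^ 2) (fun t => f t ^ 2)) in H by (intro; apply pow2_abs).
rewrite Int_cst in H; unfold nrm.
replace (2 * a) with ((a - - a) * 1 ^ 2) by ring; apply H; [lra|apply cont_const|solve_cont].
Qed.

(** Half the squared [L1] norm bounds the form, and Cauchy-Schwarz brings in the length [2 * a]. For
    [a <= / 2] constants attain the bound, which is the source of [Delta / 2] in the first case. *)
Lemma qform_bound a f : 0 < a <= 1 -> cont f -> Rabs (qform a f) <= a * nrm a f.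
Proof.
intros Ha Hf; pose proof (cont_avg a f Hf) as HT.
set (G := Int (fun t => Rabs (f t)) (- a) a).
apply Rle_trans with (/ 2 * G * G).
- unfold qform; unfold G at 2; rewrite <- Int_mulc by solve_cont.
  apply Int_abs_bound; [lra|solve_cont..|].
  intros t Ht; rewrite Rabs_mult, Rmult_comm; apply Rmult_le_compat_r; [apply Rabs_pos|].
  now apply avg_abs_le.
- pose proof (Int_abs_sqr_le a f ltac:(lra) Hf); fold G in H; nra.
Qed.

Lemma nrm_pos a f s : 0 < a -> cont f -> - a <= s <= a -> f s <> 0 -> 0 < nrm a f.
Proof.
intros Ha Hf Hs Hfs.
assert (Hp : 0 < Rabs (f s) / 2) by (pose proof (Rabs_pos_lt _ Hfs); lra).
destruct (proj1 (cont_eps f s) (Hf s) _ Hp) as (d & Hd & H).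
assert (Hlow : forall t, Rabs (t - s) < d -> (Rabs (f s) / 2) ^ 2 <= f t ^ 2).
  intros t Ht; specialize (H t Ht); rewrite <- (pow2_abs (f t)); apply pow_incr; split; [lra|].
  pose proof (Rabs_triang_inv (f s) (f s - f t)) as H1.
  replace (f s - (f s - f t)) with (f t) in H1 by ring; rewrite (Rabs_minus_sym (f s)) in H1; lra.
assert (Hsub : exists p q, - a <= p /\ p < q /\ q <= a /\ forall t, p <= t <= q -> Rabs (t - s) < d).
  destruct (Rlt_dec s a) as [Hsa|Hsa].
  - exists s, (Rmin a (s + d / 2)).
    assert (s < Rmin a (s + d / 2)) by (apply Rmin_glb_lt; lra).
    pose proof (Rmin_l a (s + d / 2)); pose proof (Rmin_r a (s + d / 2)).
    repeat split; try lra; intros t Ht; apply Rabs_def1; lra.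
  - exists (Rmax (- a) (s - d / 2)), s.
    assert (Rmax (- a) (s - d / 2) < s) by (apply Rmax_lub_lt; lra).
    pose proof (Rmax_l (- a) (s - d / 2)); pose proof (Rmax_r (- a) (s - d / 2)).
    repeat split; try lra; intros t Ht; apply Rabs_def1; lra.
destruct Hsub as (p & q & H1 & H2 & H3 & H4).
apply Rlt_le_trans with (Int (fun t => f t ^ 2) p q).
- apply Rlt_le_trans with (Int (fun _ => (Rabs (f s) / 2) ^ 2) p q).
  + rewrite Int_cst; apply Rmult_lt_0_compat; [lra|now apply pow_lt].
  + apply Int_mono; [lra|solve_cont..|]; intros; now apply Hlow, H4.
- apply Int_widen; auto; [solve_cont|intro; apply pow2_ge_0|lra].
Qed.

Lemma is_derive_R_ext (f g : R -> R) (x l : R) : (forall t : R, f t = g t) ->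
  is_derive f x l -> is_derive g x l.
Proof. intros E; exact (is_derive_ext f g x l E). Qed.

Lemma is_derive_mul_cos_sin (Y Z : R -> R) dY dZ w y : is_derive Y y dY -> is_derive Z y dZ ->
  is_derive (fun x => Y x * cos (w * x) + Z x * sin (w * x)) y
    ((dY + w * Z y) * cos (w * y) + (dZ - w * Y y) * sin (w * y)).
Proof.
intros HY HZ.
assert (Hc : is_derive (fun x => cos (w * x)) y (- w * sin (w * y))) by (auto_derive; auto; ring).
assert (Hs : is_derive (fun x => sin (w * x)) y (w * cos (w * y))) by (auto_derive; auto; ring).
pose proof (is_derive_mult Y _ y _ _ HY Hc Rmult_comm) as H1.
pose proof (is_derive_mult Z _ y _ _ HZ Hs Rmult_comm) as H2.
pose proof (is_derive_plus _ _ y _ _ H1 H2) as H.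
match type of H with is_derive _ _ ?v => replace (_ + _) with v end; [exact H|].
unfold plus, mult; simpl; ring.
Qed.

(** * The eigenvalue problem when the window does not cover the whole interval *)

Section Overlap.
Variable a : R.
Hypothesis Ha : / 2 < a <= 1.

(** [l] is the length of each outer part [[- a, a - 1]] and [[1 - a, a]], and [d] that of the middle
    part, where the window contains all of [[- a, a]]. *)
Let l := 2 * a - 1.
Let d := 2 - 2 * a.

Lemma avg_left f x : cont f -> 0 <= x <= l -> avg a f (- a + x) = / 2 * Int f (- a) (1 - a + x).
Proof.
intros Hf Hx; unfold avg, l in *; f_equal; f_equal.
- apply Rmax_left; lra.
- rewrite Rmin_right; lra.
Qed.
Lemma avg_mid f s : cont f -> a - 1 <= s <= 1 - a -> avg a f s = / 2 * Int f (- a) a.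
Proof.
intros Hf Hx; unfold avg; f_equal; f_equal; [apply Rmax_left|apply Rmin_left]; lra.
Qed.
Lemma avg_right f x : cont f -> 0 <= x <= l -> avg a f (1 - a + x) = / 2 * Int f (- a + x) a.
Proof.
intros Hf Hx; unfold avg, l in *; f_equal; f_equal.
- rewrite Rmax_right; lra.
- apply Rmin_left; lra.
Qed.

Lemma Int_three h : cont h -> Int h (- a) a
  = Int (fun x => h (- a + x)) 0 l + Int h (a - 1) (1 - a) + Int (fun x => h (1 - a + x)) 0 l.
Proof.
intros Hh; rewrite <- (Int_concat h (- a) (a - 1) a), <- (Int_concat h (a - 1) (1 - a) a) by auto.
rewrite (Int_eq_all (fun x => h (- a + x)) (fun x => h (x + - a))) by (intro; f_equal; ring).
rewrite (Int_eq_all (fun x => h (1 - a + x)) (fun x => h (x + (1 - a)))) by (intro; f_equal; ring).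
rewrite !Int_shift by auto; unfold l.
replace (0 + - a) with (- a) by ring; replace (2 * a - 1 + - a) with (a - 1) by ring.
replace (0 + (1 - a)) with (1 - a) by ring; replace (2 * a - 1 + (1 - a)) with a by ring; ring.
Qed.

Lemma cont_shift_primitive f u v : cont f -> cont (fun x => Int f u (v + x)).
Proof.
intros Hf; apply (cont_comp (fun y => Int f u y) (fun x => v + x)).
- now apply cont_primitive.
- solve_cont.
Qed.
Lemma is_derive_shift_primitive f u v x : cont f ->
  is_derive (fun x => Int f u (v + x)) x (f (v + x)).
Proof.
intros Hf; pose proof (is_derive_comp (fun y => Int f u y) (fun x => v + x) x (f (v + x)) 1) as H.
replace (f (v + x)) with (scal 1 (f (v + x))) by (unfold scal; simpl; unfold mult; simpl; ring).
apply H; [now apply is_derive_primitive|auto_derive; auto; ring].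
Qed.

(** The right side is symmetric in [f] and [g], so the symmetry of the operator can be read off. *)
Lemma avg_form f g : cont f -> cont g ->
  2 * Int (fun t => f t * avg a g t) (- a) a = Int f (- a) a * Int g (- a) a
    - Int (fun x => g (1 - a + x) * Int f (- a) (- a + x)) 0 l
    - Int (fun x => f (1 - a + x) * Int g (- a) (- a + x)) 0 l.
Proof.
intros Hf Hg; pose proof (cont_avg a g Hg) as HT.
set (X := fun h x => Int h (- a) (- a + x)).
set (Y := fun h x => Int h (- a) (1 - a + x)).
assert (CX : forall h, cont h -> cont (X h)) by (intros; now apply cont_shift_primitive).
assert (CY : forall h, cont h -> cont (Y h)) by (intros; now apply cont_shift_primitive).
assert (CXf := CX f Hf); assert (CXg := CX g Hg); assert (CYg := CY g Hg).
set (If := Int f (- a) a); set (Ig := Int g (- a) a).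
assert (Hl0 : 0 <= l) by (unfold l; lra).
assert (EL : Int (fun x => f (- a + x) * avg a g (- a + x)) 0 l
  = / 2 * (Ig * Int (fun x => f (- a + x)) 0 l - Int (fun x => g (1 - a + x) * X f x) 0 l)).
  rewrite (Int_eq _ (fun x => / 2 * (Ig * f (- a + x) - f (- a + x) * (Ig - Y g x)))); auto.
  2: { intros x Hx; rewrite avg_left by auto; unfold Y; ring. }
  rewrite Int_mulc, Int_sub, Int_mulc by solve_cont; do 2 f_equal.
  (* Integration by parts; the boundary terms vanish because [X f 0 = 0] and [Y g l] is the full
     integral [Ig]. *)
  assert (E : Int (fun x => f (- a + x) * (Ig - Y g x) - g (1 - a + x) * X f x) 0 l = 0).
    rewrite (Int_primitive (fun x => X f x * (Ig - Y g x))).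
    - unfold X, Y; rewrite Rplus_0_r, Int_same.
      replace (1 - a + l) with a by (unfold l; ring); fold Ig; ring.
    - intro x.
      replace (f (- a + x) * (Ig - Y g x) - g (1 - a + x) * X f x)
        with (plus (mult (f (- a + x)) (Ig - Y g x)) (mult (X f x) (- g (1 - a + x))))
        by (unfold plus, mult; simpl; ring).
      apply (is_derive_mult (X f) (fun x => Ig - Y g x)).
      + now apply is_derive_shift_primitive.
      + replace (- g (1 - a + x)) with (0 - g (1 - a + x)) by ring.
        apply (is_derive_minus (fun _ => Ig) (Y g)).
        * apply (is_derive_const Ig).
        * now apply is_derive_shift_primitive.
      + intros; apply Rmult_comm.
    - solve_cont.
  rewrite Int_sub in E by solve_cont; lra.
assert (ER : Int (fun x => f (1 - a + x) * avg a g (1 - a + x)) 0 l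
  = / 2 * (Ig * Int (fun x => f (1 - a + x)) 0 l - Int (fun x => f (1 - a + x) * X g x) 0 l)).
  rewrite <- Int_mulc, <- Int_sub, <- Int_mulc by solve_cont.
  apply Int_eq; auto; intros x Hx; rewrite avg_right by auto.
  unfold X.
  replace Ig with (Int g (- a) (- a + x) + Int g (- a + x) a) by (apply Int_concat; auto); ring.
assert (EM : Int (fun t => f t * avg a g t) (a - 1) (1 - a)
  = / 2 * (Ig * Int f (a - 1) (1 - a))).
  rewrite <- !Int_mulc by solve_cont.
  apply Int_eq; [lra|]; intros x Hx; rewrite avg_mid by auto; fold Ig; ring.
rewrite (Int_three (fun t => f t * avg a g t)) by solve_cont.
rewrite EL, ER, EM.
replace If with (Int (fun x => f (- a + x)) 0 l + Int f (a - 1) (1 - a)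
  + Int (fun x => f (1 - a + x)) 0 l) by (symmetry; now apply Int_three).
unfold X; field.
Qed.

Lemma avg_sym f g : cont f -> cont g ->
  Int (fun t => f t * avg a g t) (- a) a = Int (fun t => g t * avg a f t) (- a) a.
Proof.
intros Hf Hg; pose proof (avg_form f g Hf Hg); pose proof (avg_form g f Hg Hf); lra.
Qed.
(* In the variables [Y], [Z] below the eigenvalue equation for [avg] becomes the rotation
   system [Y' = w Z], [Z' = - w Y] with forcing [g]; the boundary conditions form a linear
   system for [Y 0] and [I] whose determinant is the one of [eta_eq]. *)
Lemma avg_apriori eta : eta <> 0 ->
  2 - 2 * sin (/ (2 * eta) * l) - cos (/ (2 * eta) * l) * (1 + d * / (2 * eta)) <> 0 ->
  exists K, 0 < K /\ forall f, cont f -> nrm a f <= K * nrm a (fun s => eta * f s - avg a f s).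
Proof.
intros He HD; set (w := / (2 * eta)) in *; set (th := w * l) in *.
set (ka := Rabs (/ eta)).
(* [D] is the determinant of the system for [c = Y 0] and [I] whose residuals are [r1] and [r2]
   below; the identity [sin ^ 2 + cos ^ 2 = 1] turns it into the expression of the hypothesis. *)
set (S := 1 - sin th); set (Ee := 1 - cos th + d * w); set (D := S ^ 2 - cos th * Ee).
assert (HDe : D = 2 - 2 * sin th - cos th * (1 + d * w)).
  unfold D, S, Ee; pose proof (sin2_cos2 th) as E; unfold Rsqr in E; nra.
rewrite <- HDe in HD.
assert (HDp : 0 < Rabs D) by now apply Rabs_pos_lt.
assert (Hka : 0 < ka) by (apply Rabs_pos_lt, Rinv_neq_0_compat, He).
set (K1 := 3 * ka * (Rabs Ee + 3) / Rabs D).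
assert (HK1 : 0 <= K1).
  unfold K1; apply Rdiv_le_0_compat; auto; pose proof (Rabs_pos Ee); nra.
set (K2 := K1 + ka).
exists (2 * ka ^ 2 * (1 + 4 * a ^ 2 * K2 ^ 2)); split.
  assert (0 < ka ^ 2) by now apply pow_lt.
  pose proof (pow2_ge_0 K2); pose proof (pow2_ge_0 a); nra.
intros f Hf; pose proof (cont_avg a f Hf) as HT.
set (g := fun s => eta * f s - avg a f s).
assert (Hg : cont g) by (unfold g; solve_cont).
set (G := Int (fun t => Rabs (g t)) (- a) a).
assert (HG : 0 <= G) by (apply Int_pos; [lra|solve_cont|intros; apply Rabs_pos]).
set (I := Int f (- a) a).
(* [Y x] and [Z x] are twice the values of [avg a f] at [- a + x] and [1 - a + x]. The derivative of
   [Y] is [f] on the right part and that of [Z] is [- f] on the left part, which couples the two. *)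
set (X := fun x => Int f (- a) (- a + x)); set (Y := fun x => Int f (- a) (1 - a + x)).
set (Z := fun x => I - X x).
assert (CX : cont X) by now apply cont_shift_primitive.
assert (CY : cont Y) by now apply cont_shift_primitive.
assert (CZ : cont Z) by (unfold Z; solve_cont).
assert (DX : forall x, is_derive X x (f (- a + x))) by (intro; now apply is_derive_shift_primitive).
assert (DY : forall x, is_derive Y x (f (1 - a + x))) by (intro; now apply is_derive_shift_primitive).
assert (DZ : forall x, is_derive Z x (- f (- a + x))).
  intro x; replace (- f (- a + x)) with (0 - f (- a + x)) by ring.
  apply (is_derive_minus (fun _ => I) X); [apply (is_derive_const I)|apply DX].
assert (DZn : forall x, is_derive (fun x => - Z x) x (f (- a + x))).
  intro x; rewrite <- (Ropp_involutive (f (- a + x))); apply (is_derive_opp Z), DZ.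
assert (Hl0 : 0 <= l) by (unfold l; lra).
assert (Hd0 : 0 <= d) by (unfold d; lra).
set (gR := fun x => f (1 - a + x) - w * Z x); set (gL := fun x => f (- a + x) - w * Y x).
assert (CgR : cont gR) by (unfold gR; solve_cont).
assert (CgL : cont gL) by (unfold gL; solve_cont).
assert (EgL : forall x, 0 <= x <= l -> gL x = / eta * g (- a + x)).
  intros x Hx; unfold gL, g; rewrite avg_left by auto; fold (Y x); unfold w; field; auto.
assert (EgR : forall x, 0 <= x <= l -> gR x = / eta * g (1 - a + x)).
  intros x Hx; unfold gR, g; rewrite avg_right by auto.
  assert (E : Z x = Int f (- a + x) a).
    unfold Z, I, X; rewrite <- (Int_concat f (- a) (- a + x) a) by auto; ring.
  rewrite <- E; unfold w; field; auto.
assert (Hforce : forall x p q, 0 <= x <= l -> cont p -> cont q ->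
  (forall y, Rabs (p y) <= 1) -> (forall y, Rabs (q y) <= 1) ->
  Rabs (Int (fun y => gR y * p y + gL y * q y) 0 x) <= ka * G).
  intros x p q Hx Hp Hq Bp Bq.
  apply Rle_trans with (Int (fun y => ka * (Rabs (g (1 - a + y)) + Rabs (g (- a + y)))) 0 x).
  - apply Int_abs_bound; [lra|solve_cont..|].
    intros y Hy; rewrite EgR, EgL by lra.
    eapply Rle_trans; [apply Rabs_triang|].
    eapply Rle_trans; [apply Rplus_le_compat; apply Rabs_mult_le_l; auto|].
    rewrite !Rabs_mult; fold ka; lra.
  - rewrite Int_mulc by solve_cont; apply Rmult_le_compat_l; [lra|].
    eapply Rle_trans; [apply (Int_widen _ 0 x 0 l); try lra; [solve_cont|]|].
      intro y; pose proof (Rabs_pos (g (1 - a + y))); pose proof (Rabs_pos (g (- a + y))); lra.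
    rewrite Int_add by solve_cont; unfold G; rewrite (Int_three (fun t => Rabs (g t))) by solve_cont.
    assert (0 <= Int (fun t => Rabs (g t)) (a - 1) (1 - a)); [|lra].
    apply Int_pos; [lra|solve_cont|intros; apply Rabs_pos].
set (c := Y 0).
(* Variation of constants: in rotating coordinates the free motion is constant, so [U] and [V] move
   away from their initial values only through the forcing. *)
set (U := fun x => Y x * cos (w * x) - Z x * sin (w * x)).
set (V := fun x => Y x * sin (w * x) + Z x * cos (w * x)).
assert (EZ0 : Z 0 = I) by (unfold Z, X; rewrite Rplus_0_r, Int_same; ring).
assert (HU : forall x, 0 <= x <= l -> Rabs (U x - c) <= ka * G).
  intros x Hx.
  replace (U x - c) with (Int (fun y => gR y * cos (w * y) + gL y * sin (w * y)) 0 x).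
  - apply Hforce; auto; try solve_cont; intro; [apply Rabs_cos_le|apply Rabs_sin_le].
  - rewrite (Int_primitive U).
    + unfold U at 2; rewrite Rmult_0_r, cos_0, sin_0; unfold c; ring.
    + intro y; apply (is_derive_R_ext (fun x => Y x * cos (w * x) + (- Z x) * sin (w * x))).
        intro z; unfold U; ring.
      replace (gR y * cos (w * y) + gL y * sin (w * y)) with
        ((f (1 - a + y) + w * (- Z y)) * cos (w * y) + (f (- a + y) - w * Y y) * sin (w * y))
        by (unfold gR, gL; ring).
      exact (is_derive_mul_cos_sin Y (fun x => - Z x) _ _ w y (DY y) (DZn y)).
    + solve_cont.
assert (HV : forall x, 0 <= x <= l -> Rabs (V x - I) <= ka * G).
  intros x Hx.
  replace (V x - I) with (Int (fun y => gR y * sin (w * y) + gL y * (- cos (w * y))) 0 x).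
  - apply Hforce; auto; try solve_cont; intro; [apply Rabs_sin_le|].
    rewrite Rabs_Ropp; apply Rabs_cos_le.
  - rewrite (Int_primitive V).
    + unfold V at 2; rewrite Rmult_0_r, cos_0, sin_0, EZ0; ring.
    + intro y; apply (is_derive_R_ext (fun x => Z x * cos (w * x) + Y x * sin (w * x))).
        intro z; unfold V; ring.
      replace (gR y * sin (w * y) + gL y * - cos (w * y)) with
        ((- f (- a + y) + w * Y y) * cos (w * y) + (f (1 - a + y) - w * Z y) * sin (w * y))
        by (unfold gR, gL; ring).
      exact (is_derive_mul_cos_sin Z Y _ _ w y (DZ y) (DY y)).
    + solve_cont.
assert (Hll : 0 <= l <= l) by lra.
pose proof (HU l Hll) as BU; pose proof (HV l Hll) as BV.
assert (Hcs : forall x, sin x * sin x + cos x * cos x = 1) by (intro; apply sin2_cos2).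
assert (EYl : U l * cos th + V l * sin th = I).
  replace I with (Y l); [|unfold Y, I, l; f_equal; ring].
  transitivity (Y l * (sin th * sin th + cos th * cos th)); [unfold U, V; fold th; ring|].
  rewrite Hcs; ring.
assert (EZl : V l * cos th - U l * sin th = Z l).
  transitivity (Z l * (sin th * sin th + cos th * cos th)); [unfold U, V; fold th; ring|].
  rewrite Hcs; ring.
set (m := Int g (a - 1) (1 - a)).
assert (Hm : Rabs m <= G).
  unfold m; eapply Rle_trans; [apply (Int_abs_bound g (fun t => Rabs (g t)))|]; auto; try lra.
  - solve_cont.
  - intros; lra.
  - apply Int_widen; try lra; [solve_cont|intro; apply Rabs_pos].
assert (Emid : Int f (a - 1) (1 - a) = / eta * m + d * w * I).
  unfold m; rewrite (Int_eq g (fun s => eta * f s - / 2 * I)); [|lra|].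
  - rewrite Int_sub, Int_mulc, Int_cst by solve_cont; unfold w, d; field; auto.
  - intros s Hs; unfold g; rewrite avg_mid by auto; reflexivity.
(* The second boundary condition: [Y 0] is the mass of [f] on the left part plus that on the middle
   part, where the equation is explicit. The first one is that [Y l] is the total mass [I]. *)
assert (Ec : c = I - Z l + (/ eta * m + d * w * I)).
  rewrite <- Emid; unfold Z, X, c, Y, l.
  replace (- a + (2 * a - 1)) with (a - 1) by ring; rewrite Rplus_0_r.
  rewrite <- (Int_concat f (- a) (a - 1) (1 - a)) by auto; ring.
assert (Hm' : Rabs (/ eta * m) <= ka * G).
  rewrite Rabs_mult; fold ka; apply Rmult_le_compat_l; lra.
set (r1 := c * cos th - I * S); set (r2 := c * S - I * Ee).
assert (Er1 : r1 = - ((U l - c) * cos th + (V l - I) * sin th)) by (unfold r1, S; lra).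
assert (Er2 : r2 = / eta * m - ((V l - I) * cos th - (U l - c) * sin th)).
  unfold r2, S, Ee; rewrite <- EZl in Ec; lra.
assert (Hr1 : Rabs r1 <= 3 * ka * G).
  rewrite Er1, Rabs_Ropp; eapply Rle_trans; [apply Rabs_triang|].
  pose proof (Rabs_mult_le_l (U l - c) _ (Rabs_cos_le th)).
  pose proof (Rabs_mult_le_l (V l - I) _ (Rabs_sin_le th)).
  assert (0 <= ka * G) by nra; lra.
assert (Hr2 : Rabs r2 <= 3 * ka * G).
  rewrite Er2; eapply Rle_trans; [apply Rabs_triang|]; rewrite Rabs_Ropp.
  eapply Rle_trans; [apply Rplus_le_compat_l, Rabs_triang|]; rewrite Rabs_Ropp.
  pose proof (Rabs_mult_le_l (V l - I) _ (Rabs_cos_le th)).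
  pose proof (Rabs_mult_le_l (U l - c) _ (Rabs_sin_le th)).
  lra.
assert (HS : Rabs S <= 2).
  unfold S; pose proof (SIN_bound th); apply Rabs_le; lra.
assert (Hcos := Rabs_cos_le th).
assert (HI : Rabs I <= K1 * G).
  (* Cramer's rule, here and for [c] below. *)
  replace I with (- (r1 * S - r2 * cos th) / D) by (unfold r1, r2, D; field; exact HD).
  unfold Rdiv; rewrite Rabs_mult, Rabs_Ropp, Rabs_inv.
  replace (K1 * G) with (3 * ka * G * (Rabs Ee + 3) * / Rabs D) by (unfold K1; field; lra).
  apply Rmult_le_compat_r; [apply Rlt_le, Rinv_0_lt_compat; auto|].
  eapply Rle_trans; [apply Rabs_triang|]; rewrite Rabs_Ropp, !Rabs_mult.
  pose proof (Rabs_pos r1); pose proof (Rabs_pos r2); pose proof (Rabs_pos S).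
  pose proof (Rabs_pos (cos th)); pose proof (Rabs_pos Ee).
  apply Rle_trans with (3 * ka * G * 2 + 3 * ka * G * 1); [|nra].
  apply Rplus_le_compat; apply Rmult_le_compat; auto.
assert (Hc : Rabs c <= K1 * G).
  replace c with (- (r1 * Ee - r2 * S) / D) by (unfold r1, r2, D; field; exact HD).
  unfold Rdiv; rewrite Rabs_mult, Rabs_Ropp, Rabs_inv.
  replace (K1 * G) with (3 * ka * G * (Rabs Ee + 3) * / Rabs D) by (unfold K1; field; lra).
  apply Rmult_le_compat_r; [apply Rlt_le, Rinv_0_lt_compat; auto|].
  eapply Rle_trans; [apply Rabs_triang|]; rewrite Rabs_Ropp, !Rabs_mult.
  pose proof (Rabs_pos r1); pose proof (Rabs_pos r2); pose proof (Rabs_pos S).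
  pose proof (Rabs_pos Ee).
  apply Rle_trans with (3 * ka * G * Rabs Ee + 3 * ka * G * 2); [|nra].
  apply Rplus_le_compat; apply Rmult_le_compat; auto; lra.
assert (HUV : forall x, 0 <= x <= l -> Rabs (U x) <= K2 * G /\ Rabs (V x) <= K2 * G).
  intros x Hx; pose proof (HU x Hx); pose proof (HV x Hx); unfold K2; split.
  - replace (U x) with ((U x - c) + c) by ring; eapply Rle_trans; [apply Rabs_triang|]; lra.
  - replace (V x) with ((V x - I) + I) by ring; eapply Rle_trans; [apply Rabs_triang|]; lra.
assert (HYZ : forall x, 0 <= x <= l -> Rabs (Y x) <= 2 * (K2 * G) /\ Rabs (Z x) <= 2 * (K2 * G)).
  intros x Hx; destruct (HUV x Hx) as [B1 B2]; pose proof (Hcs (w * x)) as E; split.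
  - replace (Y x) with (U x * cos (w * x) + V x * sin (w * x)).
    2: { transitivity (Y x * (sin (w * x) * sin (w * x) + cos (w * x) * cos (w * x)));
      [unfold U, V; ring|rewrite E; ring]. }
    eapply Rle_trans; [apply Rabs_triang|].
    pose proof (Rabs_mult_le_l (U x) _ (Rabs_cos_le (w * x))).
    pose proof (Rabs_mult_le_l (V x) _ (Rabs_sin_le (w * x))); lra.
  - replace (Z x) with (V x * cos (w * x) - U x * sin (w * x)).
    2: { transitivity (Z x * (sin (w * x) * sin (w * x) + cos (w * x) * cos (w * x)));
      [unfold U, V; ring|rewrite E; ring]. }
    eapply Rle_trans; [apply Rabs_triang|]; rewrite Rabs_Ropp.
    pose proof (Rabs_mult_le_l (V x) _ (Rabs_cos_le (w * x))).
    pose proof (Rabs_mult_le_l (U x) _ (Rabs_sin_le (w * x))); lra.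
assert (Havg : forall s, - a <= s <= a -> Rabs (avg a f s) <= K2 * G).
  intros s Hs; destruct (Rle_dec s (a - 1)) as [H1|H1].
  - replace s with (- a + (s + a)) by ring.
    rewrite avg_left by (auto; unfold l; lra); fold (Y (s + a)).
    rewrite Rabs_mult, (Rabs_pos_eq (/ 2)) by lra.
    pose proof (proj1 (HYZ (s + a) ltac:(unfold l; lra))); lra.
  - destruct (Rle_dec s (1 - a)) as [H2|H2].
    + rewrite avg_mid by (auto; lra); fold I; rewrite Rabs_mult, (Rabs_pos_eq (/ 2)) by lra.
      unfold K2; assert (0 <= ka * G) by nra; pose proof (Rabs_pos I); lra.
    + replace s with (1 - a + (s - 1 + a)) by ring.
      rewrite avg_right by (auto; unfold l; lra).
      assert (E : Int f (- a + (s - 1 + a)) a = Z (s - 1 + a)).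
        unfold Z, I, X; rewrite <- (Int_concat f (- a) (- a + (s - 1 + a)) a) by auto; ring.
      rewrite E, Rabs_mult, (Rabs_pos_eq (/ 2)) by lra.
      pose proof (proj2 (HYZ (s - 1 + a) ltac:(unfold l; lra))); lra.
apply Rle_trans with (2 * ka ^ 2 * (nrm a g + 2 * a * (K2 * G) ^ 2)).
- unfold nrm.
  replace (2 * a * (K2 * G) ^ 2) with (Int (fun _ => (K2 * G) ^ 2) (- a) a)
    by (rewrite Int_cst; ring).
  rewrite <- Int_add, <- Int_mulc by solve_cont.
  apply Int_mono; [lra|solve_cont..|].
  intros s Hs; specialize (Havg s Hs).
  replace (f s) with (/ eta * (g s + avg a f s)) by (unfold g; field; auto).
  rewrite Rpow_mult_distr, <- (pow2_abs (/ eta)); fold ka.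
  assert (avg a f s ^ 2 <= (K2 * G) ^ 2).
    rewrite <- (pow2_abs (avg a f s)); apply pow_incr; split; [apply Rabs_pos|auto].
  pose proof (pow2_ge_0 (g s - avg a f s)); pose proof (pow2_ge_0 ka).
  replace (2 * ka ^ 2 * (g s ^ 2 + (K2 * G) ^ 2))
    with (ka ^ 2 * (2 * (g s ^ 2 + (K2 * G) ^ 2))) by ring.
  apply Rmult_le_compat_l; auto; nra.
- pose proof (Int_abs_sqr_le a g ltac:(lra) Hg) as HGs; fold G in HGs.
  replace (2 * ka ^ 2 * (1 + 4 * a ^ 2 * K2 ^ 2) * nrm a g)
    with (2 * ka ^ 2 * (nrm a g + 2 * a * K2 ^ 2 * (2 * a * nrm a g))) by ring.
  apply Rmult_le_compat_l; [pose proof (pow2_ge_0 ka); lra|].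
  apply Rplus_le_compat_l; rewrite Rpow_mult_distr, <- Rmult_assoc.
  apply Rmult_le_compat_l; auto; pose proof (pow2_ge_0 K2); nra.
Qed.
(** The construction runs the rotation system backwards: a kernel vector of the singular boundary
    system gives initial values, and [w * Y], [w * I], [w * Z] on the three parts fit together
    continuously because [Y l = I = Z 0]. *)
Lemma avg_eigenfunction eta : eta <> 0 ->
  2 - 2 * sin (/ (2 * eta) * l) - cos (/ (2 * eta) * l) * (1 + d * / (2 * eta)) = 0 ->
  exists f, cont f /\ 0 < nrm a f /\ forall s, - a <= s <= a -> avg a f s = eta * f s.
Proof.
intros He HD; set (w := / (2 * eta)) in *; set (th := w * l) in *.
set (S := 1 - sin th); set (Ee := 1 - cos th + d * w).
assert (HDe : S ^ 2 = cos th * Ee).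
  unfold S, Ee; pose proof (sin2_cos2 th) as E; unfold Rsqr in E; nra.
assert (Hw : w <> 0) by (apply Rinv_neq_0_compat; lra).
(* [(S, cos th)] solves both equations, the second by [HDe]; if it is zero, both left coefficients
   vanish and [(1, 0)] serves. *)
assert (Hker : exists c I, (c <> 0 \/ I <> 0) /\ c * cos th = I * S /\ c * S = I * Ee).
  destruct (Req_dec S 0) as [ES|ES]; [destruct (Req_dec (cos th) 0) as [EC|EC]|].
  - exists 1, 0; rewrite ES, EC; repeat split; try ring; left; lra.
  - exists S, (cos th); repeat split; auto; lra.
  - exists S, (cos th); repeat split; auto; lra.
destruct Hker as (c & I & Hnz & E1 & E2).
set (Y := fun x => c * cos (w * x) + I * sin (w * x)).
set (Z := fun x => I * cos (w * x) - c * sin (w * x)).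
assert (CY : cont Y) by (unfold Y; solve_cont).
assert (CZ : cont Z) by (unfold Z; solve_cont).
assert (Hl0 : 0 <= l) by (unfold l; lra).
set (cl := fun x => Rmax 0 (Rmin l x)).
(* One continuous formula for the three pieces: with clamped arguments the [Z] term equals [I] left
   of the right part and the [Y] term equals [I] right of the left part. *)
set (f := fun s => w * (Y (cl (s + a)) + Z (cl (s + a - 1)) - I)).
assert (Ccl : cont cl) by (unfold cl; solve_cont).
assert (Hf : cont f) by (unfold f; solve_cont).
assert (cl_in : forall x, 0 <= x <= l -> cl x = x).
  intros x Hx; unfold cl; rewrite Rmin_right, Rmax_right; lra.
assert (cl_lo : forall x, x <= 0 -> cl x = 0).
  intros x Hx; unfold cl; apply Rmax_left; rewrite Rmin_right; lra.
assert (cl_hi : forall x, l <= x -> cl x = l).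
  intros x Hx; unfold cl; rewrite Rmin_left, Rmax_right; lra.
assert (Y0 : Y 0 = c) by (unfold Y; rewrite Rmult_0_r, cos_0, sin_0; ring).
assert (Z0 : Z 0 = I) by (unfold Z; rewrite Rmult_0_r, cos_0, sin_0; ring).
assert (Yl : Y l = I) by (unfold Y; fold th; unfold S in E1; lra).
assert (fL : forall x, 0 <= x <= l -> f (- a + x) = w * Y x).
  intros x Hx; unfold f; replace (- a + x + a) with x by ring.
  rewrite cl_in, (cl_lo (x - 1)), Z0 by (unfold l in *; lra); ring.
assert (fR : forall x, 0 <= x <= l -> f (1 - a + x) = w * Z x).
  intros x Hx; unfold f; replace (1 - a + x + a - 1) with x by ring.
  rewrite (cl_in x), cl_hi, Yl by (unfold l in *; lra); ring.
assert (fM : forall s, a - 1 <= s <= 1 - a -> f s = w * I).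
  intros s Hs; unfold f; rewrite cl_hi, cl_lo, Yl, Z0 by (unfold l; lra); ring.
assert (PY : forall x, Int (fun y => w * Z y) 0 x = Y x - c).
  intro x; rewrite (Int_primitive Y); [rewrite Y0; ring| |solve_cont].
  intro y; unfold Y, Z; auto_derive; auto; ring.
assert (PZ : forall x, Int (fun y => w * Y y) 0 x = I - Z x).
  intro x; rewrite (Int_primitive (fun x => - Z x)); [rewrite Z0; ring| |solve_cont].
  intro y; unfold Y, Z; auto_derive; auto; ring.
assert (IL : forall x, 0 <= x <= l -> Int f (- a) (- a + x) = I - Z x).
  intros x Hx; rewrite <- PZ; transitivity (Int (fun y => f (y + - a)) 0 x).
  - rewrite Int_shift by auto; f_equal; ring.
  - apply Int_eq; [lra|]; intros y Hy; rewrite Rplus_comm; apply fL; lra.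
assert (IM : Int f (a - 1) (1 - a) = d * w * I).
  rewrite (Int_eq f (fun _ => w * I)); auto; [rewrite Int_cst; unfold d; ring|lra].
assert (IR : forall x, 0 <= x <= l -> Int f (1 - a) (1 - a + x) = Y x - c).
  intros x Hx; rewrite <- PY; transitivity (Int (fun y => f (y + (1 - a))) 0 x).
  - rewrite Int_shift by auto; f_equal; ring.
  - apply Int_eq; [lra|]; intros y Hy; rewrite Rplus_comm; apply fR; lra.
assert (Zl : Z l = I * cos th - c * sin th) by (unfold Z; fold th; reflexivity).
assert (IY : forall x, 0 <= x <= l -> Int f (- a) (1 - a + x) = Y x).
  intros x Hx.
  rewrite <- (Int_concat f (- a) (a - 1) (1 - a + x)) by auto.
  rewrite <- (Int_concat f (a - 1) (1 - a) (1 - a + x)) by auto.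
  rewrite IM, IR by auto.
  replace (a - 1) with (- a + l) by (unfold l; ring); rewrite IL, Zl by lra.
  unfold S, Ee in E2; lra.
assert (IT : Int f (- a) a = I).
  rewrite <- Yl, <- IY by lra; f_equal; unfold l; ring.
assert (Hew : / 2 = eta * w) by (unfold w; field; auto).
exists f; split; auto; split.
- destruct Hnz as [Hc|HI].
  + apply (nrm_pos a f (- a)); auto; try lra.
    replace (- a) with (- a + 0) by ring; rewrite fL, Y0 by lra.
    now apply Rmult_integral_contrapositive_currified.
  + apply (nrm_pos a f 0); auto; try lra.
    rewrite fM by lra; now apply Rmult_integral_contrapositive_currified.
- intros s Hs; destruct (Rle_dec s (a - 1)) as [H1|H1].
  + replace s with (- a + (s + a)) by ring.
    rewrite avg_left, IY, fL, Hew by (auto; unfold l; lra); ring.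
  + destruct (Rle_dec s (1 - a)) as [H2|H2].
    * rewrite avg_mid, IT, fM, Hew by (auto; lra); ring.
    * replace s with (1 - a + (s - 1 + a)) by ring.
      rewrite avg_right, fR by (auto; unfold l; lra).
      replace (Int f (- a + (s - 1 + a)) a) with (Z (s - 1 + a)); [rewrite Hew; ring|].
      pose proof (Int_concat f (- a) (- a + (s - 1 + a)) a Hf) as E.
      rewrite IL, IT in E by (unfold l; lra); lra.
Qed.

Lemma qform_eigen f eta : cont f -> (forall s, - a <= s <= a -> avg a f s = eta * f s) ->
  qform a f = eta * nrm a f.
Proof.
intros Hf H; unfold qform, nrm; rewrite <- Int_mulc by solve_cont.
apply Int_eq; [lra|]; intros t Ht; rewrite H by auto; ring.
Qed.

Lemma nrm_lin f g t : cont f -> cont g ->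
  nrm a (fun s => f s + t * g s)
  = nrm a f + 2 * t * Int (fun s => f s * g s) (- a) a + t ^ 2 * nrm a g.
Proof.
intros Hf Hg; unfold nrm; rewrite <- !Int_mulc, <- !Int_add by solve_cont.
apply Int_eq_all; intro; ring.
Qed.
Lemma qform_lin f g t : cont f -> cont g ->
  qform a (fun s => f s + t * g s)
  = qform a f + 2 * t * Int (fun s => g s * avg a f s) (- a) a + t ^ 2 * qform a g.
Proof.
intros Hf Hg; pose proof (cont_avg a f Hf); pose proof (cont_avg a g Hg).
replace (2 * t * Int (fun s => g s * avg a f s) (- a) a) with
  (t * Int (fun s => f s * avg a g s) (- a) a + t * Int (fun s => g s * avg a f s) (- a) a)
  by (rewrite (avg_sym f g) by auto; ring).
unfold qform; rewrite <- !Int_mulc, <- !Int_add by solve_cont.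
apply Int_eq_all; intro s.
assert (E : avg a (fun s => f s + t * g s) s = avg a f s + t * avg a g s).
  rewrite <- (Rmult_1_l (avg a f s)), <- avg_lin by auto; unfold avg; f_equal.
  apply Int_eq_all; intro; ring.
rewrite E; ring.
Qed.

Lemma quadratic_discriminant A B D : (forall t, 0 <= A + 2 * t * B + t ^ 2 * D) -> B ^ 2 <= A * D.
Proof.
intros H; pose proof (H 0) as H0; ring_simplify in H0.
destruct (Req_dec D 0) as [ED|ED].
- subst D; destruct (Req_dec B 0) as [EB|EB]; [subst B; lra|].
  pose proof (H (- (A + 1) / (2 * B))) as H1.
  replace (A + 2 * (- (A + 1) / (2 * B)) * B + (- (A + 1) / (2 * B)) ^ 2 * 0) with (-1) in H1
    by (field; auto). lra.
- assert (HD : 0 < D).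
    apply Rnot_le_lt; intro HDn; assert (HDneg : D < 0) by lra.
    pose proof (H ((Rabs B * 2 + A + 1) / - D + 1)) as H1.
    set (t := (Rabs B * 2 + A + 1) / - D + 1) in H1.
    assert (Ht : t * - D = Rabs B * 2 + A + 1 - D) by (unfold t; field; lra).
    assert (Ht1 : 1 <= t).
      unfold t; pose proof (Rabs_pos B).
      assert (0 <= (Rabs B * 2 + A + 1) / - D) by (apply Rdiv_le_0_compat; lra); lra.
    pose proof (Rle_abs B). nra.
  pose proof (H (- B / D)) as H1.
  replace (A + 2 * (- B / D) * B + (- B / D) ^ 2 * D) with ((A * D - B ^ 2) / D) in H1
    by (field; auto).
  apply Rnot_lt_le; intro Hlt.
  assert ((A * D - B ^ 2) / D < 0); [|lra].
  apply Rmult_lt_reg_r with D; auto; unfold Rdiv; rewrite Rmult_assoc, Rinv_l by auto; lra.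
Qed.

(* The top [M] of the form [sg * qform] is an eigenvalue: otherwise [avg_apriori] and the
   Cauchy-Schwarz inequality for the nonnegative form [M - sg * avg] push it down. *)
Lemma top_eigenvalue sg M : sg ^ 2 = 1 -> 0 < M ->
  (forall f, cont f -> sg * qform a f <= M * nrm a f) ->
  (forall M', (forall f, cont f -> sg * qform a f <= M' * nrm a f) -> M <= M') ->
  2 - 2 * sin (/ (2 * (sg * M)) * l) - cos (/ (2 * (sg * M)) * l) * (1 + d * / (2 * (sg * M))) = 0.
Proof.
intros Hsg HM Hub Hleast.
assert (Hsg0 : sg <> 0) by (intro E; rewrite E in Hsg; simpl in Hsg; lra).
assert (He : sg * M <> 0) by (apply Rmult_integral_contrapositive_currified; lra).
match goal with |- ?x = 0 => destruct (Req_dec x 0) as [E|NE]; auto end; exfalso.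
destruct (avg_apriori (sg * M) He NE) as (K & HK & HKf).
assert (HMa : 0 < M + a) by lra.
assert (HKM : 0 < K * (M + a)) by now apply Rmult_lt_0_compat.
(* The improved constant results from two bounds: [nrm f <= K * nrm h], and [nrm h] is at most
   [M + a] times the defect [M * nrm f - sg * qform f]. *)
assert (Hbad : M <= M - / (K * (M + a))).
2: { pose proof (Rinv_0_lt_compat _ HKM); lra. }
apply Hleast; intros f Hf; pose proof (cont_avg a f Hf) as HT.
set (h := fun s => M * f s - sg * avg a f s).
assert (Hh : cont h) by (unfold h; solve_cont).
assert (Hbf : 0 <= M * nrm a f - sg * qform a f) by (specialize (Hub f Hf); lra).
assert (Ha0 : 0 < a) by lra.
pose proof (nrm_nonneg a h Ha0 Hh) as Hnh.
assert (Enh : nrm a (fun s => sg * M * f s - avg a f s) = nrm a h).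
  unfold nrm; apply Int_eq_all; intro s; unfold h.
  replace ((M * f s - sg * avg a f s) ^ 2) with (sg ^ 2 * (sg * M * f s - avg a f s) ^ 2).
    rewrite Hsg; ring.
  transitivity ((sg ^ 2 * M * f s - sg * avg a f s) ^ 2); [ring|rewrite Hsg; ring].
specialize (HKf f Hf); rewrite Enh in HKf.
assert (Hcross : M * Int (fun s => f s * h s) (- a) a - sg * Int (fun s => h s * avg a f s) (- a) a
  = nrm a h).
  unfold nrm; rewrite <- !Int_mulc, <- Int_sub by solve_cont.
  apply Int_eq_all; intro s; unfold h; ring.
(* Cauchy-Schwarz for the nonnegative form of [M - sg * avg] between [f] and [h]; the cross term is
   the integral of [h * h]. *)
assert (Hdisc : nrm a h ^ 2 <= (M * nrm a f - sg * qform a f) * (M * nrm a h - sg * qform a h)).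
  apply quadratic_discriminant; intro t.
  assert (Hc : cont (fun s => f s + t * h s)) by solve_cont.
  specialize (Hub _ Hc); rewrite nrm_lin, qform_lin in Hub by auto.
  replace (2 * t * nrm a h) with (2 * t * (M * Int (fun s => f s * h s) (- a) a
    - sg * Int (fun s => h s * avg a f s) (- a) a)) by (rewrite Hcross; ring).
  lra.
assert (Hqh : M * nrm a h - sg * qform a h <= (M + a) * nrm a h).
  pose proof (qform_bound a h ltac:(lra) Hh) as Hq; apply Rabs_le_between in Hq.
  assert (sg = 1 \/ sg = -1) as [->| ->] by
    (destruct (Rle_dec 0 sg); [left|right]; nra); lra.
assert (Hn : nrm a h <= (M + a) * (M * nrm a f - sg * qform a f)).
  destruct (Req_dec (nrm a h) 0) as [E|E]; [rewrite E; nra|].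
  apply Rmult_le_reg_r with (nrm a h); [lra|]; nra.
assert (Hfin : nrm a f <= K * (M + a) * (M * nrm a f - sg * qform a f)).
  eapply Rle_trans; [exact HKf|]; rewrite Rmult_assoc; apply Rmult_le_compat_l; lra.
apply Rmult_le_reg_l with (K * (M + a)); auto.
replace (K * (M + a) * ((M - / (K * (M + a))) * nrm a f))
  with (K * (M + a) * (M * nrm a f) - nrm a f) by (field; lra).
lra.
Qed.
End Overlap.

(** For [a = Delta / 2] the lengths are [l = Delta - 1] and [d = 2 - Delta], and the determinant is
    twice the difference of 1 and the left side in [eta_eq]. *)
Lemma eta_eq_det Delta eta : eta_eq Delta eta <-> eta <> 0 /\
  2 - 2 * sin (/ (2 * eta) * (2 * (Delta / 2) - 1))
  - cos (/ (2 * eta) * (2 * (Delta / 2) - 1)) * (1 + (2 - 2 * (Delta / 2)) * / (2 * eta)) = 0.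
Proof.
unfold eta_eq; split; intros [He H]; split; auto.
- replace (/ (2 * eta) * (2 * (Delta / 2) - 1)) with ((Delta - 1) / (2 * eta)) by (field; auto).
  replace ((2 - 2 * (Delta / 2)) * / (2 * eta)) with (2 * ((2 - Delta) / (4 * eta))) by (field; auto).
  lra.
- replace (/ (2 * eta) * (2 * (Delta / 2) - 1)) with ((Delta - 1) / (2 * eta)) in H by (field; auto).
  replace ((2 - 2 * (Delta / 2)) * / (2 * eta)) with (2 * ((2 - Delta) / (4 * eta))) in H by (field; auto).
  lra.
Qed.

Lemma eta_eq_eigenfunction Delta eta : 1 < Delta <= 2 -> eta_eq Delta eta ->
  exists f, cont f /\ 0 < nrm (Delta / 2) f /\ qform (Delta / 2) f = eta * nrm (Delta / 2) f.
Proof.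
intros HD H; apply eta_eq_det in H; destruct H as [He H].
destruct (avg_eigenfunction (Delta / 2) ltac:(lra) eta He H) as (f & Hf & Hn & Hs).
exists f; repeat split; auto; apply qform_eigen; auto; lra.
Qed.

(** The sign [sg] treats the largest and the smallest root at once. [M] is the supremum of the
    Rayleigh quotients of [sg * qform]; each root is such a quotient by its eigenfunction, and the
    given root of the right sign makes [M] positive, as [top_eigenvalue] requires. *)
Lemma spectral_top Delta sg eta0 : 1 < Delta <= 2 -> sg ^ 2 = 1 ->
  eta_eq Delta eta0 -> 0 < sg * eta0 ->
  exists M, 0 < M /\ eta_eq Delta (sg * M) /\
    (forall f, cont f -> sg * qform (Delta / 2) f <= M * nrm (Delta / 2) f) /\
    (forall eta, eta_eq Delta eta -> sg * eta <= M).
Proof.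
intros HD Hsg H0 Hp; set (a := Delta / 2); assert (Ha : / 2 < a <= 1) by (unfold a; lra).
assert (Ha0 : 0 < a) by lra.
assert (Hsg1 : sg = 1 \/ sg = -1) by (destruct (Rle_dec 0 sg); [left|right]; nra).
assert (Hbd : forall f, cont f -> sg * qform a f <= a * nrm a f).
  intros f Hf; pose proof (qform_bound a f ltac:(lra) Hf) as Hq; apply Rabs_le_between in Hq.
  destruct Hsg1 as [->| ->]; lra.
set (E := fun r => exists f, cont f /\ 0 < nrm a f /\ sg * qform a f = r * nrm a f).
assert (HE : forall eta, eta_eq Delta eta -> E (sg * eta)).
  intros eta He; destruct (eta_eq_eigenfunction Delta eta HD He) as (f & Hf & Hn & Hq).
  exists f; repeat split; auto; fold a in Hq; rewrite Hq; ring.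
destruct (completeness E) as [M [HMu HMl]].
- exists a; intros r (f & Hf & Hn & Hr); specialize (Hbd f Hf).
  apply Rmult_le_reg_r with (nrm a f); auto; lra.
- exists (sg * eta0); now apply HE.
assert (HM : 0 < M) by (eapply Rlt_le_trans; [exact Hp|]; apply HMu, HE, H0).
assert (Hub : forall f, cont f -> sg * qform a f <= M * nrm a f).
  intros f Hf; pose proof (nrm_nonneg a f Ha0 Hf) as Hn.
  destruct (Req_dec (nrm a f) 0) as [Hz|Hz].
  - specialize (Hbd f Hf); rewrite Hz in *; lra.
  - assert (Hr : sg * qform a f / nrm a f <= M).
      apply HMu; exists f; repeat split; auto; [lra|field; auto].
    apply Rmult_le_compat_r with (r := nrm a f) in Hr; auto.
    unfold Rdiv in Hr; rewrite Rmult_assoc, Rinv_l, Rmult_1_r in Hr; auto.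
assert (Hleast : forall M', (forall f, cont f -> sg * qform a f <= M' * nrm a f) -> M <= M').
  intros M' H; apply HMl; intros r (f & Hf & Hn & Hr); specialize (H f Hf).
  apply Rmult_le_reg_r with (nrm a f); auto; lra.
exists M; split; [auto|split; [|split; [auto|]]].
- apply eta_eq_det; split; [destruct Hsg1 as [->| ->]; lra|].
  exact (top_eigenvalue a Ha sg M Hsg HM Hub Hleast).
- intros eta He; apply HMu, HE, He.
Qed.

(** * From the quadratic form to the ratios of norms *)

Lemma cont_bounded f a b : cont f -> a <= b -> exists B, forall x, a <= x <= b -> Rabs (f x) <= B.
Proof.
intros Hf Hab.
destruct (continuity_ab_maj (fun x => Rabs (f x)) a b Hab) as (m & Hm & _).
- intros c _; apply cont_continuity_pt; solve_cont.
- exists (Rabs (f m)); auto.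
Qed.

Lemma mean_qform a f : 0 < a <= 1 -> cont f -> supported f a ->
  Int (fun t => f t * mean f t) (- a) a = qform a f.
Proof.
intros Ha Hf Hs; apply Int_eq; [lra|]; intros t Ht; f_equal; now apply mean_avg.
Qed.

(** An extremal density may be nonzero at the ends of the interval, whereas [Plancherel] needs
    continuity together with support in [[- a, a]]. A trapezoid with ramps of width [k] repairs this
    at small cost. *)
Lemma cutoff_approx a f e : 0 < a <= 1 -> cont f -> 0 < e -> exists g, cont g /\ supported g a /\
  Rabs (nrm a g - nrm a f) <= e /\ Rabs (qform a g - qform a f) <= e.
Proof.
intros Ha Hf He; destruct (cont_bounded f (- a) a Hf ltac:(lra)) as [B0 HB0].
set (B := Rabs B0 + 1).
assert (HB1 : 1 <= B) by (unfold B; pose proof (Rabs_pos B0); lra).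
assert (HB : forall x, - a <= x <= a -> Rabs (f x) <= B).
  intros x Hx; pose proof (HB0 x Hx); pose proof (Rle_abs B0); unfold B; lra.
(* The cut changes [f] by at most [B] on two ramps, so by at most [2 * B * k] in the mean; each of
   the two errors is then at most [4 * B ^ 2 * k]. *)
set (k := Rmin a (e / (8 * B ^ 2))).
assert (HB2 : 0 < B ^ 2) by (apply pow_lt; lra).
assert (Hk : 0 < k) by (apply Rmin_glb_lt; [lra|apply Rdiv_lt_0_compat; lra]).
assert (Hka : k <= a) by apply Rmin_l.
assert (Hke : 8 * B ^ 2 * k <= e).
  apply Rle_trans with (8 * B ^ 2 * (e / (8 * B ^ 2))).
  - apply Rmult_le_compat_l; [lra|apply Rmin_r].
  - right; field; lra.
set (chi := fun t => Rmax 0 (Rmin 1 ((a - Rabs t) * / k))).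
assert (Cchi : cont chi) by (unfold chi; solve_cont).
assert (Hchi : forall t, 0 <= chi t <= 1).
  intro t; unfold chi; split; [apply Rmax_l|]; apply Rmax_lub; [lra|apply Rmin_l].
assert (Hik : 0 < / k) by now apply Rinv_0_lt_compat.
assert (Hchi1 : forall t, Rabs t <= a - k -> chi t = 1).
  intros t Ht; unfold chi; rewrite Rmin_left, Rmax_right; try lra.
  apply Rmult_le_reg_r with k; auto; rewrite Rmult_assoc, Rinv_l by lra; lra.
assert (Hchi0 : forall t, a < Rabs t -> chi t = 0).
  intros t Ht; unfold chi; rewrite Rmax_left; auto.
  eapply Rle_trans; [apply Rmin_r|]; nra.
set (g := fun t => f t * chi t).
assert (Hg : cont g) by (unfold g; solve_cont).
assert (Hgs : supported g a) by (intros t Ht; unfold g; rewrite Hchi0; auto; ring).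
assert (HgB : forall x, - a <= x <= a -> Rabs (g x) <= B).
  intros x Hx; eapply Rle_trans; [|now apply (HB x)]; apply Rabs_mult_le_l.
  rewrite Rabs_pos_eq; apply Hchi.
set (r := fun t => g t - f t).
assert (Cr : cont r) by (unfold r; solve_cont).
assert (HrB : forall x, - a <= x <= a -> Rabs (r x) <= B).
  intros x Hx; eapply Rle_trans; [|now apply (HB x)].
  unfold r, g; replace (f x * chi x - f x) with (f x * (chi x - 1)) by ring.
  apply Rabs_mult_le_l; specialize (Hchi x); apply Rabs_le; lra.
assert (Hr0 : forall x, Rabs x <= a - k -> r x = 0).
  intros x Hx; unfold r, g; rewrite Hchi1 by auto; ring.
set (R := Int (fun t => Rabs (r t)) (- a) a).
assert (HR : R <= 2 * B * k).
  unfold R; rewrite <- (Int_concat _ (- a) (- a + k) a), <- (Int_concat _ (- a + k) (a - k) a)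
    by solve_cont.
  assert (I1 : Int (fun t => Rabs (r t)) (- a) (- a + k) <= Int (fun _ => B) (- a) (- a + k)).
    apply Int_mono; [lra|solve_cont..|]; intros; apply HrB; lra.
  assert (I2 : Int (fun t => Rabs (r t)) (a - k) a <= Int (fun _ => B) (a - k) a).
    apply Int_mono; [lra|solve_cont..|]; intros; apply HrB; lra.
  assert (I3 : Int (fun t => Rabs (r t)) (- a + k) (a - k) = 0).
    rewrite (Int_eq _ (fun _ => 0)); [rewrite Int_cst; ring|lra|].
    intros t Ht; rewrite Hr0, Rabs_R0; auto; apply Rabs_le; lra.
  rewrite Int_cst in I1, I2; lra.
assert (HR0 : 0 <= R) by (apply Int_pos; [lra|solve_cont|intros; apply Rabs_pos]).
exists g; repeat split; auto.
- unfold nrm; rewrite <- Int_sub by solve_cont.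
  apply Rle_trans with (2 * B * R); [|nra].
  unfold R; rewrite <- Int_mulc by solve_cont.
  apply Int_abs_bound; [lra|solve_cont..|].
  intros t Ht; replace (g t ^ 2 - f t ^ 2) with ((g t + f t) * r t) by (unfold r; ring).
  rewrite Rabs_mult; apply Rmult_le_compat_r; [apply Rabs_pos|].
  eapply Rle_trans; [apply Rabs_triang|]; specialize (HB t Ht); specialize (HgB t Ht); lra.
- pose proof (cont_avg a f Hf) as CTf; pose proof (cont_avg a g Hg) as CTg.
  pose proof (cont_avg a r Cr) as CTr.
  assert (EQ : forall t, g t * avg a g t - f t * avg a f t = g t * avg a r t + r t * avg a f t).
    intro t; assert (E : avg a r t = avg a g t - avg a f t).
      unfold avg, r; rewrite Int_sub by auto; ring.
    rewrite E; unfold r; ring.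
  unfold qform; rewrite <- Int_sub by solve_cont.
  rewrite (Int_eq_all _ _ _ _ EQ).
  apply Rle_trans with (Int (fun t => B * (/ 2 * R) + B * Rabs (r t)) (- a) a).
  + apply Int_abs_bound; [lra|solve_cont..|].
    intros t Ht; eapply Rle_trans; [apply Rabs_triang|]; rewrite !Rabs_mult.
    apply Rplus_le_compat.
    * apply Rmult_le_compat; try apply Rabs_pos; auto; now apply avg_abs_le.
    * rewrite Rmult_comm; apply Rmult_le_compat_r; [apply Rabs_pos|].
      eapply Rle_trans; [now apply avg_abs_le|].
      assert (Int (fun t => Rabs (f t)) (- a) a <= Int (fun _ => B) (- a) a).
        apply Int_mono; [lra|solve_cont..|]; intros; now apply HB.
      rewrite Int_cst in H; nra.
  + rewrite Int_add, (Int_mulc B (fun t => Rabs (r t))), Int_cst by solve_cont; fold R.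
    assert (H1 : 0 <= B * R) by (apply Rmult_le_pos; lra).
    assert (H2 : B * R <= B * (2 * B * k)) by (apply Rmult_le_compat_l; lra).
    assert (H3 : a * (B * R) <= 1 * (B * R)) by (apply Rmult_le_compat_r; lra).
    assert (H4 : 0 < B ^ 2 * k) by now apply Rmult_lt_0_compat.
    lra.
Qed.

Lemma W_sinc x : W x = 1 - sinc (2 * PI * x).
Proof.
unfold W; f_equal; destruct (Req_EM_T x 0) as [->|Hx].
- now rewrite Rmult_0_r, sinc_0.
- rewrite sinc_eq; auto; pose proof PI_RGT_0.
  apply Rmult_integral_contrapositive_currified; lra.
Qed.
Lemma W_bounds x : 0 <= W x <= 2.
Proof. rewrite W_sinc; pose proof (Rabs_sinc_le (2 * PI * x)); apply Rabs_le_between in H; lra. Qed.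

Lemma int_R_lim_sym h k l : (forall x, k x = h x) -> cont h -> (forall x, 0 <= h x) ->
  lim_sym h l -> int_R k = l.
Proof.
intros E Hc H0 Hl; unfold int_R.
assert (H : is_RInt_gen k (Rbar_locally m_infty) (Rbar_locally p_infty) l).
  apply (is_RInt_gen_ext h).
  - apply filter_forall; intros ab x _; symmetry; apply E.
  - now apply RInt_gen_of_lim_sym.
apply (is_RInt_gen_unique k l H).
Qed.

Lemma cont_dens_W F : entire F -> cont (fun x => dens F x * W x).
Proof.
intros HF; pose proof (cont_dens F HF) as Cd; pose proof cont_sinc as Cs.
apply (cont_ext (fun x => dens F x * (1 - sinc (2 * PI * x)))).
  intro; now rewrite W_sinc.
solve_cont.
Qed.

Lemma ratio_eq F I IW : entire F -> lim_sym (dens F) I -> lim_sym (fun x => dens F x * W x) IW ->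
  L2Wnorm F / L2norm F = sqrt IW / sqrt I.
Proof.
intros HF HI HW; unfold L2Wnorm, L2norm.
assert (E1 : int_R (fun x => Cmod (F (RtoC x)) ^ 2) = I).
  apply (int_R_lim_sym (dens F)); auto; [now apply cont_dens|intro; apply dens_nonneg].
assert (E2 : int_R (fun x => Cmod (F (RtoC x)) ^ 2 * W x) = IW).
  apply (int_R_lim_sym (fun x => dens F x * W x)); auto; [now apply cont_dens_W|].
  intro x; pose proof (W_bounds x); pose proof (dens_nonneg F x); nra.
now rewrite E1, E2.
Qed.

Lemma synth_PW Delta g : 0 < Delta -> cont g -> supported g (Delta / 2) ->
  PW Delta (synth g (Delta / 2)) /\
  lim_sym (dens (synth g (Delta / 2))) (nrm (Delta / 2) g).
Proof.
intros HD Hg Hs; set (a := Delta / 2) in *; assert (Ha : 0 <= a) by (unfold a; lra).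
pose proof (entire_synth g a Hg Ha) as HE.
assert (Hl : lim_sym (dens (synth g a)) (nrm a g)).
  apply (lim_sym_ext (fun x => power g a (2 * PI * x))).
    intro x; unfold dens; now rewrite Cmod_synth_sqr.
  now apply Plancherel.
split; auto; split; [auto|split].
- intros e He; exists (2 * Int (fun t => Rabs (g t)) (- a) a); intro z.
  eapply Rle_trans; [now apply (synth_growth g a)|].
  apply Rmult_le_compat_l.
    assert (0 <= Int (fun t => Rabs (g t)) (- a) a); [|lra].
    apply Int_pos; [lra|solve_cont|intros; apply Rabs_pos].
  apply exp_le, Rmult_le_compat_r; [apply Cmod_ge_0|]; unfold a; lra.
- exists (nrm a g); apply (RInt_gen_of_lim_sym (dens (synth g a))); auto.
  + now apply cont_dens.
  + intro; apply dens_nonneg.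
Qed.

Lemma ratio_synth Delta g : 0 < Delta <= 2 -> cont g -> supported g (Delta / 2) ->
  0 < nrm (Delta / 2) g ->
  ratios Delta (sqrt (nrm (Delta / 2) g - qform (Delta / 2) g) / sqrt (nrm (Delta / 2) g)).
Proof.
intros HD Hg Hs Hn; destruct (synth_PW Delta g ltac:(lra) Hg Hs) as [HP Hl].
assert (HF := proj1 HP); set (a := Delta / 2) in *.
exists (synth g a); split; [auto|split].
- destruct (Classical_Prop.classic (exists z, synth g a z <> 0%C)) as [H|H]; auto.
  exfalso; assert (Hz : forall z, synth g a z = 0%C).
    intro z; apply Classical_Prop.NNPP; intro Hz; apply H; now exists z.
  assert (E : nrm a g = 0); [|lra].
  apply (lim_sym_unique (dens (synth g a))); auto.
  (* The zero density counts as odd, so its symmetric limit is 0 and contradicts the positive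
     norm. *)
  apply lim_sym_odd; [now apply cont_dens|].
  intro x; unfold dens; rewrite !Hz, Cmod_0; ring.
- symmetry; apply ratio_eq; auto.
  apply (lim_sym_ext (fun x => power g a (2 * PI * x) - power g a (2 * PI * x) * sinc (2 * PI * x))).
    intro x; unfold dens; rewrite Cmod_synth_sqr, W_sinc; ring.
  pose proof (cont_power g a Hg) as Cp; pose proof cont_sinc as Cs.
  rewrite <- (mean_qform a g) by (auto; unfold a; lra).
  apply lim_sym_minus; [solve_cont|solve_cont| |].
  + apply Plancherel; auto; unfold a; lra.
  + apply Plancherel_sinc; auto; unfold a; lra.
Qed.

Lemma lim_sym_exists k B : cont k -> (forall x, 0 <= k x) ->
  (forall N, 0 <= N -> Int k (- N) N <= B) -> exists l, lim_sym k l.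
Proof.
intros Hc H0 HB.
destruct (completeness (fun r => exists N, 0 <= N /\ r = Int k (- N) N)) as [l [Hu Hl]].
- exists B; intros r (N & HN & ->); auto.
- exists (Int k (- 0) 0), 0; split; [lra|auto].
exists l; intros e He.
assert (Hex : exists N, 0 <= N /\ l - e < Int k (- N) N).
  apply Classical_Prop.NNPP; intro Hn.
  assert (l <= l - e); [|lra].
  apply Hl; intros r (N & HN & ->); apply Rnot_lt_le; intro Hlt; apply Hn; now exists N.
destruct Hex as (N0 & HN0 & Hlt); exists N0; split; auto; intros N HN.
assert (Int k (- N0) N0 <= Int k (- N) N) by (apply Int_widen; auto; lra).
assert (Int k (- N) N <= l) by (apply Hu; exists N; split; auto; lra).
apply Rabs_le; lra.
Qed.

(** The weighted integral exists because [0 <= W <= 2]. The positivity of [I] uses analyticity: a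
    zero integral makes [F] vanish on the line by continuity, hence everywhere by [entire_zero]. *)
Lemma ratio_PW Delta r : 0 < Delta -> ratios Delta r -> exists F I Q,
  entire F /\ exp_type_le (PI * Delta) F /\ lim_sym (dens F) I /\ 0 < I /\
  lim_sym (fun x => dens F x * sinc (2 * PI * x)) Q /\ 0 <= I - Q /\ r = sqrt (I - Q) / sqrt I.
Proof.
intros HD (F & (HF & HT & HS) & [z0 Hz0] & ->).
pose proof (cont_dens F HF) as Cd; pose proof cont_sinc as Cs.
destruct HS as [I HI].
assert (HIl : lim_sym (dens F) I) by (now apply (lim_sym_of_RInt_gen (dens F))).
pose proof (lim_sym_nonneg_bound _ _ Cd (dens_nonneg F) HIl) as HIb.
pose proof (cont_dens_W F HF) as CdW.
assert (HdW : forall x, 0 <= dens F x * W x).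
  intro x; pose proof (W_bounds x); pose proof (dens_nonneg F x); nra.
destruct (lim_sym_exists (fun x => dens F x * W x) (2 * I)) as [IW HIW]; auto.
  intros N HN; apply Rle_trans with (Int (fun x => 2 * dens F x) (- N) N).
  - apply Int_mono; [lra|auto|solve_cont|]; intros x _.
    pose proof (W_bounds x); pose proof (dens_nonneg F x); nra.
  - rewrite Int_mulc by auto; apply Rmult_le_compat_l; [lra|]; apply HIb; lra.
assert (HIpos : 0 < I).
  apply Rnot_le_lt; intro HI0.
  assert (Hzero : forall x, F (x, 0) = 0%C).
    intro x; apply Classical_Prop.NNPP; intro Hx.
    destruct (entire_line F HF) as (C1 & C2 & _).
    pose proof (Rabs_pos x); pose proof (Rle_abs x); pose proof (Rle_abs (- x)).
    rewrite Rabs_Ropp in H1.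
    assert (Hc : forall h, cont h -> h x <> 0 -> (forall t, h t ^ 2 <= dens F t) -> False).
      intros h Hh Hhx Hb.
      pose proof (nrm_pos (Rabs x + 1) h x ltac:(lra) Hh ltac:(lra) Hhx) as Hp.
      assert (nrm (Rabs x + 1) h <= Int (dens F) (- (Rabs x + 1)) (Rabs x + 1)).
        apply Int_mono; [lra|solve_cont..|]; auto.
      pose proof (HIb (- (Rabs x + 1)) (Rabs x + 1) ltac:(lra)); lra.
    destruct (Req_dec (fst (F (x, 0))) 0) as [E1|E1].
    - destruct (Req_dec (snd (F (x, 0))) 0) as [E2|E2].
      + apply Hx, injective_projections; auto.
      + apply (Hc _ C2 E2); intro t; unfold dens; rewrite Cmod_sqr.
        pose proof (pow2_ge_0 (fst (F (t, 0)))); lra.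
    - apply (Hc _ C1 E1); intro t; unfold dens; rewrite Cmod_sqr.
      pose proof (pow2_ge_0 (snd (F (t, 0)))); lra.
  destruct (HT 1 Rlt_0_1) as [A HA].
  apply Hz0, (entire_zero F A (PI * Delta + 1)); auto.
  pose proof PI_RGT_0; nra.
exists F, I, (I - IW).
assert (HQ : lim_sym (fun x => dens F x * sinc (2 * PI * x)) (I - IW)).
  apply (lim_sym_ext (fun x => dens F x - dens F x * W x)); [intro; rewrite W_sinc; ring|].
  now apply lim_sym_minus.
repeat split; auto.
- assert (0 <= IW); [|lra].
  pose proof (lim_sym_nonneg_bound _ _ CdW HdW HIW 0 0 (Rle_refl 0)) as H0.
  now rewrite Int_same in H0.
- replace (I - (I - IW)) with IW by ring; now apply ratio_eq.
Qed.

Lemma ratio_form Delta r al be : 0 < Delta <= 2 -> ratios Delta r ->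
  (forall f, cont f -> 0 <= al * nrm (Delta / 2) f + be * qform (Delta / 2) f) ->
  exists I Q, 0 < I /\ 0 <= I - Q /\ 0 <= al * I + be * Q /\ r = sqrt (I - Q) / sqrt I.
Proof.
intros HD Hr Hf; destruct (ratio_PW Delta r ltac:(lra) Hr)
  as (F & I & Q & HF & HT & HI & HIp & HQ & HIQ & Er).
pose proof (cont_dens F HF) as Cd; pose proof cont_sinc as Cs.
exists I, Q; repeat split; auto.
apply (form_nonneg F Delta I ltac:(lra) HF HT HI al be).
- intros f Hc Hs; rewrite mean_qform by (auto; lra); now apply Hf.
- apply (lim_sym_ext (fun x => al * dens F x + be * (dens F x * sinc (2 * PI * x)))); [intro; ring|].
  apply lim_sym_plus; [solve_cont|solve_cont| |]; apply lim_sym_mulc; auto; solve_cont.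
Qed.

Lemma sqrt_ratio I Q : 0 < I -> 0 <= I - Q -> sqrt (I - Q) / sqrt I = sqrt (1 - Q / I).
Proof.
intros HI HQ; rewrite <- sqrt_div_alt by auto; f_equal; field; lra.
Qed.

(** The eigenvalue relation holds for [f], and the admissible function is the synthesis of a cut-off
    [g]. The tolerance [d] keeps [nrm g] at least half of [nrm f] and thus controls the quotient. *)
Lemma ratio_near Delta M f : 0 < Delta <= 2 -> cont f -> 0 < nrm (Delta / 2) f ->
  qform (Delta / 2) f = M * nrm (Delta / 2) f -> forall e, 0 < e ->
  exists q, ratios Delta (sqrt (1 - q)) /\ Rabs (q - M) <= e.
Proof.
intros HD Hf Hn Hq e He; set (a := Delta / 2) in *; assert (Ha : 0 < a <= 1) by (unfold a; lra).
set (n := nrm a f) in *; pose proof (Rabs_pos M) as HM.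
set (d := Rmin (n / 2) (e * n / (2 * (1 + Rabs M)))).
assert (Hen : 0 < e * n) by now apply Rmult_lt_0_compat.
assert (Hd : 0 < d) by (apply Rmin_glb_lt; [lra|apply Rdiv_lt_0_compat; lra]).
assert (Hd1 : d <= n / 2) by apply Rmin_l.
assert (Hd2 : d * (1 + Rabs M) <= e * n / 2).
  apply Rle_trans with (e * n / (2 * (1 + Rabs M)) * (1 + Rabs M)).
  - apply Rmult_le_compat_r; [lra|apply Rmin_r].
  - right; field; lra.
destruct (cutoff_approx a f d Ha Hf Hd) as (g & Hg & Hgs & B1 & B2).
fold n in B1; rewrite Hq in B2; apply Rabs_le_between in B1, B2.
assert (Hng : 0 < nrm a g) by lra.
exists (qform a g / nrm a g); split.
- rewrite <- sqrt_ratio; auto.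
  + now apply ratio_synth.
  + pose proof (qform_bound a g Ha Hg) as Hb; apply Rabs_le_between in Hb; nra.
- replace (qform a g / nrm a g - M)
    with (((qform a g - M * n) - M * (nrm a g - n)) / nrm a g) by (field; lra).
  unfold Rdiv; rewrite Rabs_mult, Rabs_inv, (Rabs_pos_eq (nrm a g)) by lra.
  apply Rmult_le_reg_r with (nrm a g); auto.
  rewrite Rmult_assoc, Rinv_l, Rmult_1_r by lra.
  eapply Rle_trans; [apply Rabs_triang|]; rewrite Rabs_Ropp, Rabs_mult.
  assert (Rabs (qform a g - M * n) <= d) by (apply Rabs_le; lra).
  assert (Rabs (nrm a g - n) <= d) by (apply Rabs_le; lra).
  nra.
Qed.

Lemma C_lower_eq Delta M f : 0 < Delta <= 2 ->
  (forall h, cont h -> qform (Delta / 2) h <= M * nrm (Delta / 2) h) ->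
  cont f -> 0 < nrm (Delta / 2) f -> qform (Delta / 2) f = M * nrm (Delta / 2) f ->
  C_lower Delta = Finite (sqrt (1 - M)).
Proof.
intros HD HM Hf Hn Hq; apply is_glb_Rbar_unique; split.
- intros r Hr; simpl.
  destruct (ratio_form Delta r M (-1) HD Hr) as (I & Q & HI & HIQ & HF & ->).
    intros h Hh; specialize (HM h Hh); lra.
  rewrite sqrt_ratio by auto; apply sqrt_le_1_alt.
  assert (Q / I <= M); [|lra].
  apply Rmult_le_reg_r with I; auto; unfold Rdiv; rewrite Rmult_assoc, Rinv_l by lra; lra.
- intros b Hb; apply Rbar_not_lt_le; intro Hlt.
  (* [qform_bound] gives [M <= Delta / 2 <= 1], so [sqrt (1 - M)] is a true root and not the default
     0. *)
  assert (HM1 : 0 <= 1 - M).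
    pose proof (qform_bound (Delta / 2) f ltac:(lra) Hf) as Hbd; rewrite Hq in Hbd.
    apply Rabs_le_between in Hbd; assert (M <= Delta / 2); [|lra].
    apply Rmult_le_reg_r with (nrm (Delta / 2) f); lra.
  assert (Hfin : exists c, sqrt (1 - M) < c /\ Rbar_le c b).
    destruct b as [b| |]; simpl in Hlt.
    + exists b; split; [auto|apply Rbar_le_refl].
    + exists (sqrt (1 - M) + 1); split; [lra|exact Logic.I].
    + contradiction.
  destruct Hfin as (c & Hc & Hcb).
  pose proof (sqrt_pos (1 - M)) as Hs0; pose proof (sqrt_sqrt (1 - M) HM1) as Hs.
  (* Half the gap between [c ^ 2] and [1 - M], so that [1 - q] stays below [c ^ 2]. *)
  destruct (ratio_near Delta M f HD Hf Hn Hq ((c * c - (1 - M)) / 2)) as (q & Hr & Hqm); [nra|].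
  pose proof (Rbar_le_trans _ _ _ Hcb (Hb _ Hr)) as Hle; simpl in Hle.
  apply Rabs_le_between in Hqm.
  destruct (Rle_dec 0 (1 - q)) as [H1|H1]; [|rewrite (sqrt_neg_0 (1 - q)) in Hle; lra].
  assert (sqrt (1 - q) < sqrt (c * c)) by (apply sqrt_lt_1_alt; nra).
  rewrite sqrt_square in H by lra; lra.
Qed.

Lemma C_upper_eq Delta m f : 0 < Delta <= 2 ->
  (forall h, cont h -> m * nrm (Delta / 2) h <= qform (Delta / 2) h) ->
  cont f -> 0 < nrm (Delta / 2) f -> qform (Delta / 2) f = m * nrm (Delta / 2) f ->
  C_upper Delta = Finite (sqrt (1 - m)).
Proof.
intros HD HM Hf Hn Hq; apply is_lub_Rbar_unique; split.
- intros r Hr; simpl.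
  destruct (ratio_form Delta r (- m) 1 HD Hr) as (I & Q & HI & HIQ & HF & ->).
    intros h Hh; specialize (HM h Hh); lra.
  rewrite sqrt_ratio by auto; apply sqrt_le_1_alt.
  assert (m <= Q / I); [|lra].
  apply Rmult_le_reg_r with I; auto; unfold Rdiv; rewrite Rmult_assoc, Rinv_l by lra; lra.
- intros b Hb; apply Rbar_not_lt_le; intro Hlt.
  assert (Hfin : exists c, c < sqrt (1 - m) /\ Rbar_le b c).
    destruct b as [b| |]; simpl in Hlt.
    + exists b; split; [auto|apply Rbar_le_refl].
    + contradiction.
    + exists (sqrt (1 - m) - 1); split; [lra|exact Logic.I].
  destruct Hfin as (c & Hc & Hbc).
  destruct (Rlt_dec c 0) as [Hc0|Hc0].
  + destruct (ratio_near Delta m f HD Hf Hn Hq 1 Rlt_0_1) as (q & Hr & _).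
    pose proof (Rbar_le_trans _ _ _ (Hb _ Hr) Hbc) as Hle; simpl in Hle.
    pose proof (sqrt_pos (1 - q)); lra.
  + assert (Hm1 : 0 <= 1 - m).
      apply Rnot_lt_le; intro H; rewrite (sqrt_neg_0 (1 - m)) in Hc; lra.
    pose proof (sqrt_sqrt (1 - m) Hm1) as Hs.
    destruct (ratio_near Delta m f HD Hf Hn Hq ((1 - m - c * c) / 2)) as (q & Hr & Hqm); [nra|].
    pose proof (Rbar_le_trans _ _ _ (Hb _ Hr) Hbc) as Hle; simpl in Hle.
    apply Rabs_le_between in Hqm.
    assert (sqrt (c * c) < sqrt (1 - q)) by (apply sqrt_lt_1_alt; nra).
    rewrite sqrt_square in H by lra; lra.
Qed.

Lemma qform_small a f : 0 < a <= / 2 -> cont f -> qform a f = / 2 * Int f (- a) a ^ 2.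
Proof.
intros Ha Hf; unfold qform.
rewrite (Int_eq _ (fun t => (/ 2 * Int f (- a) a) * f t)); [rewrite Int_mulc by auto; ring|lra|].
intros t Ht; unfold avg; rewrite Rmax_left, Rmin_left by lra; ring.
Qed.

Theorem theorem17 :
  (forall Delta : R, 0 < Delta <= 1 ->
     C_lower Delta = Finite (sqrt (1 - Delta / 2)) /\ C_upper Delta = Finite 1) /\
  (forall Delta : R, 1 < Delta <= 2 ->
     exists eta_p eta_m : R,
       (eta_eq Delta eta_p /\ forall eta, eta_eq Delta eta -> eta <= eta_p) /\
       (eta_eq Delta eta_m /\ forall eta, eta_eq Delta eta -> eta_m <= eta) /\
       C_lower Delta = Finite (sqrt (1 - eta_p)) /\
       C_upper Delta = Finite (sqrt (1 - eta_m))).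
Proof.
split; intros Delta HD.
- assert (Ha : 0 < Delta / 2 <= / 2) by lra; split.
  (* Constants are extremal: for [Delta <= 1] the operator has rank one with range the constants. *)
  + apply (C_lower_eq Delta (Delta / 2) (fun _ => 1)); [lra| |apply cont_const| |].
    * intros h Hh; pose proof (qform_bound (Delta / 2) h ltac:(lra) Hh) as H.
      apply Rabs_le_between in H; lra.
    * apply (nrm_pos _ _ 0); try lra; apply cont_const.
    * rewrite qform_small by (auto using cont_const); unfold nrm; rewrite !Int_cst; field.
  + rewrite <- sqrt_1; replace 1 with (1 - 0) at 1 by ring.
    (* Any density of mean zero is in the kernel of the rank-one operator; the odd function [t] is
       one. *)
    apply (C_upper_eq Delta 0 (fun t => t)); [lra| |apply cont_id| |].
    * intros h Hh; rewrite qform_small by auto.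
      pose proof (pow2_ge_0 (Int h (- (Delta / 2)) (Delta / 2))); lra.
    * apply (nrm_pos _ _ (Delta / 2)); try lra; apply cont_id.
    * rewrite qform_small, (Int_sym (fun t => t)) by (auto using cont_id).
      rewrite (Int_eq_all _ (fun _ => 0)) by (intro; ring); rewrite Int_cst; ring.
- pose proof PI_RGT_0 as HPI.
  (* A positive root: the argument becomes [PI / 2], where the cosine vanishes and the sine is 1. *)
  assert (E1 : eta_eq Delta ((Delta - 1) / PI)).
    split; [apply Rgt_not_eq, Rdiv_lt_0_compat; lra|].
    replace ((Delta - 1) / (2 * ((Delta - 1) / PI))) with (PI / 2) by (field; lra).
    rewrite cos_PI2, sin_PI2; ring.
  (* A negative root: the argument becomes [- 3 * PI / 2], where again the cosine vanishes and the
     sine is 1. *)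
  assert (E2 : eta_eq Delta (- ((Delta - 1) / (3 * PI)))).
    assert (0 < (Delta - 1) / (3 * PI)) by (apply Rdiv_lt_0_compat; lra).
    split; [lra|].
    replace ((Delta - 1) / (2 * - ((Delta - 1) / (3 * PI)))) with (- (3 * (PI / 2))) by (field; lra).
    rewrite cos_neg, sin_neg, cos_3PI2, sin_3PI2; ring.
  destruct (spectral_top Delta 1 _ HD ltac:(ring) E1) as (Mp & HMp & Ep & Up & Tp).
    rewrite Rmult_1_l; apply Rdiv_lt_0_compat; lra.
  destruct (spectral_top Delta (-1) _ HD ltac:(ring) E2) as (Mm & HMm & Em & Um & Tm).
    assert (0 < (Delta - 1) / (3 * PI)) by (apply Rdiv_lt_0_compat; lra); lra.
  exists (1 * Mp), (-1 * Mm); repeat split; try apply Ep; try apply Em.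
  + intros eta He; specialize (Tp eta He); lra.
  + intros eta He; specialize (Tm eta He); lra.
  + destruct (eta_eq_eigenfunction Delta _ HD Ep) as (f & Hf & Hn & Hq).
    apply (C_lower_eq Delta (1 * Mp) f); auto; [lra|].
    intros h Hh; specialize (Up h Hh); lra.
  + destruct (eta_eq_eigenfunction Delta _ HD Em) as (f & Hf & Hn & Hq).
    apply (C_upper_eq Delta (-1 * Mm) f); auto; [lra|].
    intros h Hh; specialize (Um h Hh); lra.
Qed.
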